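(* Let $G\subseteq \mathrm{GL}(V)$, $\mathfrak a$, $N$, $\theta N$, $\mathcal M=G\cdot x_c\subseteq\mathbb P(V)$, the special flow $\Phi_X$ of $X\in\mathfrak a$, and the fixed point set $\mathcal F_{\mathcal M}$ be as in the context. Let $\preceq_{\mathrm{Br}}$, $\leftarrow_{\mathrm{Sm}}$, $\preceq_{\mathrm{Sm}}$ be the Bruhat relation, the Smale relation and the Smale order on $\mathcal F_{\mathcal M}$, as defined in the context. Then: (i) The relations $\preceq_{\mathrm{Br}}$, $\leftarrow_{\mathrm{Sm}}$ and $\preceq_{\mathrm{Sm}}$ on $\mathcal F_{\mathcal M}$ agree. (ii) For every $x\in\mathcal F_{\mathcal M}$, $\overline{N\cdot x}=\bigcup_{y\preceq_{\mathrm{Br}}x}N\cdot y$ (union over $y\in\mathcal F_{\mathcal M}$). (iii) For every $x\in\mathcal F_{\mathcal M}$, $\overline{\theta(N)\cdot x}=\bigcup_{x\preceq_{\mathrm{Br}}y}\theta(N)\cdot y$ (union over $y\in\mathcal F_{\mathcal M}$). (iv) $\preceq_{\mathrm{Br}}$ is a partial order on $\mathcal F_{\mathcal M}$. Here closures are taken in $\mathcal M$.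
   Context: Group setting. $V$ is a finite-dimensional complex vector space with an inner product $\langle\cdot|\cdot\rangle$, and $\varphi^t$ denotes the transpose (adjoint) of $\varphi\in\mathrm{End}_{\mathbb C}(V)$ with respect to the inner product. The Cartan involution is $\theta(g)=(g^{-1})^t$ on $\mathrm{GL}(V)$, with derivative $\theta(Y)=-Y^t$ on $\mathfrak{gl}(V)=\mathrm{End}_{\mathbb C}(V)$. $G\subseteq\mathrm{GL}(V)$ is a closed connected $\theta$-invariant subgroup whose Lie algebra $\mathfrak g=\{Y\in\mathrm{End}_{\mathbb C}(V)\mid e^{\mathbb RY}\subseteq G\}$ is a complex subspace of $\mathfrak{gl}(V)$. Let $\mathfrak k,\mathfrak p$ be the $(+1)$- and $(-1)$-eigenspaces of $\theta$ on $\mathfrak g$, and let $\mathfrak a$ be a maximal abelian subspace of $\mathfrak p$. Let $\mathfrak a_{\mathbb C}=\mathfrak a+i\mathfrak a$ and $A_{\mathbb C}=\exp(\mathfrak a_{\mathbb C})$. Weights and roots. $V=\bigoplus_{\mu\in\mathcal P}V^\mu$, where $V^\mu=\{v\mid Yv=\mu(Y)v\ \forall Y\in\mathfrak a\}$ and $\mathcal P\subset\mathfrak a^*$ is the finite set of $\mu$ with $V^\mu\ne0$. For $\alpha\in\mathfrak a^*$ put $\mathfrak g^\alpha=\{Y\in\mathfrak g\mid [H,Y]=\alpha(H)Y\ \forall H\in\mathfrak a\}$; $\Delta$ is the set of $\alpha\neq0$ with $\mathfrak g^\alpha\ne0$. Fix $X_o\in\mathfrak a$ with $\alpha(X_o)\neq0$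 for all $\alpha\in\Delta$ and put $\Delta^+=\{\alpha\in\Delta\mid\alpha(X_o)>0\}$. Let $\mathfrak n=\bigoplus_{\alpha\in\Delta^+}\mathfrak g^\alpha$, $N=\exp(\mathfrak n)$, $\theta N=\theta(N)=\exp(\theta\mathfrak n)$. Let $\mathfrak m=\{Y\in\mathfrak k\mid[H,Y]=0\ \forall H\in\mathfrak a\}$, $\mathfrak b=\mathfrak m+\mathfrak a+\mathfrak n$, and let $B$ be the closed subgroup of $G$ generated by $\exp\mathfrak b$. Flag manifold. $\mathbb P(V)$ is the projective space of $V$, $\mathcal M\subseteq\mathbb P(V)$ is a closed $G$-orbit and $x_c\in\mathcal M$ is a $B$-fixed point (one exists), so $\mathcal M=G\cdot x_c$. Special flow. $X\in\mathfrak a$ satisfies $\alpha(X)<0$ for all $\alpha\in\Delta^+$ and $\mu(X)\neq\nu(X)$ for all $\mu\ne\nu$ in $\mathcal P$; $\Phi_X(t)$ is the action of $e^{tX}$ on $\mathbb P(V)$, restricted to $\mathcal M$. $\mathcal F_{\mathcal M}$ is the set of points of $\mathcal M$ fixed by $e^{\mathbb RX}$; equivalently the set of $A_{\mathbb C}$-fixed points in $\mathcal M$. For $x\in\mathcal F_{\mathcal M}$, $\mathcal W^{\pm}_{\mathcal M}(x)=\{y\in\mathcal M\mid\lim_{t\to\pm\infty}e^{tX}\cdot y=x\}$; one has $\mathcal W^+_{\mathcal M}(x)=N\cdot x$ and $\mathcal W^-_{\mathcal M}(x)=(\theta N)\cdot x$. Relations on $\mathcal F_{\mathcal M}$. - Bruhat: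 $x\preceq_{\mathrm{Br}}y$ iff $N\cdot x\subseteq\overline{N\cdot y}$. - Smale relation: $x\leftarrow_{\mathrm{Sm}}y$ iff $\mathcal W^-_{\mathcal M}(y)\cap\mathcal W^+_{\mathcal M}(x)\neq\emptyset$, i.e. $(\theta N)\cdot y\cap N\cdot x\neq\emptyset$. - Smale order: $\preceq_{\mathrm{Sm}}$ is the transitive closure of $\leftarrow_{\mathrm{Sm}}$.
   Formalization: In (i) the Smale relations are reversed: x ⪯_Br y iff y ←_Sm x iff y ⪯_Sm x. As written (i) fails: for SL₂(C) on P¹, X=diag(-1,1), [e1] ⪯_Br [e2], but W⁻([e2])={[e2]} and W⁺([e1])={[e1]} are disjoint. *)

(* Defs.v *)
From HB Require Import structures.
From mathcomp Require Import all_boot all_order all_algebra.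
From mathcomp Require Import complex.
From mathcomp Require Import all_classical all_reals all_analysis.
From Stdlib Require Relation_Definitions Relation_Operators.

Set Implicit Arguments.
Unset Strict Implicit.
Unset Printing Implicit Defensive.

Import Order.TTheory GRing.Theory Num.Theory.
Import numFieldNormedType.Exports.

Local Open Scope classical_set_scope.
Local Open Scope ring_scope.
Local Open Scope complex_scope.

(* The topology of a finite-dimensional complex vector space: the one making
   the coordinate isomorphism with row vectors a homeomorphism (it does not
   depend on the basis).  It is used both for V and for End(V). *)
Section VectorTopology.
Context {R : realType} (W : vectType R[i]).

Definition coords : W -> 'rV[R[i]^o]_(\dim {:W}) :=
  passmx.rVof (vbasis {:W}).

Definition vtop : Type := initial_topology coords.

HB.instance Definition _ := Topological.copy vtop (initial_topology coords).
HB.instance Definition _ := isPointed.Build vtop (0 : W).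

End VectorTopology.

(* P(V) is the set of lines of V with the quotient topology of V \ {0}. *)
Section ProjectiveSpace.
Context {R : realType} (V : vectType R[i]).

Definition pspace : Type := {L : {vspace V} | \dim L == 1}.
HB.instance Definition _ := Choice.copy pspace {L : {vspace V} | \dim L == 1}.

Definition punctured : set (vtop V) := [set v | (v : V) != 0].

Lemma dim_line (v : punctured) : \dim (<[(\val v : V)]>%VS) == 1.
Proof. by rewrite dim_vline (set_valP v). Qed.

Definition pline (v : punctured) : pspace :=
  Sub <[(\val v : V)]>%VS (dim_line v).

Definition proj_open (U : set pspace) : Prop := open (pline @^-1` U).

Lemma proj_openT : proj_open setT.
Proof. by rewrite /proj_open preimage_setT; exact: openT. Qed.

Lemma proj_openI : setI_closed proj_open.
Proof. by move=> A B; exact: openI. Qed.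

Lemma proj_open_bigU (I : Type) (f : I -> set pspace) :
  (forall i, proj_open (f i)) -> proj_open (\bigcup_i f i).
Proof. by move=> fo; apply: bigcup_open => i _; exact: fo. Qed.

HB.instance Definition _ :=
  isOpenTopological.Build pspace proj_openT proj_openI proj_open_bigU.

(* For invertible g the image of a line is a line; the default value taken by
   insubd when this fails is never used for g in GL(V). *)
Definition pact (g : 'End(V)) (x : pspace) : pspace := insubd x (g @: \val x)%VS.

Definition orb (S : set 'End(V)) (x : pspace) : set pspace :=
  [set pact g x | g in S].

End ProjectiveSpace.

Section LinearGroups.
Context {R : realType} {V : vectType R[i]}.
Implicit Types (Y Z g h : 'End(V)) (S G : set 'End(V)).

Definition GL : set 'End(V) := [set g | lker g == 0%VS].

Definition bracket Y Z : 'End(V) := (Y \o Z)%VF - (Z \o Y)%VF.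

Definition powE Y (k : nat) : 'End(V) := iter k (fun Z => (Y \o Z)%VF) \1%VF.

Definition expE Y : 'End(V) :=
  lim (((fun n : nat => \sum_(k < n) (k`!%:R : R[i])^-1 *: powE Y k)
         : nat -> vtop 'End(V)) @ \oo).

Definition is_subgroup G : Prop :=
  [/\ G `<=` GL, G \1%VF,
      forall g h, G g -> G h -> G (g \o h)%VF
    & forall g, G g -> G (g^-1)%VF].

Definition closed_in_GL G : Prop :=
  closure (G : set (vtop 'End(V))) `&` GL `<=` G.

Definition is_rsubspace S : Prop :=
  S 0 /\ forall (r : R) Y Z, S Y -> S Z -> S (r%:C *: Y + Z).

Definition is_csubspace S : Prop :=
  S 0 /\ forall (c : R[i]) Y Z, S Y -> S Z -> S (c *: Y + Z).

Definition lie G : set 'End(V) := [set Y | forall t : R, G (expE (t%:C *: Y))].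

End LinearGroups.

Section Cartan.
Context {R : realType} {V : vectType R[i]} (dot : {dot V for Num.conj}).
Implicit Types (Y Z g : 'End(V)) (S G : set 'End(V)).

Definition adj Y : 'End(V) :=
  xget 0 [set Z : 'End(V) | forall u v : V, dot (Y u) v = dot u (Z v)].

Definition thetaG g : 'End(V) := adj (g^-1)%VF.

Definition thetaL Y : 'End(V) := - adj Y.

Definition kpart G : set 'End(V) := [set Y | lie G Y /\ thetaL Y = Y].

Definition ppart G : set 'End(V) := [set Y | lie G Y /\ thetaL Y = - Y].

Definition is_abelian S : Prop := forall Y Z, S Y -> S Z -> bracket Y Z = 0.

Definition is_maximal_abelian_in_p G (a : set 'End(V)) : Prop :=
  [/\ is_rsubspace a, a `<=` ppart G, is_abelian a
    & forall a' : set 'End(V), is_rsubspace a' -> a' `<=` ppart G ->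
        is_abelian a' -> a `<=` a' -> a' = a].

End Cartan.

(* Elements of the real rdual a^* are functions on the type of elements of a,
   so that Leibniz equality of functionals is equality in a^*. *)
Section Roots.
Context {R : realType} {V : vectType R[i]} (dot : {dot V for Num.conj}).
Context (G a : set 'End(V)).
Implicit Types (mu alpha : a -> R).

Definition rdual : set (a -> R) :=
  [set mu | forall (r : R) (H1 H2 H3 : a),
     \val H3 = r%:C *: \val H1 + \val H2 -> mu H3 = r * mu H1 + mu H2].

Definition weight_space mu : set V :=
  [set v | forall Y : a, (\val Y : 'End(V)) v = (mu Y)%:C *: v].

Definition weight_set : set (a -> R) :=
  [set mu | rdual mu /\ exists2 v, weight_space mu v & v != 0].

Definition root_space alpha : set 'End(V) :=
  [set Y | lie G Y /\
     forall H : a, bracket (\val H) Y = (alpha H)%:C *: Y].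

Definition root_set : set (a -> R) :=
  [set alpha | [/\ rdual alpha, alpha <> (fun=> 0)
     & exists2 Y, root_space alpha Y & Y != 0]].

Definition pos_roots (Xo : a) : set (a -> R) :=
  [set alpha | root_set alpha /\ 0 < alpha Xo].

(* The sum of the positive root spaces, as finite sums of root vectors. *)
Definition nilrad (Xo : a) : set 'End(V) :=
  [set Y | exists s : seq 'End(V),
     (forall Z, Z \in s -> exists2 alpha, pos_roots Xo alpha & root_space alpha Z)
     /\ Y = \sum_(Z <- s) Z].

Definition Ngrp (Xo : a) : set 'End(V) := expE @` nilrad Xo.

Definition thetaN (Xo : a) : set 'End(V) := thetaG dot @` Ngrp Xo.

Definition mpart : set 'End(V) :=
  [set Y | kpart dot G Y /\ forall H : a, bracket (\val H) Y = 0].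

Definition bpart (Xo : a) : set 'End(V) :=
  [set Y | exists Y1 Y2 Y3,
     [/\ mpart Y1, a Y2, nilrad Xo Y3 & Y = Y1 + Y2 + Y3]].

Definition Bgrp (Xo : a) : set 'End(V) :=
  \bigcap_(H in [set H : set 'End(V) | [/\ is_subgroup H, closed_in_GL H,
     H `<=` G & expE @` bpart Xo `<=` H]]) H.

End Roots.

Section Flow.
Context {R : realType} {V : vectType R[i]} (dot : {dot V for Num.conj}).
Context (G a : set 'End(V)) (Xo : a) (M : set (pspace V)) (X : a).

Definition flow (t : R) (y : pspace V) : pspace V :=
  pact (expE (t%:C *: (\val X : 'End(V)))) y.

Definition fixed_points : set (pspace V) :=
  M `&` [set x | forall t : R, flow t x = x].

Definition Wplus (x : pspace V) : set (pspace V) :=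
  M `&` [set y | flow t y @[t --> +oo%R] --> x].

Definition Wminus (x : pspace V) : set (pspace V) :=
  M `&` [set y | flow t y @[t --> -oo%R] --> x].

Definition closure_in (S : set (pspace V)) : set (pspace V) := closure S `&` M.

Definition bruhat (x y : fixed_points) : Prop :=
  orb (Ngrp G Xo) (\val x) `<=` closure_in (orb (Ngrp G Xo) (\val y)).

(* A trajectory witnessing smale x y runs from y (at -oo) to x (at +oo).  Since
   the roots in Delta^+ are negative on X, Wplus x = N . x, so such a trajectory
   stays in N . x and puts y in its closure: smale x y yields bruhat y x, with
   the arguments exchanged. *)
Definition smale (x y : fixed_points) : Prop :=
  Wminus (\val y) `&` Wplus (\val x) !=set0.

Definition smale_order : fixed_points -> fixed_points -> Prop :=
  Relation_Operators.clos_trans fixed_points smale.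

End Flow.

(* Main.v *)
Require Import Defs.
From HB Require Import structures.
From mathcomp Require Import all_boot all_order all_algebra.
From mathcomp Require Import complex spectral.
From mathcomp Require Import all_classical all_reals all_analysis.
From mathcomp Require Import ring lra.
From Stdlib Require Relation_Definitions Relation_Operators.
(** Choose a basis of [V] made of joint eigenvectors of the commuting Hermitian
    operators in [a], and call level of a basis vector its eigenvalue under [X].
    The flow multiplies the coordinate at a basis vector of level [c] by the
    exponential of [t * c]. So the line of a vector tends to the line of its
    component of highest level ([flow_limit]), and a line is fixed when all its
    nonzero coordinates have the same level. Conjugation by exponentials of
    elements of [a] is diagonal on matrix entries, which splits the Lie algebra
    of [G] into root spaces and the centraliser of [a] ([root_decomposition]).
    As the positive roots are negative at [X], the nilradical consists of the
    elements of the Lie algebra that strictly lower the level ([nilradE]), and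
    its image under the Cartan involution of those that strictly raise it. The
    remaining part, which preserves the level, is [a + i a] by maximality of [a]
    ([centralizer_a]), and it fixes every fixed point of the flow, because [X]
    separates the weights.

    The main geometric fact is that the points of [M] near a fixed point [x]
    have the form [n n' x] with [n] in [N] and [n'] in the opposite group
    ([big_cell]). It has two sources. Near the identity the closed group [G] is
    parametrised by exponentials of the three parts of its Lie algebra
    ([local_decomposition]): a product of exponentials has an invertible
    derivative, and transversally to its Lie algebra [G] is discrete. And by
    Baire's theorem elements of [G] near the identity carry [x] to all points of
    [M] near [x] ([orbit_map_open]). The level preserving factor disappears as
    it fixes [x].

    The flow contracts [N] by conjugation, which shows that [N] is the group of
    all [g] in [G] for which [g - 1] lowers the level ([unipP]), and that the
    stable set of [x] is [N x] ([stable_cell]): once a trajectory is in the open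
    cell, its position is [n n' x], and then [n' x] tends to [x] in both
    directions of time, so [n' x = x]. Every trajectory in the closed orbit [M]
    has a limit, so [M] is the union of the sets [N y] ([orb_cover]).

    Everything follows from this. The closure of [N y] is stable under [N], so
    [x] precedes [y] in the Bruhat relation as soon as [x] is in that closure. In
    this case [N y] contains a point [n n' x], hence also [n' x], whose
    trajectory runs between the two fixed points; conversely a point common to
    [N y] and the unstable set of [x] flows backwards to [x] inside [N y]
    ([br_linkP]). Thus the Bruhat relation, clearly transitive, is the Smale
    relation. The closure of [N x] is a union of sets [N y] because both it and
    [M] are ([closure_unip]); reversing the flow exchanges the two unipotent
    groups and gives the closures of the opposite orbits ([closure_opposite]).
    Antisymmetry holds because a trajectory between different fixed points
    joins different levels ([link_level]). *)

Set Implicit Arguments.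
Unset Strict Implicit.
Unset Printing Implicit Defensive.

Import Order.TTheory GRing.Theory Num.Theory.
Import numFieldNormedType.Exports.

Local Open Scope classical_set_scope.
Local Open Scope ring_scope.
Local Open Scope complex_scope.

Import Normc.

(** * Norms on a finite-dimensional complex vector space *)

Section Modulus.
Context {R : realType}.
Implicit Types z w : R[i].

Lemma normc_ge0 z : 0 <= normc z.
Proof. by case: z => a b /=; exact: sqrtr_ge0. Qed.

Lemma normcR (r : R) : normc r%:C = `|r|.
Proof. by rewrite /= expr0n /= addr0 sqrtr_sqr. Qed.

Lemma expRC_neq0 (r : R) : (expR r)%:C != 0.
Proof. by apply/eqP => /(congr1 (@complex.Re R)) /= /eqP; rewrite expR_eq0. Qed.

Lemma normcB z w : normc (z - w) = normc (w - z).
Proof. by rewrite -opprB normcN. Qed.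

Lemma normc_nbhs (z : R[i]^o) (A : set R[i]^o) :
  nbhs z A <-> exists2 e : R, 0 < e & forall w, normc (w - z) < e -> A w.
Proof.
split=> [/nbhs_ballP[e /= e0 zA]|[e e0 zA]].
  case: e e0 zA => a b; rewrite ltcE /= => /andP[/eqP -> a0] zA.
  exists a => // w wz; apply: zA; rewrite -ball_normE /= normc_def ltcR.
  by move: wz; rewrite normcB; case: z w => x y [x' y'].
apply/nbhs_ballP; exists e%:C; first by rewrite /= ltcR.
move=> w; rewrite -ball_normE /= normc_def ltcR => wz; apply: zA.
by rewrite normcB; case: z w wz => a b [c d].
Qed.

Lemma normc_ball_compact (r : R) : compact [set z : R[i]^o | normc z <= r].
Proof.
pose f (p : R * R) : R[i]^o := p.1 +i* p.2.
have fc : continuous f.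
  move=> [a b] A /normc_nbhs[e e0 zA].
  have : nbhs (a, b) (ball a (e / 2) `*` ball b (e / 2)).
    by exists (ball a (e / 2), ball b (e / 2)) => //; split => /=;
       apply: nbhsx_ballx; rewrite divr_gt0.
  apply: filterS => -[c d] [/= ac bd]; apply: zA.
  rewrite -!ball_normE /= in ac bd.
  have -> : f (c, d) - f (a, b) = (c - a)%:C + (d - b)%:C * 'i%C.
    by apply/eqP; rewrite eq_complex /=; apply/andP; split; apply/eqP; ring.
  apply: le_lt_trans (le_normcD _ _) _; rewrite normcM !normcR.
  rewrite (_ : normc 'i%C = 1) ?mulr1; last first.
    by rewrite /= expr0n /= add0r expr1n sqrtr1.
  by rewrite (splitr e) ltrD // distrC.
have Kc : compact (f @` (`[-r, r]%classic `*` `[-r, r]%classic)).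
  apply: continuous_compact; first exact: continuous_subspaceT.
  by apply: compact_setX; exact: segment_compact.
apply: subclosed_compact Kc _.
  rewrite -openC openE => z /= /negP; rewrite -ltNge => rz.
  apply/normc_nbhs; exists (normc z - r); first by rewrite subr_gt0.
  move=> w wz /=; apply/negP; rewrite -ltNge.
  have := le_normcD (z - w) w; rewrite subrK.
  by move: wz; rewrite normcB; lra.
move=> [a b] /= zr.
have ab0 : 0 <= a ^+ 2 + b ^+ 2 by rewrite addr_ge0 // sqr_ge0.
have H (x y : R) : Num.sqrt (x ^+ 2 + y ^+ 2) <= r -> `|x| <= r.
  move=> H; apply: le_trans H; rewrite -sqrtr_sqr ler_sqrt ?lerDl ?sqr_ge0 //.
  by rewrite addr_ge0 // sqr_ge0.
exists (a, b) => //; split; rewrite /= in_itv /= -ler_norml; first exact: H zr.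
by apply: (H b a); rewrite addrC.
Qed.

End Modulus.

Lemma coord_inj (K : fieldType) (U : vectType K) (v w : U) :
  (forall i, coord (vbasis {:U}) i v = coord (vbasis {:U}) i w) -> v = w.
Proof.
move=> vw; rewrite (coord_vbasis (memvf v)) (coord_vbasis (memvf w)).
by apply: eq_bigr => i _; rewrite vw.
Qed.

(* Identities between linear combinations are checked on coordinates. *)
Ltac vring := apply: coord_inj => ?;
  rewrite ?(linearD, linearN) ?linearZ ?(linearD, linearN) ?linearZ /=; ring.

Section Norms.
Context {R : realType} {W : vectType R[i]}.
Implicit Types (v w : W).

Definition is_norm (N : W -> R) : Prop :=
  [/\ forall v w, N (v + w) <= N v + N w,
      forall (a : R[i]) v, N (a *: v) = normc a * N v
    & forall v, N v = 0 -> v = 0].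

Section NormAxioms.
Variable N : W -> R.
Hypothesis hN : is_norm N.

Lemma normD v w : N (v + w) <= N v + N w. Proof. by case: hN. Qed.

Lemma normZ (a : R[i]) v : N (a *: v) = normc a * N v. Proof. by case: hN. Qed.

Lemma norm0 : N 0 = 0.
Proof. by rewrite -(scale0r 0) normZ normc0 mul0r. Qed.

Lemma normN v : N (- v) = N v.
Proof. by rewrite -scaleN1r normZ normcN normc1 mul1r. Qed.

Lemma normB v w : N (v - w) = N (w - v).
Proof. by rewrite -normN opprB. Qed.

Lemma norm_ge0 v : 0 <= N v.
Proof. by have := normD v (- v); rewrite subrr norm0 normN; lra. Qed.

Lemma norm_gt0 v : v != 0 -> 0 < N v.
Proof.
move=> v0; rewrite lt_def norm_ge0 andbT; apply: contra v0 => /eqP.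
by case: hN => _ _ h /h ->.
Qed.

Lemma norm_sum (I : Type) (r : seq I) (P : pred I) (F : I -> W) :
  N (\sum_(i <- r | P i) F i) <= \sum_(i <- r | P i) N (F i).
Proof.
elim/big_ind2 : _ => [|x y z t xy zt|//]; first by rewrite norm0.
by apply: le_trans (normD _ _) _; exact: lerD.
Qed.

End NormAxioms.

Definition nm v : R := \sum_i normc (coord (vbasis {:W}) i v).

Lemma normc_coord_le i v : normc (coord (vbasis {:W}) i v) <= nm v.
Proof.
by rewrite /nm (bigD1 i) //= lerDl sumr_ge0 // => j _; exact: normc_ge0.
Qed.

Lemma nm_is_norm : is_norm nm.
Proof.
split=> [v w|a v|v v0].
- by rewrite -big_split; apply: ler_sum => i _; rewrite linearD le_normcD.
- by rewrite mulr_sumr; apply: eq_bigr => i _; rewrite linearZ normcM.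
- rewrite (coord_vbasis (memvf v)) big1 // => i _.
  have : normc (coord (vbasis {:W}) i v) <= 0 by rewrite -v0 normc_coord_le.
  by rewrite le_eqVlt ltNge normc_ge0 orbF => /eqP/eq0_normc ->; rewrite scale0r.
Qed.

Definition nmD := normD nm_is_norm.
Definition nmZ := normZ nm_is_norm.
Lemma nmZr (a : R) v : nm (a%:C *: v) = `|a| * nm v.
Proof. by rewrite nmZ normcR. Qed.
Definition nm0 := norm0 nm_is_norm.
Definition nmN := normN nm_is_norm.
Definition nmB := normB nm_is_norm.
Definition nm_ge0 := norm_ge0 nm_is_norm.
Definition nm_gt0 := norm_gt0 nm_is_norm.

Lemma nm_normalise v : v != 0 -> nm ((nm v)^-1%:C *: v) = 1.
Proof. by move=> /nm_gt0 v1; rewrite nmZr gtr0_norm ?invr_gt0 // mulVf ?gt_eqF. Qed.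

Lemma vtop_nbhsP (v : vtop W) (A : set (vtop W)) :
  nbhs v A <-> exists2 e : R, 0 < e & forall w : W, nm (w - v) < e -> A w.
Proof.
split=> [|[e e0 vA]].
  rewrite nbhsE => -[B [[C Co <-] Cv] BA].
  have /= [P Pn PC] : nbhs (coords (v : W)) C by exact: open_nbhs_nbhs.
  have Pe i : exists e : R, 0 < e /\
      forall z, normc (z - coord (vbasis {:W}) i v) < e -> P ord0 i z.
    have /normc_nbhs[e e0 eP] := Pn ord0 i.
    by exists e; split=> // z; move: (eP z); rewrite mxE.
  have [e eP] := choice Pe.
  exists (\big[Order.min/1]_i e i).
    by elim/big_ind : _ => // [x y x0 y0|i _]; rewrite ?lt_min ?x0 //; case: (eP i).
  move=> w wv; apply: BA; apply: PC => k i; rewrite ord1 mxE.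
  apply: (eP i).2; rewrite -linearB; apply: le_lt_trans (normc_coord_le _ _) _.
  by apply: lt_le_trans wv _; exact: bigmin_le.
pose S : set 'rV[R[i]^o]_(\dim {:W}) :=
    [set x | forall i, normc (x ord0 i - coord (vbasis {:W}) i v) < e / (\dim {:W}).+1%:R].
have NS : nbhs (coords (v : W)) S.
  exists (fun _ i => [set z | normc (z - coord (vbasis {:W}) i v) < e / (\dim {:W}).+1%:R]).
    move=> k i /=; apply/normc_nbhs; exists (e / (\dim {:W}).+1%:R).
      by rewrite divr_gt0.
    by move=> z; rewrite mxE.
  by move=> x Hx i; exact: Hx.
have : nbhs v (@coords R W @^-1` S) := @initial_continuous W _ (@coords R W) v _ NS.
apply: filterS => w Hw; apply: vA.
apply: (@le_lt_trans _ _ (\sum_(i < \dim {:W}) e / (\dim {:W}).+1%:R)).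
  apply: ler_sum => i _; rewrite linearB; apply: ltW.
  by move: (Hw i); rewrite mxE.
rewrite sumr_const card_ord -[ltLHS]mulr_natr -mulrA gtr_pMr // mulrC.
by rewrite ltr_pdivrMr // mul1r ltr_nat.
Qed.

Lemma nm_ball_nbhs (v : vtop W) (e : R) : 0 < e ->
  nbhs v [set w : vtop W | nm ((w : W) - v) < e].
Proof. by move=> e0; apply/vtop_nbhsP; exists e. Qed.

Lemma nm_continuous : continuous (nm : vtop W -> R).
Proof.
move=> v A /nbhs_ballP[e /= e0 eA]; apply/vtop_nbhsP; exists e => // w vw.
apply: eA; rewrite -ball_normE /=.
have h1 := nmD (w - v) v; have h2 := nmD ((v : W) - w) w.
rewrite !subrK (nmB v w) in h1 h2.
by rewrite ltr_norml; apply/andP; split; lra.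
Qed.

Lemma nm_ball_compact (r : R) : compact [set w : vtop W | nm (w : W) <= r].
Proof.
set n := \dim {:W}.
pose f (x : 'rV[R[i]^o]_n) : vtop W := passmx.vecof (vbasis {:W}) x.
have bW : basis_of {:W} (vbasis {:W}) := vbasisP _.
have fK : cancel f (@coords R W) by move=> x; exact: passmx.vecofK.
have fc : continuous f.
  apply: continuous_comp_initial => x.
  by rewrite (_ : _ \o f = id) //; apply/funext => y /=; exact: fK.
have Kc := rV_compact (A := fun _ : 'I_n => [set z : R[i]^o | normc z <= r])
  (fun i => @normc_ball_compact R r).
have {}Kc := continuous_compact (continuous_subspaceT fc) Kc.
apply: subclosed_compact Kc _.
  have := @closed_comp _ _ (nm : vtop W -> R) _ (in1W nm_continuous) (@closed_le R r).
  exact.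
move=> w /= wr; exists (coords (w : W)); last by apply: passmx.rVofK.
by move=> i /=; rewrite mxE; apply: le_trans wr; exact: normc_coord_le.
Qed.

Lemma nm_closed_compact (A : set (vtop W)) (r : R) :
  closed A -> (forall w, A w -> nm (w : W) <= r) -> compact A.
Proof. move=> cA Ar; exact: subclosed_compact cA (@nm_ball_compact r) Ar. Qed.

Section NormEquivalence.
Variable N : W -> R.
Hypothesis hN : is_norm N.

Lemma norm_upper : exists2 c : R, 0 < c & forall w, N w <= c * nm w.
Proof.
exists (1 + \sum_(i < \dim {:W}) N (vbasis {:W})`_i); first by rewrite ltr_wpDr // sumr_ge0 // => i _; exact: norm_ge0.
move=> w; rewrite {1}(coord_vbasis (memvf w)); apply: le_trans (norm_sum hN _ _ _) _.
rewrite mulrDl mul1r mulr_suml; apply: ler_wpDl; first exact: nm_ge0.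
apply: ler_sum => i _; rewrite (normZ hN) [leRHS]mulrC ler_wpM2r ?norm_ge0 //.
exact: normc_coord_le.
Qed.

Lemma norm_continuous : continuous (N : vtop W -> R).
Proof.
have [c c0 cN] := norm_upper.
move=> v A /nbhs_ballP[e /= e0 eA]; apply/vtop_nbhsP; exists (e / c) => [|w vw].
  by rewrite divr_gt0.
apply: eA; rewrite -ball_normE /=.
have h1 := normD hN (w - v) v; have h2 := normD hN ((v : W) - w) w.
rewrite !subrK (normB hN v w) in h1 h2.
have {}vw : N (w - v) < e.
  by apply: le_lt_trans (cN _) _; rewrite mulrC -ltr_pdivlMr.
by rewrite ltr_norml; apply/andP; split; lra.
Qed.

(** The unit sphere of a given norm is compact, so every other norm has a
    positive minimum on it. *)
Lemma norm_lower : exists2 c : R, 0 < c & forall w, nm w <= c * N w.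
Proof.
have [[w0 w00]|W0] := pselect (exists w : W, w != 0); last first.
  exists 1 => // w; have [->|w0] := eqVneq w 0; first by rewrite nm0 norm0 // mulr0.
  by case: W0; exists w.
pose S : set (vtop W) := [set w | nm (w : W) = 1].
have cS : compact S.
  apply: (@nm_closed_compact _ 1) => [|w ->//].
  have := @closed_comp _ _ (nm : vtop W -> R) _ (in1W nm_continuous) (@closed_eq R 1).
  exact.
have [|w1 w1S w1min] := compact_EVT_min _ cS (continuous_subspaceT norm_continuous).
  by exists ((nm w0)^-1%:C *: w0); exact: nm_normalise.
have N1 : 0 < N w1.
  apply: norm_gt0 => //; apply/eqP => w10; move: w1S; rewrite inE /S /= w10 nm0.
  by move/eqP; rewrite eq_sym oner_eq0.
exists (N w1)^-1 => [|w]; first by rewrite invr_gt0.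
have [->|w0'] := eqVneq w 0; first by rewrite nm0 norm0 // mulr0.
have := w1min _ (mem_set (nm_normalise w0' : S _)).
have w'0 := nm_gt0 w0'.
rewrite normZ // normcR gtr0_norm ?invr_gt0 // => H.
by rewrite mulrC ler_pdivlMr // mulrC -ler_pdivlMr // mulrC.
Qed.

Lemma norm_nbhsP (v : vtop W) (A : set (vtop W)) :
  nbhs v A <-> exists2 e : R, 0 < e & forall w : W, N (w - v) < e -> A w.
Proof.
have [c c0 cN] := norm_upper; have [d d0 dN] := norm_lower.
split=> [/vtop_nbhsP|] [e e0 eA].
  exists (e / d) => [|w wv]; first by rewrite divr_gt0.
  by apply: eA; apply: le_lt_trans (dN _) _; rewrite mulrC -ltr_pdivlMr.
apply/vtop_nbhsP; exists (e / c) => [|w wv]; first by rewrite divr_gt0.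
by apply: eA; apply: le_lt_trans (cN _) _; rewrite mulrC -ltr_pdivlMr.
Qed.

Lemma norm_ball_nbhs (v : vtop W) (e : R) : 0 < e ->
  nbhs v [set w : vtop W | N ((w : W) - v) < e].
Proof. by move=> e0; apply/norm_nbhsP; exists e. Qed.

Lemma norm_closed_compact (A : set (vtop W)) (r : R) :
  closed A -> (forall w, A w -> N (w : W) <= r) -> compact A.
Proof.
have [d d0 dN] := norm_lower.
move=> cA Ar; apply: (@nm_closed_compact _ (d * r)) => // w Aw.
by apply: le_trans (dN _) _; rewrite ler_pM2l // Ar.
Qed.

Lemma norm_ball_compact (r : R) : compact [set w : vtop W | N (w : W) <= r].
Proof.
apply: (@norm_closed_compact _ r) => [|w ->//].
have := @closed_comp _ _ (N : vtop W -> R) _ (in1W norm_continuous) (@closed_le R r).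
exact.
Qed.

Lemma norm_limit1 (v : W) : (forall e : R, 0 < e -> exists2 w, N w = 1 & N (w - v) < e) -> N v = 1.
Proof.
move=> H; apply/eqP; rewrite -subr_eq0 -normr_eq0 eq_le normr_ge0 andbT.
apply/ler_addgt0Pr => e /H[w w1 wv]; rewrite add0r.
have h1 := normD hN (w - v) v; have h2 := normD hN (v - w) w.
rewrite subrK in h1; rewrite subrK (normB hN v) in h2.
by rewrite ler_norml; apply/andP; split; lra.
Qed.

Lemma norm_closedP (A : set (vtop W)) :
  closed A <-> forall v : W, (forall e : R, 0 < e -> exists2 w : W, A w & N (w - v) < e) -> A v.
Proof.
split=> [cA v H|H v cv].
  apply: cA => B /norm_nbhsP[e e0 eB]; have [w Aw we] := H _ e0.
  by exists w; split=> //; exact: eB.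
apply: H => e e0; have [w [Aw we]] := cv _ (norm_ball_nbhs v e0).
by exists w.
Qed.

Lemma norm_closureP (A : set (vtop W)) (v : W) :
  closure A (v : vtop W) <-> forall e : R, 0 < e -> exists2 w : W, A w & N (w - v) < e.
Proof.
split=> [cv e e0|H B /norm_nbhsP[e e0 eB]].
  by have [w [Aw we]] := cv _ (norm_ball_nbhs v e0); exists w.
by have [w Aw we] := H _ e0; exists w; split=> //; exact: eB.
Qed.

Lemma norm_cvgP (u : nat -> W) (l : W) :
  ((u : nat -> vtop W) @ \oo --> (l : vtop W)) <->
  forall e : R, 0 < e -> \forall k \near \oo, N (u k - l) < e.
Proof.
split=> [ul e e0|H A /norm_nbhsP[e e0 eA]]; first exact: (ul _ (norm_ball_nbhs l e0)).
by have := H _ e0; apply: filterS => k; exact: eA.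
Qed.

(** A Cauchy sequence is bounded, and an accumulation point provided by
    compactness of the closed balls is its limit. *)
Lemma norm_complete (u : nat -> W) :
  (forall e : R, 0 < e -> exists n, forall m, (n <= m)%N -> N (u m - u n) <= e) ->
  exists l : W, (u : nat -> vtop W) @ \oo --> (l : vtop W).
Proof.
move=> uC; have [n1 n1P] := uC _ ltr01.
pose B : set (vtop W) := [set w | N (w : W) <= N (u n1) + 1].
have cB : compact B := @norm_ball_compact _.
have uB : ((u : nat -> vtop W) @ \oo) B.
  exists n1 => // m /= n1m; rewrite /B /=.
  have := normD hN (u m - u n1) (u n1); rewrite subrK.
  by have := n1P _ n1m; lra.
have [l [_ cl]] := cB _ _ uB.
exists l; apply/norm_cvgP => e e0.
have [n nP] := uC (e / 4) ltac:(by rewrite divr_gt0).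
have [w [[m /= nm <-] wl]] : [set u m | m in [set m | (n <= m)%N]] `&`
    [set w : vtop W | N ((w : W) - l) < e / 4] !=set0.
  apply: (cl _ _ _ (norm_ball_nbhs _ _)); last by rewrite divr_gt0.
  by exists n => // m /= nm; exists m.
exists n => // k /= nk; rewrite /= in wl.
have h1 := nP _ nm; have h2 := nP _ nk.
have h3 := normD hN (u k - u n) (u n - l); rewrite addrA subrK in h3.
have h4 := normD hN (u n - u m) (u m - l); rewrite addrA subrK (normB hN (u n)) in h4.
by lra.
Qed.

Lemma norm_cvg_le (u : nat -> W) (l w : W) (c : R) :
  (u : nat -> vtop W) @ \oo --> (l : vtop W) ->
  (\forall k \near \oo, N (u k - w) <= c) -> N (l - w) <= c.
Proof.
move=> /norm_cvgP ul uw; apply/ler_addgt0Pr => e e0.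
have [k _ /(_ _ (leqnn k))[h1 h2]] := filterI (ul _ e0) uw.
have := normD hN (l - u k) (u k - w); rewrite addrA subrK (normB hN l).
by lra.
Qed.

Lemma norm_cvg_unique (u : nat -> W) (l l' : W) :
  (u : nat -> vtop W) @ \oo --> (l : vtop W) ->
  (u : nat -> vtop W) @ \oo --> (l' : vtop W) -> l = l'.
Proof.
move=> ul /norm_cvgP ul'; apply/eqP; rewrite -subr_eq0; apply/negP => /negP/(norm_gt0 hN) d0.
have h : \forall k \near \oo, N (u k - l') <= N (l - l') / 2.
  by apply: filterS (ul' (N (l - l') / 2) _) => [k /ltW|]; rewrite ?divr_gt0.
by have := norm_cvg_le ul h; lra.
Qed.

End NormEquivalence.

Lemma vtop_hausdorff : hausdorff_space (vtop W).
Proof.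
move=> v w vw; apply/eqP; rewrite -subr_eq0; apply/negP => /negP/nm_gt0 d0.
have d2 : 0 < nm ((v : W) - w) / 2 by rewrite divr_gt0.
have [z [/= zv zw]] := vw _ _ (nm_ball_nbhs v d2) (nm_ball_nbhs w d2).
have := nmD ((v : W) - z) (z - w); rewrite addrA subrK (nmB v z).
by move: zv zw; lra.
Qed.

End Norms.

(** * The exponential series of an endomorphism *)

Section EndNorm.
Context {R : realType} {V : vectType R[i]}.
Implicit Types (A B : 'End(V)) (v : V).

(** The sum of the norms of the columns, chosen because it is compatible with
    composition. *)
Definition nmE A : R := \sum_(i < \dim {:V}) nm (A (vbasis {:V})`_i).

Lemma nmE_app A v : nm (A v) <= nmE A * nm v.
Proof.
rewrite {1}(coord_vbasis (memvf v)) linear_sum mulr_suml.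
apply: le_trans (norm_sum nm_is_norm _ _ _) _; apply: ler_sum => i _.
by rewrite linearZ nmZ mulrC ler_wpM2l ?nm_ge0 // normc_coord_le.
Qed.

Lemma nmE_is_norm : is_norm nmE.
Proof.
split=> [A B|a A|A A0].
- by rewrite -big_split; apply: ler_sum => i _; rewrite add_lfunE nmD.
- by rewrite mulr_sumr; apply: eq_bigr => i _; rewrite scale_lfunE nmZ.
- apply/lfunP => v; rewrite zero_lfunE.
  have := nmE_app A v; rewrite A0 mul0r => H; apply/eqP; apply/negP => /negP/nm_gt0.
  by lra.
Qed.

Definition nmED := normD nmE_is_norm.
Definition nmEZ := normZ nmE_is_norm.
Lemma nmEZr (a : R) A : nmE (a%:C *: A) = `|a| * nmE A.
Proof. by rewrite nmEZ normcR. Qed.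
Definition nmE0 := norm0 nmE_is_norm.
Definition nmEN := normN nmE_is_norm.
Definition nmEB := normB nmE_is_norm.
Definition nmE_ge0 := norm_ge0 nmE_is_norm.
Definition nmE_gt0 := norm_gt0 nmE_is_norm.

Lemma nmE_comp A B : nmE (A \o B)%VF <= nmE A * nmE B.
Proof.
by rewrite mulr_sumr; apply: ler_sum => i _; rewrite comp_lfunE nmE_app.
Qed.

Lemma nmE_compB A A' B B' :
  nmE ((A \o B) - (A' \o B'))%VF <= nmE (A - A') * nmE B + nmE A' * nmE (B - B').
Proof.
have -> : ((A \o B) - (A' \o B') = ((A - A') \o B) + (A' \o (B - B')))%VF.
  by rewrite comp_lfunDl comp_lfunNl comp_lfunDr comp_lfunNr addrA subrK.
by apply: le_trans (nmED _ _) _; rewrite lerD // nmE_comp.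
Qed.

Lemma comp_cvg (u w : nat -> 'End(V)) A B :
  (u : nat -> vtop 'End(V)) @ \oo --> (A : vtop 'End(V)) ->
  (w : nat -> vtop 'End(V)) @ \oo --> (B : vtop 'End(V)) ->
  (fun n => (u n \o w n)%VF : vtop 'End(V)) @ \oo --> ((A \o B)%VF : vtop 'End(V)).
Proof.
move=> /(norm_cvgP nmE_is_norm) uA /(norm_cvgP nmE_is_norm) wB.
apply/(norm_cvgP nmE_is_norm) => e e0.
pose a := nmE A + 1; pose b := nmE B + 1.
have a0 : 0 < a by rewrite ltr_wpDl // nmE_ge0.
have b0 : 0 < b by rewrite ltr_wpDl // nmE_ge0.
have h1 := uA (e / 2 / b) ltac:(by rewrite !divr_gt0).
have h2 := wB (e / 2 / a) ltac:(by rewrite !divr_gt0).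
have h3 := wB _ ltr01.
apply: filterS (filterI h1 (filterI h2 h3)) => k [k1 [k2 k3]].
apply: le_lt_trans (nmE_compB _ _ _ _) _; rewrite (splitr e); apply: ltrD.
  apply: (@le_lt_trans _ _ (nmE (u k - A) * b)); last by rewrite -ltr_pdivlMr.
  rewrite ler_wpM2l ?nmE_ge0 //.
  by have := nmED (w k - B) B; rewrite subrK /b; lra.
apply: (@le_lt_trans _ _ (a * nmE (w k - B))); last by rewrite mulrC -ltr_pdivlMr.
by rewrite ler_wpM2r ?nmE_ge0 // /a; lra.
Qed.

End EndNorm.

Section Exponential.
Context {R : realType} {V : vectType R[i]}.
Implicit Types (A B Y Z g : 'End(V)) (v : V).

Definition expS A n : 'End(V) := \sum_(k < n) (k`!%:R : R[i])^-1 *: powE A k.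

Lemma expS_S A n : expS A n.+1 = expS A n + (n`!%:R : R[i])^-1 *: powE A n.
Proof. by rewrite /expS big_ord_recr. Qed.

Lemma normc_fact n : normc (n`!%:R : R[i])^-1 = (n`!%:R)^-1 :> R.
Proof.
rewrite normcV; congr (_^-1); rewrite -(rmorph_nat (real_complex R)) normcR.
by rewrite ger0_norm.
Qed.

Lemma powES A k : powE A k.+1 = (A \o powE A k)%VF.
Proof. by []. Qed.

Lemma nmE_powE A k : nmE (powE A k) <= nmE (\1%VF : 'End(V)) * nmE A ^+ k.
Proof.
elim: k => [|k IH]; first by rewrite expr0 mulr1.
rewrite [powE _ _]/= exprS mulrCA; apply: le_trans (nmE_comp _ _) _.
by rewrite ler_wpM2l ?nmE_ge0.
Qed.

Lemma expR_series_le (a : R) n : 0 <= a -> series (exp_coeff a) n <= expR a.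
Proof.
move=> a0; apply: (nondecreasing_cvgn_le _ (is_cvg_series_exp_coeff a)).
apply/nondecreasing_seqP => m; by rewrite seriesSr lerDl exp_coeff_ge0.
Qed.

Lemma nmE_expS_le A n m : (n <= m)%N ->
  nmE (expS A m - expS A n) <=
  nmE (\1%VF : 'End(V)) * (series (exp_coeff (nmE A)) m - series (exp_coeff (nmE A)) n).
Proof.
elim: m => [|m IH]; first by rewrite leqn0 => /eqP ->; rewrite !subrr nmE0 mulr0.
rewrite leq_eqVlt => /predU1P[->|]; first by rewrite !subrr nmE0 mulr0.
rewrite ltnS => /IH{}IH; rewrite expS_S seriesSr [X in nmE X]addrAC [X in _ * X]addrAC mulrDr.
apply: le_trans (nmED _ _) _; apply: lerD => //;
rewrite nmEZ normc_fact /exp_coeff /= mulrA mulrC ler_wpM2r ?invr_ge0 //.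
exact: nmE_powE.
Qed.

Lemma expS_cvg A : (expS A : nat -> vtop 'End(V)) @ \oo --> (expE A : vtop 'End(V)).
Proof.
suff [l /[dup] cvl /cvg_lim El] :
    exists l : 'End(V), (expS A : nat -> vtop 'End(V)) @ \oo --> (l : vtop 'End(V)).
  by rewrite /expE El //; exact: vtop_hausdorff.
apply: (norm_complete nmE_is_norm) => e e0.
pose K := nmE (\1%VF : 'End(V)) + 1.
have K0 : 0 < K by rewrite ltr_wpDl // nmE_ge0.
have /cvgrPdist_lt/(_ (e / K)) := is_cvg_series_exp_coeff (nmE A).
case=> [|n _ /(_ _ (leqnn n)) nP]; first by rewrite divr_gt0.
exists n => m nm; apply: le_trans (nmE_expS_le A nm) _.
apply: (@le_trans _ _ (K * (e / K))); last by rewrite mulrC divfK // gt_eqF.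
have h : series (exp_coeff (nmE A)) m - series (exp_coeff (nmE A)) n <= e / K.
  have := expR_series_le m (nmE_ge0 A); move: nP; rewrite /expR => /ltr_normlW.
  by lra.
apply: (@le_trans _ _ (nmE (\1%VF : 'End(V)) * (e / K))); first by rewrite ler_wpM2l ?nmE_ge0.
by rewrite ler_wpM2r ?divr_ge0 // ?ltW // /K; lra.
Qed.

Lemma expE_unique A B :
  (expS A : nat -> vtop 'End(V)) @ \oo --> (B : vtop 'End(V)) -> expE A = B.
Proof. by move=> AB; exact: (norm_cvg_unique nmE_is_norm (@expS_cvg A) AB). Qed.

Lemma nmE_powB A B r k : nmE A <= r -> nmE B <= r ->
  nmE (powE A k.+1 - powE B k.+1) <= nmE (A - B) * (k.+1%:R * r ^+ k).
Proof.
move=> Ar Br; have r0 : 0 <= r := le_trans (nmE_ge0 _) Ar.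
elim: k => [|k IH]; first by rewrite /powE /= !comp_lfun1r expr0 !mulr1.
have pA : nmE (powE A k.+1) <= r ^+ k.+1.
  elim: {IH} k => [|k IH]; first by rewrite /powE /= !comp_lfun1r expr1.
  rewrite powES exprS; apply: le_trans (nmE_comp _ _) _.
  by apply: ler_pM => //; exact: nmE_ge0.
rewrite powES (powES B); apply: le_trans (nmE_compB _ _ _ _) _.
have h1 : nmE (A - B) * nmE (powE A k.+1) <= nmE (A - B) * r ^+ k.+1.
  by rewrite ler_wpM2l ?nmE_ge0.
have h2 : nmE B * nmE (powE A k.+1 - powE B k.+1) <=
    r * (nmE (A - B) * (k.+1%:R * r ^+ k)) by apply: ler_pM; rewrite ?nmE_ge0.
apply: le_trans (lerD h1 h2) _; rewrite -[k.+2%:R]natr1 exprS.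
by rewrite le_eqVlt; apply/orP; left; apply/eqP; ring.
Qed.

Lemma exp_coeff_succ (r : R) n :
  (n.+1`!%:R)^-1 * (n.+1%:R * r ^+ n) = exp_coeff r n.
Proof.
rewrite /exp_coeff /= factS natrM invfM mulrA (mulrAC _^-1) mulVf ?pnatr_eq0 //.
by rewrite mul1r mulrC.
Qed.

(** Term by term the difference of the powers of order [k] is at most
    [k * r ^ (k - 1)] times that of the arguments; in sum this gives the
    exponential series without the term that belongs to [k = 1]. *)
Lemma expE_lipschitz A B r : nmE A <= r -> nmE B <= r ->
  nmE (expE A - expE B - (A - B)) <= nmE (A - B) * (expR r - 1).
Proof.
move=> Ar Br; have r0 : 0 <= r := le_trans (nmE_ge0 _) Ar.
have H n : nmE (expS A n.+2 - expS B n.+2 - (A - B)) <=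
    nmE (A - B) * (series (exp_coeff r) n.+1 - 1).
  elim: n => [|n IH].
    rewrite /expS !big_ord_recr !big_ord0 /= !add0r !invr1 !scale1r /powE /= !comp_lfun1r.
    rewrite opprD addrACA subrr add0r subrr nmE0.
    rewrite /series /= big_nat1 /exp_coeff /= expr0 divr1 subrr mulr0 //.
  move: (A - B) IH (nmE_powB n.+1 Ar Br) => D IH powD.
  rewrite expS_S (expS_S B) opprD addrACA -scalerBr [X in nmE X]addrAC.
  apply: le_trans (nmED _ _) _; rewrite seriesSr [X in _ * X]addrAC mulrDr.
  apply: lerD; first exact: IH.
  rewrite nmEZ normc_fact -exp_coeff_succ mulrCA ler_wpM2l ?invr_ge0 ?ler0n //.
apply: (norm_cvg_le nmE_is_norm (u := fun n => expS A n - expS B n)).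
  apply/(norm_cvgP nmE_is_norm) => e e0.
  have :=@expS_cvg A => /(norm_cvgP nmE_is_norm)/(_ (e / 2)).
  have :=@expS_cvg B => /(norm_cvgP nmE_is_norm)/(_ (e / 2)).
  rewrite !divr_gt0 // => /(_ isT) h1 /(_ isT) h2.
  apply: filterS (filterI h1 h2) => n [n1 n2].
  rewrite [X in nmE X](_ : _ = (expS A n - expE A) - (expS B n - expE B)).
    by apply: le_lt_trans (nmED _ _) _; rewrite nmEN; lra.
  by rewrite !opprD addrACA.
exists 2%N => // -[//|[//|n]] _ /=; apply: le_trans (H n) _.
by rewrite ler_wpM2l ?nmE_ge0 // lerD2r expR_series_le.
Qed.

End Exponential.

(** * Algebraic rules for the exponential *)

(** In the product of two truncated series the antidiagonals below the corner are
    those of the product series, and the second sum is the truncation error. *)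
Lemma square_sum (U : zmodType) (f : nat -> nat -> U) n :
  \sum_(0 <= i < n) \sum_(0 <= j < n) f i j =
  \sum_(0 <= k < n) \sum_(0 <= i < k.+1) f i (k - i)%N +
  \sum_(0 <= i < n) \sum_(n - i <= j < n) f i j.
Proof.
have -> : \sum_(0 <= k < n) \sum_(0 <= i < k.+1) f i (k - i)%N =
    \sum_(0 <= i < n) \sum_(0 <= j < n - i) f i j.
  elim: n => [|n IH]; first by rewrite !big_geq.
  rewrite big_nat_recr //= IH [in RHS]big_nat_recr //= subSnn big_nat1.
  rewrite [X in _ + X = _]big_nat_recr //= subnn addrA -big_split /=.
  congr (_ + _); apply: eq_big_nat => i /andP[_ ilt].
  by rewrite subSn ?(ltnW ilt) // big_nat_recr.
rewrite -big_split; apply: eq_big_nat => i /andP[_ ilt].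
by rewrite -big_cat_nat // leq_subr.
Qed.

Section ExponentialAlgebra.
Context {R : realType} {V : vectType R[i]}.
Implicit Types (A B Y Z g : 'End(V)) (v : V).

Lemma expE_dist A B r : nmE A <= r -> nmE B <= r ->
  nmE (expE A - expE B) <= nmE (A - B) * expR r.
Proof.
move=> Ar Br; have := expE_lipschitz Ar Br; rewrite mulrBr mulr1.
by have := nmED (expE A - expE B - (A - B)) (A - B); rewrite subrK; lra.
Qed.

Lemma expE0 : expE (0 : 'End(V)) = \1%VF.
Proof.
apply: expE_unique; apply/(norm_cvgP nmE_is_norm) => e e0.
exists 1%N => // -[//|n] _ /=.
suff -> : expS (0 : 'End(V)) n.+1 = \1%VF by rewrite subrr nmE0.
elim: n => [|n IH]; first by rewrite /expS big_ord1 invr1 scale1r.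
by rewrite expS_S IH powES comp_lfun0l scaler0 addr0.
Qed.

Lemma powE_intertwine A B g k : (g \o A = B \o g)%VF -> (g \o powE A k = powE B k \o g)%VF.
Proof.
move=> gAB; elim: k => [|k IH]; first by rewrite comp_lfun1r comp_lfun1l.
by rewrite !powES comp_lfunA gAB -!comp_lfunA IH.
Qed.

Lemma comp_lfun_suml (I : Type) (r : seq I) (P : pred I) (F : I -> 'End(V)) B :
  ((\sum_(i <- r | P i) F i) \o B = \sum_(i <- r | P i) (F i \o B))%VF.
Proof. by apply: (big_morph (fun A => (A \o B)%VF)) => [x y|]; rewrite ?comp_lfunDl ?comp_lfun0l. Qed.

Lemma comp_lfun_sumr (I : Type) (r : seq I) (P : pred I) (F : I -> 'End(V)) B :
  (B \o (\sum_(i <- r | P i) F i) = \sum_(i <- r | P i) (B \o F i))%VF.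
Proof. by apply: (big_morph (fun A => (B \o A)%VF)) => [x y|]; rewrite ?comp_lfunDr ?comp_lfun0r. Qed.

Lemma cst_cvgE A : (fun=> A : vtop 'End(V)) @ \oo --> (A : vtop 'End(V)).
Proof. by apply/(norm_cvgP nmE_is_norm) => e e0; exists 0%N => // k _ /=; rewrite subrr nmE0. Qed.

(** All partial sums of the series are intertwined, and composition is
    continuous. *)
Lemma expE_intertwine A B g : (g \o A = B \o g)%VF -> (g \o expE A = expE B \o g)%VF.
Proof.
move=> gAB; apply: (norm_cvg_unique nmE_is_norm (u := fun n => (g \o expS A n)%VF)).
  by apply: comp_cvg; [exact: cst_cvgE|exact: expS_cvg].
rewrite (_ : (fun _ => _) = (fun n => (expS B n \o g)%VF)).
  by apply: comp_cvg; [exact: expS_cvg|exact: cst_cvgE].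
apply/funext => n; rewrite /expS comp_lfun_suml comp_lfun_sumr.
apply: eq_bigr => k _.
by rewrite -comp_lfunZr -comp_lfunZl (powE_intertwine _ gAB).
Qed.

(** Composition as the multiplication of a ring, also when [V] is zero, in order
    to have the binomial formula for commuting endomorphisms. *)
Definition endRing : pzRingType := HB.pack 'End(V)
  (GRing.Zmodule_isPzRing.Build 'End(V) (@comp_lfunA _ V V V V) (@comp_lfun1l _ V V)
     (@comp_lfun1r _ V V) (@comp_lfunDl _ V V V) (@comp_lfunDr _ V V V)).

Lemma powE_exp A k : powE A k = (A : endRing) ^+ k.
Proof. by elim: k => // k IH; rewrite powES IH exprS. Qed.

(** Newton's binomial formula turns a partial sum of the exponential of a sum
    into a triangular part of the product of the two partial sums. *)
Lemma expS_comm A B n : (A \o B = B \o A)%VF ->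
  (expS A n \o expS B n)%VF = expS (A + B) n +
  \sum_(0 <= i < n) \sum_(n - i <= j < n)
     ((i`!%:R : R[i])^-1 * (j`!%:R)^-1) *: (powE A i \o powE B j)%VF.
Proof.
move=> AB; rewrite {1 2}/expS comp_lfun_suml.
pose f i j := ((i`!%:R : R[i])^-1 * (j`!%:R)^-1) *: (powE A i \o powE B j)%VF.
transitivity (\sum_(0 <= i < n) \sum_(0 <= j < n) f i j).
  rewrite big_mkord; apply: eq_bigr => i _; rewrite comp_lfun_sumr big_mkord.
  by apply: eq_bigr => j _; rewrite -comp_lfunZl -comp_lfunZr scalerA.
rewrite square_sum; congr (_ + _); rewrite /expS big_mkord; apply: eq_bigr => k _.
rewrite powE_exp (_ : (A + B)%R = (B + A)%R :> endRing); last exact: addrC.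
rewrite exprDn_comm; last exact/esym/AB.
rewrite scaler_sumr big_mkord; apply: eq_bigr => i _; rewrite /f.
have -> : ((B : endRing) ^+ (k - i) * (A : endRing) ^+ i) = (powE A i \o powE B (k - i))%VF.
  rewrite -!powE_exp; apply/esym.
  apply: (@powE_intertwine B B (powE A i)); apply/esym; exact: powE_intertwine.
set P := (powE A i \o powE B (k - i))%VF.
have -> : P *+ 'C(k, i) = ('C(k, i)%:R : R[i]) *: P by rewrite scaler_nat.
rewrite scalerA; congr (_ *: _).
have ik : (i <= k)%N by rewrite -ltnS.
have fn0 m : (m`!%:R : R[i]) != 0 by rewrite pnatr_eq0 -lt0n fact_gt0.
apply: (mulfI (fn0 k)); rewrite mulVKf // -(bin_fact ik) !natrM.
by rewrite -invfM mulfK // mulf_neq0.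
Qed.

(** The terms of the product of two partial sums that are missing from the partial
    sum for [A + B] are bounded by the corresponding terms for the real numbers
    [nmE A] and [nmE B], which tend to zero by the functional equation of the
    real exponential. *)
Lemma expED A B : (A \o B = B \o A)%VF -> expE (A + B) = (expE A \o expE B)%VF.
Proof.
move=> AB; apply/esym.
apply: (norm_cvg_unique nmE_is_norm (u := fun n => (expS A n \o expS B n)%VF)).
  by apply: comp_cvg; exact: expS_cvg.
apply/(norm_cvgP nmE_is_norm) => e e0.
pose K := nmE (\1%VF : 'End(V)); pose a := nmE A; pose b := nmE B.
pose S x n := series (exp_coeff x) n : R.
have bound n : nmE (\sum_(0 <= i < n) \sum_(n - i <= j < n)
     ((i`!%:R : R[i])^-1 * (j`!%:R)^-1) *: (powE A i \o powE B j)%VF) <=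
   K ^+ 2 * (S a n * S b n - S (a + b) n).
  have -> : S a n * S b n - S (a + b) n =
      \sum_(0 <= i < n) \sum_(n - i <= j < n) (exp_coeff a i * exp_coeff b j).
    apply/eqP; rewrite subr_eq addrC; apply/eqP.
    have -> : S (a + b) n = \sum_(0 <= k < n) \sum_(0 <= i < k.+1) (exp_coeff a i * exp_coeff b (k - i)%N).
      apply: eq_bigr => k _; rewrite {1}/exp_coeff /= addrC exprDn_comm; last exact: mulrC.
      rewrite mulr_suml big_mkord; apply: eq_bigr => i _; rewrite /exp_coeff /=.
      have ik : (i <= k)%N by rewrite -ltnS.
      have fn0 m : (m`!%:R : R) != 0 by rewrite pnatr_eq0 -lt0n fact_gt0.
      rewrite -mulr_natl -(bin_fact ik) !natrM.
      have c0 : ('C(k, i)%:R : R) != 0 by rewrite pnatr_eq0 -lt0n bin_gt0.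
      by field; rewrite c0 !fn0.
    rewrite -square_sum /S /series /= mulr_suml; apply: eq_bigr => i _.
    by rewrite mulr_sumr.
  rewrite mulr_sumr; apply: le_trans (norm_sum nmE_is_norm _ _ _) _.
  apply: ler_sum => i _; rewrite mulr_sumr.
  apply: le_trans (norm_sum nmE_is_norm _ _ _) _.
  apply: ler_sum => j _; rewrite nmEZ normcM !normc_fact.
  have h := ler_pM (nmE_ge0 _) (nmE_ge0 _) (nmE_powE A i) (nmE_powE B j).
  apply: (@le_trans _ _ ((i`!%:R)^-1 / j`!%:R * (K * a ^+ i * (K * b ^+ j)))).
    rewrite ler_wpM2l ?mulr_ge0 ?invr_ge0 ?ler0n //.
    exact: le_trans (nmE_comp _ _) h.
  rewrite /exp_coeff /= le_eqVlt; apply/orP; left; apply/eqP.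
  by ring.
have SL x : S x @ \oo --> expR x := is_cvg_series_exp_coeff x.
have L : (fun n => K ^+ 2 * (S a n * S b n - S (a + b) n)) @ \oo --> (0 : R).
  rewrite -(mulr0 (K ^+ 2)) -(subrr (expR (a + b))) {1}expRD.
  apply: cvgMr; apply: cvgB; [by apply: cvgM; exact: SL|exact: SL].
have e2 : 0 < e / 2 by rewrite divr_gt0.
have /(norm_cvgP nmE_is_norm)/(_ _ e2) h1 := @expS_cvg R V (A + B).
have /cvgrPdist_lt/(_ _ e2) h2 := L.
apply: filterS (filterI h1 h2) => n [n1]; rewrite sub0r normrN => /ltr_normlW n2.
rewrite expS_comm // addrAC; apply: le_lt_trans (nmED _ _) _.
by have := bound n; lra.
Qed.

Lemma expEN A : (expE A \o expE (- A) = \1)%VF.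
Proof. by rewrite -expED ?subrr ?expE0 // comp_lfunNl comp_lfunNr. Qed.

Lemma expNE A : (expE (- A) \o expE A = \1)%VF.
Proof. by have := expEN (- A); rewrite opprK. Qed.

Lemma expE_GL A : GL (expE A).
Proof.
apply/lker0P => u v /(congr1 (expE (- A))).
by rewrite -!comp_lfunE expNE !id_lfunE.
Qed.

Lemma inv_unique A B : (A \o B = \1)%VF -> (B \o A = \1)%VF -> (A^-1 = B)%VF.
Proof.
move=> AB BA; have A0 : lker A == 0%VS.
  by apply/lker0P => u v /(congr1 B); rewrite -!comp_lfunE BA !id_lfunE.
by rewrite -[LHS]comp_lfun1r -AB lker0_compKf.
Qed.

Lemma expEV A : ((expE A)^-1 = expE (- A))%VF.
Proof. by apply: inv_unique; rewrite ?expEN ?expNE. Qed.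

Lemma expE_conj A g : GL g -> expE (g \o A \o g^-1)%VF = (g \o expE A \o g^-1)%VF.
Proof.
move=> g0; have H : (g \o expE A = expE (g \o A \o g^-1) \o g)%VF.
  by apply: expE_intertwine; rewrite lker0_compfVK.
by rewrite H (lker0_compfK g0).
Qed.

Lemma expE_nat A m : expE (m%:R *: A) = powE (expE A) m.
Proof.
elim: m => [|m IH]; first by rewrite scale0r expE0.
rewrite -natr1 scalerDl scale1r addrC expED ?IH //.
by rewrite -comp_lfunZl -comp_lfunZr.
Qed.

Lemma expE_eigen A (r : R) v : A v = r%:C *: v -> expE A v = (expR r)%:C *: v.
Proof.
move=> Av; apply/eqP; rewrite -subr_eq0; apply/negP => /negP/nm_gt0 d0.
have pw k : powE A k v = (r ^+ k)%:C *: v.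
  elim: k => [|k IH]; first by rewrite id_lfunE scale1r.
  by rewrite powES comp_lfunE IH linearZ /= Av scalerA -rmorphM -exprSr.
have Sn n : expS A n v = (series (exp_coeff r) n)%:C *: v.
  elim: n => [|n IH]; first by rewrite /expS big_ord0 /series /= big_geq // scale0r zero_lfunE.
  rewrite expS_S add_lfunE IH scale_lfunE pw seriesSr rmorphD scalerDl scalerA.
  by congr (_ + _ *: _); rewrite /exp_coeff /= mulrC rmorphM fmorphV rmorph_nat.
pose e := nm (expE A v - (expR r)%:C *: v) / 2 / (nm v + 1).
have v1 : 0 < nm v + 1 by rewrite ltr_wpDl ?nm_ge0.
have e0 : 0 < e by rewrite !divr_gt0.
have /(norm_cvgP nmE_is_norm)/(_ _ e0) h1 := @expS_cvg R V A.
have /cvgrPdist_lt/(_ _ e0) h2 := is_cvg_series_exp_coeff r.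
have [n _ /(_ _ (leqnn n))[/= n1 n2]] := filterI h1 h2.
have h3 := nmD (expE A v - expS A n v) (expS A n v - (expR r)%:C *: v).
rewrite addrA subrK {2}Sn -scalerBl -rmorphB nmZr distrC in h3.
rewrite -[_ v - _]/(_ - _) -opp_lfunE -add_lfunE in h3.
have h4 := nmE_app (expE A - expS A n) v; rewrite nmEB in h4.
have h5 : nmE (expS A n - expE A) * nm v <= e * nm v by rewrite ler_wpM2r ?nm_ge0 // ltW.
have h6 : `|expR r - series (exp_coeff r) n| * nm v <= e * nm v.
  by rewrite ler_wpM2r ?nm_ge0 // ltW.
have : e * (nm v + 1) = nm (expE A v - (expR r)%:C *: v) / 2 by rewrite divfK // gt_eqF.
by rewrite /= in h3; move: h3 h4 h5 h6 e0; rewrite mulrDr mulr1; lra.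
Qed.

Lemma app_cvg (u : nat -> 'End(V)) A v (e : R) : 0 < e ->
  (u : nat -> vtop 'End(V)) @ \oo --> (A : vtop 'End(V)) ->
  exists n, nm (u n v - A v) < e.
Proof.
move=> e0 /(norm_cvgP nmE_is_norm) uA.
have v1 : 0 < nm v + 1 by rewrite ltr_wpDl ?nm_ge0.
have [n _ /(_ _ (leqnn n)) /= nP] := uA (e / (nm v + 1)) ltac:(by rewrite divr_gt0).
exists n; rewrite -opp_lfunE -add_lfunE; apply: le_lt_trans (nmE_app _ _) _.
apply: (@le_lt_trans _ _ (nmE (u n - A) * (nm v + 1))).
  by rewrite ler_wpM2l ?nmE_ge0 // lerDl.
by rewrite -ltr_pdivlMr.
Qed.

End ExponentialAlgebra.

(** A projection along the subspace is continuous and vanishes on it. *)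
Lemma vspace_closed (R : realType) (W : vectType R[i]) (N : W -> R) (U : {vspace W}) (w : W) :
  is_norm N -> (forall e : R, 0 < e -> exists2 u, u \in U & N (u - w) < e) -> w \in U.
Proof.
move=> hN wU; pose p := (\1 - projv U)%VF.
have pU u : u \in U -> p u = 0.
  by move=> uU; rewrite /p add_lfunE opp_lfunE id_lfunE projv_id // subrr.
suff p0 : p w = 0.
  move/eqP: p0; rewrite /p add_lfunE opp_lfunE id_lfunE subr_eq0 => /eqP ->.
  exact: memv_proj.
have [c c0 cP] := norm_lower hN.
apply/eqP; apply/negP => /negP/nm_gt0 d0.
have p1 : 0 < nmE p + 1 by rewrite ltr_wpDl ?nmE_ge0.
have [u uU uw] := wU (nm (p w) / (nmE p + 1) / c) ltac:(by rewrite !divr_gt0).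
have := nmE_app p (u - w); rewrite linearB /= pU // sub0r nmN.
apply/negP; rewrite -ltNge; move: uw; rewrite !ltr_pdivlMr // => uw.
apply: le_lt_trans uw; rewrite mulrC; apply: ler_pM; rewrite ?nm_ge0 ?nmE_ge0 ?lerDl //.
by rewrite mulrC.
Qed.

Section ExponentialStable.
Context {R : realType} {V : vectType R[i]}.

Lemma expE_stable (A : 'End(V)) (U : {vspace V}) v :
  (forall u, u \in U -> A u \in U) -> v \in U -> expE A v \in U.
Proof.
move=> AU vU.
have pw k : powE A k v \in U.
  by elim: k => [|k IH]; rewrite ?id_lfunE // powES comp_lfunE AU.
have Sn n : expS A n v \in U.
  by rewrite /expS sum_lfunE memv_suml // => k _; rewrite scale_lfunE memvZ.
apply: (vspace_closed nm_is_norm) => e e0.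
have [n nP] := app_cvg v e0 (@expS_cvg _ _ A).
by exists (expS A n v).
Qed.

End ExponentialStable.

(** * Strict derivatives and local surjectivity *)

Section LocalInverse.
Context {R : realType} {V : vectType R[i]}.
Local Notation E := 'End(V).
Implicit Types (f g : E -> E) (L M : 'End('End(V))) (w y : E).

Lemma linear_bound L : exists2 c : R, 0 < c & forall w, nmE (L w) <= c * nmE w.
Proof.
have [c c0 cP] := norm_upper (@nmE_is_norm R V).
have [d d0 dP] := norm_lower (@nmE_is_norm R V).
have l1 : 0 < nmE L + 1 by rewrite ltr_wpDl ?nmE_ge0.
exists (c * (nmE L + 1) * d) => [|w]; first by rewrite !mulr_gt0.
apply: le_trans (cP _) _; rewrite -!mulrA ler_pM2l //.
apply: le_trans (nmE_app _ _) _.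
by apply: ler_pM; rewrite ?nmE_ge0 ?nm_ge0 ?lerDl.
Qed.

(** Strict differentiability at the origin, with derivative [L]. *)
Definition sdiff f L : Prop := forall e : R, 0 < e -> exists2 d : R, 0 < d &
  forall w w', nmE w <= d -> nmE w' <= d ->
    nmE (f w - f w' - L (w - w')) <= e * nmE (w - w').

Lemma sdiff_exp L : sdiff (fun w => expE (L w)) L.
Proof.
move=> e e0; have [c c0 cP] := linear_bound L.
have /cvgrPdist_lt/(_ (e / c)) := @continuous_expR R 0.
rewrite divr_gt0 // => /(_ isT)/nbhs_ballP[r /= r0 rP].
have r2 : 0 < r / 2 by rewrite divr_gt0.
exists (r / 2 / c) => [|w w' wd w'd]; first by rewrite divr_gt0.
have Lr z : nmE z <= r / 2 / c -> nmE (L z) <= r / 2.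
  by move=> zd; apply: le_trans (cP _) _; rewrite mulrC -ler_pdivlMr.
rewrite linearB /=; apply: le_trans (expE_lipschitz (Lr _ wd) (Lr _ w'd)) _.
have : `|expR 0 - expR (r / 2)| < e / c.
  by apply: rP; rewrite -ball_normE /= sub0r normrN gtr0_norm //; lra.
rewrite expR0 distrC => /ltr_normlW/ltW h.
rewrite -linearB /=; apply: (@le_trans _ _ (c * nmE (w - w') * (e / c))).
  apply: ler_pM; rewrite ?nmE_ge0 ?cP //.
  by rewrite subr_ge0 -[leLHS]expR0 ler_expR ltW.
by rewrite mulrAC mulrCA mulfV ?mulr1 ?gt_eqF.
Qed.

Lemma sdiff_bounds f L : f 0 = \1%VF -> sdiff f L ->
  exists2 c : R, 0 < c & forall e : R, 0 < e -> exists2 d : R, 0 < d &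
    forall w w', nmE w <= d -> nmE w' <= d ->
    [/\ nmE (f w - f w' - L (w - w')) <= e * nmE (w - w'),
        nmE (f w - f w') <= c * nmE (w - w'), nmE (L (w - w')) <= c * nmE (w - w')
      & nmE (f w - \1%VF) <= e].
Proof.
move=> f0 fL; have [c c0 cP] := linear_bound L.
exists (c + 1) => [|e e0]; first by rewrite ltr_wpDr.
have [d d0 dP] := fL (Order.min e 1) ltac:(by rewrite lt_min e0 ltr01).
have c1 : 0 < c + 1 by rewrite ltr_wpDr.
exists (Order.min d (e / (c + 1))) => [|w w']; first by rewrite lt_min d0 divr_gt0.
rewrite !le_min => /andP[wd we] /andP[w'd _].
have B z z' : nmE z <= d -> nmE z' <= d -> nmE (f z - f z') <= (c + 1) * nmE (z - z').
  move=> zd z'd; have h1 := dP _ _ zd z'd; have h2 := cP (z - z').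
  have := nmED (f z - f z' - L (z - z')) (L (z - z')); rewrite subrK mulrDl mul1r.
  have h3 : Order.min e 1 * nmE (z - z') <= nmE (z - z').
    by rewrite ler_piMl ?nmE_ge0 // ge_min lexx orbT.
  by lra.
split.
- by apply: le_trans (dP _ _ wd w'd) _; rewrite ler_wpM2r ?nmE_ge0 // ge_min lexx.
- exact: B.
- apply: le_trans (cP _) _; rewrite ler_wpM2r ?nmE_ge0 // lerDl //.
- have := B _ 0 wd; rewrite nmE0 f0 subr0 => /(_ (ltW d0)) h; apply: le_trans h _.
  by rewrite mulrC -ler_pdivlMr.
Qed.

(** The product rule at the identity: as both factors take the value [1] there, the
    derivatives add up. *)
Lemma sdiff_comp f g L M : f 0 = \1%VF -> g 0 = \1%VF -> sdiff f L -> sdiff g M ->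
  sdiff (fun w => (f w \o g w)%VF) (L + M).
Proof.
move=> f0 g0 /(sdiff_bounds f0)[c c0 fP] /(sdiff_bounds g0)[d d0 gP] e e0.
have [K [K0 K1 Kc Kd]] : exists K : R,
    [/\ 0 < K, nmE (\1%VF : E) + 1 <= K, c <= K & d + 1 <= K].
  exists (nmE (\1%VF : E) + 1 + c + d); have := @nmE_ge0 R V \1%VF.
  by clear fP gP; split; lra.
have K1' : 1 <= K by apply: le_trans K1; rewrite lerDr nmE_ge0.
(* Each of four error terms below is at most [h * K] times the distance. *)
pose h := Order.min 1 (e / (4 * K)).
have h0 : 0 < h by rewrite lt_min ltr01 divr_gt0 // mulr_gt0.
have [a a0 aP] := fP _ h0; have [b b0 bP] := gP _ h0.
exists (Order.min a b) => [|w w']; first by rewrite lt_min a0.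
rewrite !le_min => /andP[wa wb] /andP[w'a w'b].
have [f1 f2 f3 f4] := aP _ _ wa w'a; have [g1 g2 g3 g4] := bP _ _ wb w'b.
have [_ _ _ f4'] := aP _ _ w'a w'a.
move: (w - w') f1 f2 f3 g1 g2 g3 => D f1 f2 f3 g1 g2 g3.
have -> : ((f w \o g w) - (f w' \o g w') - (L + M) D =
   ((f w - f w' - L D) \o g w) + (L D \o (g w - \1)) +
   ((f w' - \1) \o (g w - g w')) + (g w - g w' - M D))%VF.
  rewrite add_lfunE !comp_lfunDl !comp_lfunDr !comp_lfunNl !comp_lfunNr !comp_lfun1l !comp_lfun1r.
  set X1 := (f w \o g w)%VF; set X2 := (f w' \o g w')%VF; set X3 := (f w' \o g w)%VF.
  set X4 := (L D \o g w)%VF.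
  by vring.
have n1 : nmE ((f w - f w' - L D) \o g w)%VF <= h * nmE D * K.
  apply: le_trans (nmE_comp _ _) _; apply: ler_pM; rewrite ?nmE_ge0 //.
  have := nmED (g w - \1%VF) \1%VF; rewrite subrK.
  have h1 : h <= 1 by rewrite ge_min lexx.
  move=> h2; apply: le_trans h2 _; apply: le_trans K1; rewrite addrC lerD2l.
  exact: le_trans g4 h1.
have n2 : nmE (L D \o (g w - \1))%VF <= K * nmE D * h.
  apply: le_trans (nmE_comp _ _) _; apply: ler_pM; rewrite ?nmE_ge0 //.
  by apply: le_trans f3 _; rewrite ler_wpM2r ?nmE_ge0.
have n3 : nmE ((f w' - \1) \o (g w - g w'))%VF <= h * (K * nmE D).
  apply: le_trans (nmE_comp _ _) _; apply: ler_pM; rewrite ?nmE_ge0 //.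
  apply: le_trans g2 _; rewrite ler_wpM2r ?nmE_ge0 //.
  by apply: le_trans Kd; rewrite lerDl.
have n4 : nmE (g w - g w' - M D) <= h * (K * nmE D).
  apply: le_trans g1 _; rewrite ler_wpM2l ?(ltW h0) // ler_peMl ?nmE_ge0 //.
have h4 : 4 * (h * K) <= e.
  have : h <= e / (4 * K) by rewrite ge_min lexx orbT.
  by rewrite ler_pdivlMr ?mulr_gt0 // mulrCA.
have h5 : 4 * (h * K) * nmE D <= e * nmE D by rewrite ler_wpM2r ?nmE_ge0.
apply: le_trans h5; rewrite (_ : 4 * (h * K) * nmE D =
  h * nmE D * K + K * nmE D * h + h * (K * nmE D) + h * (K * nmE D)); last by ring.
do 3 (apply: le_trans (nmED _ _) _; apply: lerD => //).
Qed.

(** A map whose difference to the identity is a contraction near the origin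
    covers a neighbourhood: where the distance to the target is minimal on a
    small compact ball, one correction step would halve it, so it is zero. *)
Lemma sdiff_surj f : f 0 = \1%VF -> sdiff f \1%VF -> forall r : R, 0 < r ->
  exists2 e : R, 0 < e & forall y, nmE (y - \1%VF) <= e -> exists2 w, nmE w <= r & f w = y.
Proof.
move=> f0 fd r r0; have [d d0 dP] := fd (2^-1) ltac:(by []).
pose s := Order.min r d.
have s0 : 0 < s by rewrite lt_min r0.
exists (s / 2) => [|y ys]; first by rewrite divr_gt0.
pose K : set (vtop E) := [set w | nmE (w : E) <= s].
have dP' w w' : K w -> K w' -> nmE (f w - f w' - (w - w')) <= 2^-1 * nmE (w - w' : E).
  rewrite /K /= !le_min => /andP[_ wd] /andP[_ w'd].
  by have := dP _ _ wd w'd; rewrite id_lfunE.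
have cK : compact K := @norm_ball_compact _ _ _ nmE_is_norm s.
have K0 : K !=set0 by exists (0 : E); rewrite /K /= nmE0 ltW.
have hc : {within K, continuous (fun w : vtop E => nmE (f w - y))}.
  apply/subspace_continuousP => w Kw B /nbhs_ballP[e /= e0 eB].
  apply/(norm_nbhsP nmE_is_norm); exists (e / 2) => [|w' w'w Kw']; first by rewrite divr_gt0.
  apply: eB; rewrite -ball_normE /=.
  have h1 := dP' _ _ Kw' Kw; have h2 := nmED (f w' - f w - (w' - w)) (w' - w).
  rewrite subrK in h2.
  have h3 := nmED (f w' - f w) (f w - y); rewrite addrA subrK in h3.
  have h4 := nmED (f w - f w') (f w' - y); rewrite addrA subrK (nmEB (f w) (f w')) in h4.
  by rewrite /from_subspace /= ltr_norml; apply/andP; split; lra.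
have correction (o u a b : E) : u - (a - b) = (b - o) - (a - o - (u - 0)).
  by rewrite subr0; vring.
have [w Kw wmin] := compact_EVT_min K0 cK hc.
rewrite inE in Kw; exists w; first by move: Kw; rewrite /K /= le_min => /andP[].
apply/eqP; rewrite -subr_eq0; apply/negP => /negP/nmE_gt0 d1.
pose w' : E := w - (f w - y).
have Kw' : K w'.
  rewrite /K /= /w'.
  have -> := correction (f 0) w (f w) y; rewrite f0.
  have h1 := dP' w 0 Kw ltac:(by rewrite /K /= nmE0 ltW).
  rewrite [X in _ * nmE X]subr0 f0 in h1.
  apply: le_trans (nmED _ _) _; rewrite nmEN.
  by move: Kw; rewrite /K /= => Kw; move: h1; rewrite subr0; lra.
have := wmin _ (mem_set Kw').
have h1 := dP' _ _ Kw' Kw.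
have h2 : w' - w = - (f w - y) by rewrite /w' addrC addKr.
rewrite h2 opprK nmEN addrA subrK in h1.
by move=> h3; move: (le_trans h3 h1) d1; lra.
Qed.

End LocalInverse.

(** * Closed groups near the identity *)

(** Among the subspaces contained in [S] one of maximal dimension is all of [S]. *)
Lemma linear_set_vspace (K : fieldType) (U : vectType K) (S : set U) : S 0 ->
  (forall (c : K) v w, S v -> S w -> S (c *: v + w)) ->
  exists U' : {vspace U}, forall w, S w <-> w \in U'.
Proof.
move=> S0 SP.
pose P n := `[< exists2 X : {vspace U}, {in X, forall w, S w} & \dim X = n >].
have exP : exists n, P n.
  exists 0%N; apply/asboolP; exists 0%VS; last exact: dimv0.
  by move=> w; rewrite memv0 => /eqP ->.
have ubP n : P n -> (n <= \dim {:U})%N.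
  by move=> /asboolP[X _ <-]; rewrite dimvS // subvf.
case: (ex_maxnP exP ubP) => n /asboolP[X XS Xn] nmax.
exists X => w; split=> [Sw|]; last exact: XS.
have /nmax : P (\dim (X + <[w]>)%VS).
  apply/asboolP; exists (X + <[w]>)%VS => // u /memv_addP[x xX [y /vlineP[k ->] ->]].
  by rewrite addrC; apply: SP => //; exact: XS.
rewrite -Xn => dX; have /eqP -> : X == (X + <[w]>)%VS by rewrite eqEdim addvSl.
by apply: (subvP (addvSr _ _)); exact: memv_line.
Qed.

Lemma addv_pi_comp (K : fieldType) (U : vectType K) (X Y : {vspace U}) (q : 'End(U)) :
  (forall w, q w \in (X + Y)%VS) ->
  ((addv_pi1 X Y \o q) + (addv_pi2 X Y \o q))%VF = q.
Proof.
move=> qXY; apply/lfunP => w; rewrite add_lfunE.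
by rewrite (comp_lfunE (addv_pi1 X Y)) (comp_lfunE (addv_pi2 X Y)) addv_pi1_pi2.
Qed.

Section LieSubgroup.
Context {R : realType} {V : vectType R[i]}.
Context (G : set 'End(V)) (G_group : is_subgroup G) (G_closed : closed_in_GL G).
Local Notation E := 'End(V).
Implicit Types (g h : E) (Y Z : E) (S : {vspace E}).

Lemma groupGL g : G g -> GL g. Proof. by case: G_group => H _ _ _; exact: H. Qed.
Lemma group1 : G \1%VF. Proof. by case: G_group. Qed.
Lemma groupM g h : G g -> G h -> G (g \o h)%VF. Proof. by case: G_group => _ _ H _; exact: H. Qed.
Lemma groupV g : G g -> G (g^-1)%VF. Proof. by case: G_group => _ _ _; exact. Qed.

Lemma group_pow g k : G g -> G (powE g k).
Proof. by move=> Gg; elim: k => [|k IH]; [exact: group1|rewrite powES; exact: groupM]. Qed.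

Lemma lie_exp Y : lie G Y -> G (expE Y).
Proof. by move=> /(_ 1); rewrite rmorph1 scale1r. Qed.

Lemma lieZ (t : R) Y : lie G Y -> lie G (t%:C *: Y).
Proof. by move=> GY s; rewrite scalerA -rmorphM; exact: GY. Qed.

Lemma lieN Y : lie G Y -> lie G (- Y).
Proof. by move=> /(lieZ (-1)); rewrite rmorphN rmorph1 scaleN1r. Qed.

Lemma lie_conj g Y : G g -> lie G Y -> lie G (g \o Y \o g^-1)%VF.
Proof.
move=> Gg GY t; rewrite comp_lfunZl comp_lfunZr expE_conj; last exact: groupGL.
by apply: groupM; [apply: groupM|exact: groupV].
Qed.

Lemma group_limit g : GL g -> (forall e : R, 0 < e -> exists2 h, G h & nmE (h - g) < e) -> G g.
Proof. by move=> g0 H; apply: G_closed; split=> //; apply/(norm_closureP nmE_is_norm). Qed.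

(** The one-parameter group of a limit of directions of ever shorter logarithms
    of elements of [G] is approximated by the powers of these elements. *)
Lemma lie_limit_direction (Y : nat -> E) (u : E) :
  (forall e : R, 0 < e -> exists k, [/\ G (expE (Y k)), 0 < nmE (Y k), nmE (Y k) < e
     & nmE ((nmE (Y k))^-1%:C *: Y k - u) < e]) ->
  nmE u = 1 -> lie G u.
Proof.
move=> HY u1.
have pos (t : R) : 0 <= t -> G (expE (t%:C *: u)).
  move=> t0; apply: group_limit (expE_GL _) _ => e e0.
  (* [K] absorbs the Lipschitz constant [expR (t + 1)] of the exponential and the
     factor [t + 1] in the distance of the logarithms. *)
  pose K := expR (t + 1) * 2 * (t + 1).
  have K0 : 0 < K by rewrite !mulr_gt0 ?expR_gt0 // ltr_wpDl.
  pose d := Order.min 1 (e / K).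
  have d0 : 0 < d by rewrite lt_min ltr01 divr_gt0.
  have d1 : d <= 1 by rewrite ge_min lexx.
  have [k [Gk Y0 Yd ud]] := HY _ d0.
  (* The first [m] steps of length [y] fall short of [t] by less than [y]. *)
  set y := nmE (Y k) in Y0 Yd ud; pose m := Num.truncn (t / y).
  exists (powE (expE (Y k)) m); first exact: group_pow.
  rewrite -expE_nat.
  have /andP[m1 m2] : m%:R <= t / y < m.+1%:R by apply: truncn_itv; rewrite divr_ge0 // ltW.
  rewrite ler_pdivlMr // in m1; rewrite ltr_pdivrMr // -natr1 mulrDl mul1r in m2.
  have nY : nmE (m%:R *: Y k) = m%:R * y.
    by rewrite -(rmorph_nat (real_complex R)) nmEZr ger0_norm.
  have nu : nmE (t%:C *: u) <= t + 1 by rewrite nmEZr ger0_norm // u1 mulr1 lerDl.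
  have nY1 : nmE (m%:R *: Y k) <= t + 1 by rewrite nY; apply: le_trans m1 _; rewrite lerDl.
  apply: le_lt_trans (expE_dist nY1 nu) _.
  have -> : m%:R *: Y k - t%:C *: u = (m%:R - (t / y)%:C) *: Y k + t%:C *: (y^-1%:C *: Y k - u).
    by rewrite rmorphM; vring.
  have d2 : nmE ((m%:R - (t / y)%:C) *: Y k + t%:C *: (y^-1%:C *: Y k - u)) < d * (t + 1).
    apply: le_lt_trans (nmED _ _) _.
    rewrite -(rmorph_nat (real_complex R)) -rmorphB !nmEZr (ger0_norm t0) -/y.
    have -> : `|m%:R - t / y| * y = t - m%:R * y.
      rewrite ler0_norm; last by rewrite subr_le0 ler_pdivlMr.
      by rewrite opprB mulrBl divfK // gt_eqF.
    have h1 : t * nmE (y^-1%:C *: Y k - u) <= t * d by rewrite ler_wpM2l // ltW.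
    by rewrite mulrDr mulr1 (mulrC d); lra.
  have h1 : d * (t + 1) * expR (t + 1) <= e / 2.
    have : d <= e / K by rewrite ge_min lexx orbT.
    by rewrite ler_pdivlMr // /K ler_pdivlMr //; lra.
  have h2 : d * (t + 1) * expR (t + 1) < e by lra.
  by apply: lt_trans h2; rewrite ltr_pM2r ?expR_gt0.
move=> t; have [t0|t0] := leP 0 t; first exact: pos.
have := groupV (pos (- t) _); rewrite expEV rmorphN scaleNr opprK; apply.
by rewrite oppr_ge0 ltW.
Qed.

(** Transversally to its Lie algebra a closed group is discrete: otherwise the
    directions of logarithms tending to zero accumulate, on the unit sphere of
    the transversal space, at an element of the Lie algebra. *)
Lemma transversal_discrete S : (forall Y, Y \in S -> lie G Y -> Y = 0) ->
  exists2 d : R, 0 < d & forall Y, Y \in S -> nmE Y <= d -> G (expE Y) -> Y = 0.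
Proof.
move=> Sg; apply: contrapT => H.
have bad k : exists Y, [/\ Y \in S, nmE Y <= k.+1%:R^-1, G (expE Y) & Y != 0].
  apply: contrapT => Hk; apply: H; exists k.+1%:R^-1 => [|Y YS Yk GY].
    by rewrite invr_gt0.
  by apply: contrapT => /eqP Y0; apply: Hk; exists Y.
have [Y YP] := choice bad.
pose u k : vtop E := (nmE (Y k))^-1%:C *: Y k.
have Y0 k : 0 < nmE (Y k) by case: (YP k) => _ _ _ /nmE_gt0.
have u1 k : nmE (u k : E) = 1 by rewrite nmEZr gtr0_norm ?invr_gt0 // mulVf // gt_eqF.
pose B : set (vtop E) := [set w | nmE (w : E) <= 1].
have cB : compact B := @norm_ball_compact _ _ _ nmE_is_norm 1.
have uB : (u @ \oo) B by exists 0%N => // k _; rewrite /B /= u1.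
have [l [_ cl]] := cB _ _ uB.
have near_l e n : 0 < e -> exists2 k, (n <= k)%N & nmE ((u k : E) - l) < e.
  move=> e0; have [w [[k /= nk <-] kl]] :
      [set u k | k in [set k | (n <= k)%N]] `&` [set w : vtop E | nmE ((w : E) - l) < e] !=set0.
    apply: (cl _ _ _ (norm_ball_nbhs nmE_is_norm _ e0)).
    by exists n => // k nk; exists k.
  by exists k.
have l1 : nmE (l : E) = 1.
  apply: (norm_limit1 nmE_is_norm) => e e0; have [k _ kl] := near_l _ 0%N e0.
  by exists (u k).
have lS : (l : E) \in S.
  apply: (vspace_closed nmE_is_norm) => e e0; have [k _ kl] := near_l _ 0%N e0.
  by exists (u k) => //; rewrite memvZ //; case: (YP k).
have lg : lie G l.
  apply: (lie_limit_direction (Y := Y)) => // e e0.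
  have [n nP] : exists n, (n.+1%:R^-1 : R) < e.
    exists (Num.truncn e^-1); rewrite -[ltRHS]invrK ltf_pV2 ?posrE ?invr_gt0 //.
    exact: truncnS_gt.
  have [k nk kl] := near_l e n e0; exists k; split=> //; first by case: (YP k).
  case: (YP k) => _ Yk _ _; apply: le_lt_trans Yk _; apply: le_lt_trans nP.
  by rewrite lef_pV2 ?posrE // ler_nat.
by move: l1; rewrite (Sg _ lS lg) nmE0 => /eqP; rewrite eq_sym oner_eq0.
Qed.

(** Take the product of the exponentials of the components of [w] in a complement
    of the Lie algebra and in its three parts. Its derivative is the identity, so
    it covers a neighbourhood of the identity. Where the value is in [G] the
    transversal factor is in [G] as well, hence trivial. *)
Lemma local_decomposition (g1 g2 g3 : {vspace E}) :
  (forall Y, lie G Y <-> Y \in (g1 + (g2 + g3))%VS) ->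
  exists2 e : R, 0 < e & forall y, nmE (y - \1%VF) <= e -> G y ->
    exists Y1 Y2 Y3, [/\ Y1 \in g1, Y2 \in g2, Y3 \in g3
      & y = (expE Y1 \o (expE Y2 \o expE Y3))%VF].
Proof.
move=> gP; set g := (g1 + (g2 + g3))%VS in gP.
have Sg Y : Y \in (g^C)%VS -> lie G Y -> Y = 0.
  move=> YS /gP Yg; apply/eqP; rewrite -memv0 -(capv_compl g).
  by rewrite memv_cap Yg.
have [d d0 dP] := transversal_discrete Sg.
pose p0 := addv_pi1 (g^C)%VS g; pose q0 := addv_pi2 (g^C)%VS g.
pose p1 := (addv_pi1 g1 (g2 + g3) \o q0)%VF; pose q1 := (addv_pi2 g1 (g2 + g3) \o q0)%VF.
pose p2 := (addv_pi1 g2 g3 \o q1)%VF; pose p3 := (addv_pi2 g2 g3 \o q1)%VF.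
have q0g w : q0 w \in g by exact: memv_pi2.
have q1g w : q1 w \in (g2 + g3)%VS by rewrite /q1 comp_lfunE; exact: memv_pi2.
have pE : (p0 + (p1 + (p2 + p3)) = \1)%VF.
  rewrite (addv_pi_comp q1g) (addv_pi_comp q0g); apply/lfunP => w.
  rewrite (add_lfunE p0) id_lfunE addv_pi1_pi2 //.
  by rewrite addvC addv_complf memvf.
have m1 w : p1 w \in g1 by rewrite /p1 comp_lfunE; exact: memv_pi1.
have m2 w : p2 w \in g2 by rewrite /p2 comp_lfunE; exact: memv_pi1.
have m3 w : p3 w \in g3 by rewrite /p3 comp_lfunE; exact: memv_pi2.
have m0 w : p0 w \in (g^C)%VS by exact: memv_pi1.
move: p0 p1 p2 p3 pE m0 m1 m2 m3 => p0 p1 p2 p3 pE m0 m1 m2 m3 {q0g q1g q0 q1}.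
pose f w := (expE (p0 w) \o (expE (p1 w) \o (expE (p2 w) \o expE (p3 w))))%VF.
have fd : sdiff f \1%VF.
  rewrite -pE; apply: sdiff_comp; rewrite ?linear0 ?expE0 ?comp_lfun1l //; first exact: sdiff_exp.
  apply: sdiff_comp; rewrite ?linear0 ?expE0 ?comp_lfun1l //; first exact: sdiff_exp.
  by apply: sdiff_comp; rewrite ?linear0 ?expE0 //; exact: sdiff_exp.
have f0 : f 0 = \1%VF by rewrite /f !linear0 expE0 !comp_lfun1l.
have [c c0 cP] := linear_bound p0.
have [e e0 eP] := sdiff_surj f0 fd (r := d / c) ltac:(by rewrite divr_gt0).
exists e => // y ye Gy; have [w wr fw] := eP _ ye.
have p0w : p0 w = 0.
  apply: dP; first exact: m0.
    by apply: le_trans (cP _) _; rewrite mulrC -ler_pdivlMr.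
  have Gz : G (expE (p1 w) \o (expE (p2 w) \o expE (p3 w)))%VF.
    have m23 Y : Y \in (g2 + g3)%VS -> Y \in g by apply/subvP; rewrite addvSr.
    do 2 ?apply: groupM; apply: lie_exp; apply/gP.
    - by apply: (subvP (addvSl _ _)).
    - by apply: m23; apply: (subvP (addvSl _ _)).
    - by apply: m23; apply: (subvP (addvSr _ _)).
  have := groupM Gy (groupV Gz); rewrite -fw /f lker0_compfK //.
  exact: groupGL.
exists (p1 w), (p2 w), (p3 w); split=> //.
by rewrite -fw /f p0w expE0 comp_lfun1l.
Qed.

End LieSubgroup.

(** * Lines and the topology of projective space *)

Section ProjectivePoints.
Context {R : realType} {V : vectType R[i]}.
Implicit Types (x y : pspace V) (u v w : V) (g h : 'End(V)).

Lemma vline_eqP u v : u != 0 -> u \in <[v]>%VS -> (<[u]> = <[v]>)%VS.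
Proof.
move=> u0 uv; apply/eqP; rewrite eqEdim -memvE uv /= !dim_vline u0.
by case: (v != 0).
Qed.

Lemma pspace_gen x : exists2 v, v != 0 & \val x = <[v]>%VS.
Proof.
have d1 := eqP (valP x : \dim (\val x) == 1%N).
have v0 : vpick (\val x) != 0.
  by rewrite vpick0; apply/eqP => x0; move: d1; rewrite x0 dimv0.
exists (vpick (\val x)) => //; apply/eqP; rewrite eq_sym eqEdim -memvE memv_pick.
by rewrite d1 dim_vline v0.
Qed.

Lemma pspace_gen_neq0 x v : \val x = <[v]>%VS -> v != 0.
Proof.
move=> xv; have := valP x; rewrite /= xv dim_vline; by case: (v != 0).
Qed.

Lemma pspace_mk v : v != 0 -> exists x, \val x = <[v]>%VS.
Proof.
move=> v0; have d1 : \dim <[v]>%VS == 1%N by rewrite dim_vline v0.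
by exists (Sub <[v]>%VS d1); rewrite SubK.
Qed.

Lemma GL_neq0 g v : GL g -> v != 0 -> g v != 0.
Proof.
by move=> /lker0P g0 v0; apply: contra v0 => /eqP gv; apply/eqP/g0; rewrite gv linear0.
Qed.

Lemma pact_gen g x v : GL g -> \val x = <[v]>%VS -> \val (pact g x) = <[g v]>%VS.
Proof.
move=> g0 xv; have v0 := pspace_gen_neq0 xv.
by rewrite /pact insubdK xv limg_line // unfold_in dim_vline GL_neq0.
Qed.

Lemma pact1 x : pact \1%VF x = x.
Proof.
have [v v0 xv] := pspace_gen x; apply: val_inj.
rewrite (pact_gen _ xv) ?id_lfunE //.
by apply/lker0P => a b; rewrite !id_lfunE.
Qed.

Lemma GL_comp g h : GL g -> GL h -> GL (g \o h)%VF.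
Proof.
move=> /lker0P gi /lker0P hi; apply/lker0P => a b; rewrite !comp_lfunE.
by move=> /gi /hi.
Qed.

Lemma pactM g h x : GL g -> GL h -> pact (g \o h)%VF x = pact g (pact h x).
Proof.
move=> g0 h0; have [v v0 xv] := pspace_gen x; apply: val_inj.
by rewrite (pact_gen (GL_comp g0 h0) xv) (pact_gen g0 (pact_gen h0 xv)) comp_lfunE.
Qed.

(** The topology of projective space is a quotient topology; here it is described
    by the vectors near one fixed generator of a line, since the multiples of
    the vectors near it fill an open set. *)
Lemma pnbhsP x v (U : set (pspace V)) : \val x = <[v]>%VS ->
  nbhs x U <-> exists2 e : R, 0 < e &
    forall w y, \val y = <[w]>%VS -> nm (w - v) < e -> U y.
Proof.
move=> xv; have v0 := pspace_gen_neq0 xv.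
have lineE w (w0 : (w : V) != 0) y : \val y = <[w]>%VS ->
    exists p : @punctured R V, \val p = w /\ pline p = y.
  move=> yw; exists (SigSub (mem_set (w0 : @punctured R V w))); split=> //.
  by apply: val_inj; rewrite yw /pline SubK.
split.
  rewrite nbhsE => -[Q [Qo Qx] QU].
  have [B Bo BQ] : wopen set_val (@pline R V @^-1` Q) := Qo.
  have [p [pv px]] := lineE _ v0 _ xv.
  have Bv : B (v : vtop V).
    have : (set_val @^-1` B) p by rewrite BQ /= px.
    by rewrite /= set_valE pv.
  have /vtop_nbhsP[e e0 eB] : nbhs (v : vtop V) B by exact: open_nbhs_nbhs.
  exists e => // w y yw we; apply: QU.
  have [q [qw <-]] := lineE _ (pspace_gen_neq0 yw) _ yw.
  suff : (set_val @^-1` B) q by rewrite BQ.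
  by rewrite /= set_valE qw; exact: eB.
move=> [e e0 eU].
(* The vectors having a nonzero multiple that generates, with all vectors near
   it, only lines of [U]. *)
pose B : set (vtop V) := [set u | exists c : R[i], c != 0 /\ exists2 d : R, 0 < d &
   forall w y, \val y = <[w]>%VS -> nm (w - c *: (u : V)) < d -> U y].
pose Q : set (pspace V) := [set y | exists2 u, \val y = <[u]>%VS & B u].
have BQ : set_val @^-1` B = @pline R V @^-1` Q.
  apply/seteqP; split=> p /=; rewrite set_valE.
    by move=> Bp; exists (\val p) => //; rewrite /pline SubK.
  move=> [u]; rewrite /pline SubK => pu [c [c0 [d d0 dU]]].
  have /vlineP[k uk] : u \in <[\val p : V]>%VS by rewrite pu memv_line.
  have k0 : k != 0.
    apply/eqP => k0; have := dim_line p; rewrite pu uk k0 scale0r dim_vline eqxx //.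
  exists (c * k); split; first by rewrite mulf_neq0.
  by exists d => // w y yw; rewrite -scalerA -uk; exact: dU.
rewrite nbhsE; exists Q; last first.
  move=> y [u yu [c [c0 [d d0 dU]]]]; apply: (dU (c *: u)); last by rewrite subrr nm0.
  by rewrite yu; apply/esym/vline_eqP; rewrite ?memvZ ?memv_line // scaler_eq0 negb_or c0 (pspace_gen_neq0 yu).
split; last first.
  exists v => //; exists 1; split; first exact: oner_neq0.
  by exists e => // w y yw; rewrite scale1r; exact: eU.
change (wopen set_val (@pline R V @^-1` Q)); exists B => //.
rewrite openE => u [c [c0 [d d0 dU]]]; apply/vtop_nbhsP.
have nc : 0 < normc c by rewrite lt_def normc_ge0 andbT; apply: contra c0 => /eqP/eq0_normc ->.
exists (d / 2 / normc c) => [|u' u'u]; first by rewrite !divr_gt0.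
exists c; split=> //; exists (d / 2) => [|w y yw wu']; first by rewrite divr_gt0.
apply: dU yw _; have := nmD (w - c *: u') (c *: u' - c *: (u : V)); rewrite addrA subrK -scalerBr nmZ.
by move: u'u; rewrite ltr_pdivlMr // mulrC; lra.
Qed.

Lemma pclosureP (S : set (pspace V)) x v : \val x = <[v]>%VS ->
  closure S x <-> forall e : R, 0 < e -> exists w y, [/\ \val y = <[w]>%VS, nm (w - v) < e & S y].
Proof.
move=> xv; split=> [cx e e0|H U /(pnbhsP _ xv)[e e0 eU]].
  have /cx[y [Sy [w yw we]]] : nbhs x [set y | exists2 w, \val y = <[w]>%VS & nm (w - v) < e].
    by apply/(pnbhsP _ xv); exists e => // w y yw we; exists w.
  by exists w, y.
by have [w [y [yw we Sy]]] := H _ e0; exists y; split=> //; exact: eU yw we.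
Qed.

(** If [v' = k w'] with [w'] bounded away from zero, then [k] is bounded, so that
    [k w] is close to [v]. *)
Lemma parallel_closed v w : w != 0 ->
  (forall e : R, 0 < e -> exists v' w', [/\ nm (v' - v) < e, nm (w' - w) < e & v' \in <[w']>%VS]) ->
  v \in <[w]>%VS.
Proof.
move=> /nm_gt0 w0 H; apply: (vspace_closed nm_is_norm) => e e0.
pose K := (nm v + 1) / (nm w / 2).
have K0 : 0 < K by rewrite divr_gt0 ?divr_gt0 // ltr_wpDl ?nm_ge0.
pose d := Order.min (Order.min 1 (nm w / 2)) (Order.min (e / 2) (e / 2 / K)).
have e2 : 0 < e / 2 by rewrite divr_gt0.
have ek : 0 < e / 2 / K := divr_gt0 e2 K0.
have d0 : 0 < d by rewrite /d !lt_min ltr01 e2 ek divr_gt0.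
have [v' [w' [v'v w'w /vlineP[k v'k]]]] := H d d0.
exists (k *: w); first by rewrite memvZ ?memv_line.
move: v'v w'w; rewrite !lt_min => /andP[/andP[v1 _] /andP[v2 _]] /andP[/andP[_ w1] /andP[_ w2]].
have kK : normc k <= K.
  rewrite /K ler_pdivlMr ?divr_gt0 //.
  have h1 : normc k * nm w' = nm v' by rewrite v'k nmZ.
  have h2 := nmD (v' - v) v; rewrite subrK in h2.
  have h3 : nm w / 2 <= nm w'.
    by have := nmD (w - w') w'; rewrite subrK nmB; lra.
  by apply: (@le_trans _ _ (normc k * nm w')); [rewrite ler_wpM2l ?normc_ge0|rewrite h1; lra].
have h1 := nmD (k *: w - v') (v' - v); rewrite addrA subrK in h1.
have h2 : nm (k *: w - v') = normc k * nm (w' - w) by rewrite v'k -scalerBr nmZ nmB.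
have h3 : normc k * nm (w' - w) <= K * (e / 2 / K).
  by apply: ler_pM; rewrite ?normc_ge0 ?nm_ge0 // ltW.
by move: h3; rewrite mulrCA mulfV ?mulr1 ?gt_eqF //; lra.
Qed.

Lemma pspace_hausdorff : hausdorff_space (pspace V).
Proof.
move=> x y; have [v v0 xv] := pspace_gen x; have [w w0 yw] := pspace_gen y => xy.
suff vw : v \in <[w]>%VS by apply: val_inj; rewrite yw xv; exact: vline_eqP.
apply: parallel_closed => // e e0.
have Nx : nbhs x [set z | exists2 v', \val z = <[v']>%VS & nm (v' - v) < e].
  by apply/(pnbhsP _ xv); exists e => // v' z zv' ?; exists v'.
have Ny : nbhs y [set z | exists2 v', \val z = <[v']>%VS & nm (v' - w) < e].
  by apply/(pnbhsP _ yw); exists e => // v' z zv' ?; exists v'.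
have [z [[v' zv' v'v] [w' zw' w'w]]] := xy _ _ Nx Ny.
by exists v', w'; split=> //; rewrite -zw' zv' memv_line.
Qed.

End ProjectivePoints.

(** Baire's theorem. If no set of the countable closed cover had an interior point,
    shrinking balls avoiding them one after the other would have a common point. *)
Lemma baire_compact (R : realType) (W : vectType R[i]) (K : set (vtop W)) (A : nat -> set (vtop W)) :
  compact K -> K !=set0 -> (forall n, closed (A n)) -> K `<=` \bigcup_n A n ->
  exists n, exists2 v : W, K v & exists2 e : R, 0 < e & forall w : W, K w -> nm (w - v) < e -> A n w.
Proof.
move=> cK [v0 Kv0] cA KA; apply: contrapT => H.
have step n (s : W * R) : exists s' : W * R, K s.1 -> 0 < s.2 ->
    [/\ K s'.1, 0 < s'.2, nm (s'.1 - s.1) + s'.2 <= s.2 &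
     forall w : W, nm (w - s'.1) <= s'.2 -> ~ A n w].
  case: s => v e; have [Kv|] := pselect (K v); last by exists (v, e).
  have [e0|] := ltP 0 e; last by exists (v, e) => //= _; rewrite ltNge e0.
  have [w [Kw we Aw]] : exists w : W, [/\ K w, nm (w - v) < e & ~ A n w].
    apply: contrapT => Hw; apply: H; exists n, v => //; exists e => // w Kw we.
    by apply: contrapT => Aw; apply: Hw; exists w.
  have [d d0 dA] : exists2 d : R, 0 < d & forall z : W, nm (z - w) < d -> ~ A n z.
    have /vtop_nbhsP[d d0 dP] : nbhs (w : vtop W) (~` A n).
      by apply: open_nbhs_nbhs; split=> //; apply: closed_openC.
    by exists d.
  exists (w, Order.min (d / 2) (e - nm (w - v))) => _ _ /=; split=> //.
  - by rewrite lt_min divr_gt0 //= subr_gt0.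
  - by rewrite -lerBrDl ge_min lexx orbT.
  - move=> z; rewrite le_min => /andP[zd _]; apply: dA.
    by move: zd d0; lra.
have [f' f'P] := choice (fun ns : nat * (W * R) => step ns.1 ns.2).
pose f n s := f' (n, s); have fP n s := f'P (n, s).
pose s := fix s n : W * R := if n is m.+1 then f m (s m) else (v0, 1).
have sP n : K (s n).1 /\ 0 < (s n).2.
  by elim: n => [//|n [h1 h2]] /=; have [] := fP n _ h1 h2.
have nest n m : (n <= m)%N -> nm ((s m).1 - (s n).1) + (s m).2 <= (s n).2.
  elim: m => [|m IH]; first by rewrite leqn0 => /eqP ->; rewrite subrr nm0 add0r.
  rewrite leq_eqVlt => /predU1P[->|]; first by rewrite subrr nm0 add0r.
  rewrite ltnS => /IH{}IH; have [h1 h2] := sP m; have [_ _ h3 _] := fP m _ h1 h2.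
  have := nmD ((s m.+1).1 - (s m).1) ((s m).1 - (s n).1); rewrite addrA subrK /=.
  by move: h3 IH => /=; lra.
pose u n : vtop W := (s n).1.
have uK : (u @ \oo) K by exists 0%N => // n _; exact: (sP n).1.
have [l [Kl cl]] := cK _ _ uK.
have lP n : nm ((l : W) - (s n).1) <= (s n).2.
  apply/ler_addgt0Pr => e e0.
  have [w [[m /= nm' <-] ml]] : [set u m | m in [set m | (n <= m)%N]] `&`
      [set w : vtop W | nm ((w : W) - l) < e] !=set0.
    apply: (cl _ _ _ (nm_ball_nbhs _ e0)).
    by exists n => // m nm'; exists m.
  have := nmD ((l : W) - (s m).1) ((s m).1 - (s n).1); rewrite addrA subrK.
  rewrite /= nmB in ml; have := nest _ _ nm'; have [_] := sP m.
  by move: ml; rewrite /u; lra.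
have [n _ An] := KA _ Kl.
have [h1 h2] := sP n; have [_ _ _ h3] := fP n _ h1 h2.
by apply: (h3 l) An; exact: (lP n.+1).
Qed.

(** * Openness of the orbit map *)

Section OrbitMap.
Context {R : realType} {V : vectType R[i]}.
Context (G : set 'End(V)) (G_group : is_subgroup G) (G_closed : closed_in_GL G).
Local Notation E := 'End(V).
Implicit Types (g h : E) (v w : V) (x y : pspace V).

Definition bounded_part (r : R) : set (vtop E) :=
  [set g | [/\ G g, nmE (g : E) <= r & nmE ((g : E)^-1)%VF <= r]].

(** A vector [d] killed by [g] satisfies [d = - h^-1 (g - h) d] and would be
    shorter than itself. *)
Lemma near_GL g h : GL h -> nmE (h^-1)%VF * nmE (g - h) < 1 -> GL g.
Proof.
move=> h0 gh; apply/lker0P => a b ab; apply/eqP; rewrite -subr_eq0.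
apply/negP => /negP/nm_gt0 d0.
have gd : g (a - b) = 0 by rewrite linearB /= ab subrr.
have E1 : a - b = - (h^-1 \o (g - h))%VF (a - b).
  by rewrite comp_lfunE add_lfunE opp_lfunE gd sub0r linearN /= opprK lker0_lfunK.
have := nmE_app (h^-1 \o (g - h))%VF (a - b).
rewrite -[nm (_ (a - b))]nmN -E1 => H.
have : nmE (h^-1 \o (g - h))%VF < 1 by apply: le_lt_trans (nmE_comp _ _) gh.
by rewrite -(ltr_pM2r d0) mul1r => /(le_lt_trans H); rewrite ltxx.
Qed.

Lemma invE_dist g h : GL g -> GL h ->
  nmE ((g^-1)%VF - (h^-1)%VF) <= nmE (g^-1)%VF * nmE (h - g) * nmE (h^-1)%VF.
Proof.
move=> g0 h0; have -> : (g^-1)%VF - (h^-1)%VF = (g^-1 \o (h - g) \o h^-1)%VF.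
  rewrite comp_lfunDr comp_lfunDl comp_lfunNr comp_lfunNl.
  by rewrite (lker0_compfK h0) (lker0_compVf g0) comp_lfun1l.
apply: le_trans (nmE_comp _ _) _.
by rewrite ler_wpM2r ?nmE_ge0 // nmE_comp.
Qed.

(** The bound on the inverses keeps the limits invertible, so that closedness of
    [G] in the general linear group applies. *)
Lemma bounded_part_compact r : compact (bounded_part r).
Proof.
apply: (norm_closed_compact nmE_is_norm (r := r)) => [|g []//].
apply/(norm_closedP nmE_is_norm) => g H.
have gr : nmE g <= r.
  apply/ler_addgt0Pr => e /H[h [_ hr _] gh].
  by have := nmED (g - h) h; rewrite subrK nmEB; lra.
have r0 : 0 <= r := le_trans (nmE_ge0 _) gr.
have r1 : 0 < r + 1 by rewrite ltr_wpDl.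
have g0 : GL g.
  have [h [Gh hr h'r] gh] := H (r + 1)^-1 ltac:(by rewrite invr_gt0).
  apply: (near_GL (groupGL G_group Gh)); rewrite nmEB.
  apply: le_lt_trans (ler_wpM2r (nmE_ge0 _) h'r) _.
  apply: (@le_lt_trans _ _ (r * (r + 1)^-1)).
    by rewrite ler_wpM2l // ltW.
  by rewrite ltr_pdivrMr // mul1r ltrDl.
split=> //.
  apply: (group_limit G_closed g0) => e /H[h [Gh _ _] gh].
  by exists h.
pose c := nmE (g^-1)%VF; rewrite -/c.
have c1 : 0 < c * r + 1 by rewrite ltr_wpDl // mulr_ge0 // nmE_ge0.
apply/ler_addgt0Pr => e e0.
have [h [Gh hr h'r] gh] := H (e / (c * r + 1)) ltac:(by rewrite divr_gt0).
have h0 := groupGL G_group Gh.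
have h1 : nmE ((g^-1)%VF - (h^-1)%VF) <= c * nmE (h - g) * nmE (h^-1)%VF := invE_dist g0 h0.
have h2 : c <= nmE ((g^-1)%VF - (h^-1)%VF) + nmE (h^-1)%VF.
  by rewrite /c -{1}[(g^-1)%VF](subrK (h^-1)%VF) nmED.
have h3 : c * nmE (h - g) * nmE (h^-1)%VF <= e.
  apply: (@le_trans _ _ (c * (e / (c * r + 1)) * r)).
    apply: ler_pM; rewrite ?mulr_ge0 ?nmE_ge0 //.
    by rewrite ler_wpM2l ?nmE_ge0 // ltW.
  by rewrite mulrAC mulrA ler_pdivrMr // mulrC ler_pM2l // lerDl.
by lra.
Qed.

Lemma bounded_part_exhaust g : G g -> exists n : nat, bounded_part n%:R g.
Proof.
move=> Gg; pose m := Order.max (nmE g) (nmE (g^-1)%VF).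
exists (Num.truncn m).+1; have : m <= (Num.truncn m).+1%:R by rewrite ltW // truncnS_gt.
by rewrite ge_max => /andP[h1 h2]; split.
Qed.

Lemma not_parallel_near v w : w != 0 -> v \notin <[w]>%VS ->
  exists2 e : R, 0 < e & forall v' w', nm (v' - v) < e -> nm (w' - w) < e -> v' \notin <[w']>%VS.
Proof.
move=> w0 vw; apply: contrapT => H; move/negP: vw; apply.
apply: parallel_closed => // e e0; apply: contrapT => He; apply: H.
exists e => // v' w' h1 h2; apply/negP => h3; apply: He.
by exists v', w'.
Qed.

Lemma app_near (g : E) v (e : R) : 0 < e -> exists2 d : R, 0 < d &
  forall (g' : E) v', nmE (g' - g) < d -> nm (v' - v) < d -> nm (g' v' - g v) < e.
Proof.
move=> e0; pose K := nmE g + nm v + 1 + 1.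
have K0 : 0 < K by rewrite ltr_wpDl // addr_ge0 // addr_ge0 ?nmE_ge0 ?nm_ge0.
exists (Order.min 1 (e / K)) => [|g' v']; first by rewrite lt_min ltr01 divr_gt0.
rewrite !lt_min => /andP[_ g2] /andP[v1 v2].
have -> : g' v' - g v = (g' - g) v' + g (v' - v).
  by rewrite add_lfunE opp_lfunE linearB /= addrA subrK.
apply: le_lt_trans (nmD _ _) _.
have h1 := nmE_app (g' - g) v'; have h2 := nmE_app g (v' - v).
have h3 : nm v' <= nm v + 1 by have := nmD (v' - v) v; rewrite subrK; lra.
have h4 : nmE (g' - g) * nm v' <= e / K * (nm v + 1).
  by apply: ler_pM; rewrite ?nmE_ge0 ?nm_ge0 // ltW.
have h5 : nmE g * nm (v' - v) <= nmE g * (e / K) by rewrite ler_wpM2l ?nmE_ge0 // ltW.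
have eK : e / K * K = e by rewrite divfK // gt_eqF.
have eK0 : 0 < e / K by rewrite divr_gt0.
by move: eK; rewrite /K !mulrDr !mulr1; move: h1 h2 h4 h5 eK0; rewrite !mulrDr mulr1 (mulrC (nmE g)); lra.
Qed.

(** A line different from all the lines of the [g v0] stays away from them
    uniformly, by compactness of the bounded part. *)
Lemma bounded_orbit_closed v0 r : v0 != 0 ->
  closed [set v : vtop V | nm (v : V) = 1 /\ exists2 g : E, bounded_part r g & (v : V) \in <[g v0]>%VS].
Proof.
move=> v00; apply/(norm_closedP nm_is_norm) => v H.
split; first by apply: (norm_limit1 nm_is_norm) => e /H[w [w1 _] wv]; exists w.
apply: contrapT => Hn.
pose P (w : vtop V) (g : vtop E) : Prop := (w : V) \notin <[(g : E) v0]>%VS.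
have loc (g : vtop E) : bounded_part r g -> \forall g' \near g & w \near (v : vtop V), P w g'.
  move=> gB; have [Gg _ _] := gB.
  have vg : v \notin <[(g : E) v0]>%VS by apply/negP => vg; apply: Hn; exists g.
  have [e e0 eP] := not_parallel_near (GL_neq0 (groupGL G_group Gg) v00) vg.
  have [d d0 dP] := app_near g v0 e0.
  exists ([set g' : vtop E | nmE ((g' : E) - g) < d], [set w : vtop V | nm ((w : V) - v) < e]).
    by split; [exact: (norm_ball_nbhs nmE_is_norm)|exact: nm_ball_nbhs].
  move=> [g' w] [/= h1 h2]; apply: eP => //; apply: dP => //.
  by rewrite subrr nm0.
have far := (compact_near_coveringP _).1 (@bounded_part_compact r) (vtop V) (nbhs (v : vtop V)) P
  (nbhs_filter (v : vtop V)) loc.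
have [d d0 dP] := (vtop_nbhsP _ _).1 far.
have [w [_ [g gB wg]] wv] := H d d0.
by have := dP w wv g gB; rewrite /P wg.
Qed.

(** An instance of the openness of transitive actions of locally compact groups,
    countable at infinity, on compact spaces. By Baire's theorem some bounded part
    of the group covers a neighbourhood of a point, and compactness of the bounded
    part transports this to the base point. *)
Lemma orbit_map_open x v0 : closed (orb G x) -> \val x = <[v0]>%VS ->
  forall e : R, 0 < e -> exists2 d : R, 0 < d & forall w y,
    \val y = <[w]>%VS -> nm (w - v0) < d -> orb G x y ->
    exists g, [/\ G g, nmE (g - \1%VF) < e & y = pact g x].
Proof.
move=> Mc xv0 e e0; have v00 := pspace_gen_neq0 xv0.
pose K : set (vtop V) := [set v | nm (v : V) = 1 /\ exists2 y, orb G x y & (v : V) \in \val y].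
pose A n : set (vtop V) := [set v | nm (v : V) = 1 /\
  exists2 g : E, bounded_part n%:R g & (v : V) \in <[g v0]>%VS].
have memy v y : v != 0 -> v \in \val y -> \val y = <[v]>%VS.
  by have [w w0 yw] := pspace_gen y; rewrite yw => v1 /(vline_eqP v1) ->.
have n1 v : nm v = 1 -> v != 0.
  by move=> v1; apply/eqP => v2; move: v1; rewrite v2 nm0 => /eqP; rewrite eq_sym oner_eq0.
have cK : compact K.
  apply: (nm_closed_compact (r := 1)) => [|v [->]//].
  apply/(norm_closedP nm_is_norm) => v H.
  have v1 : nm v = 1.
    by apply: (norm_limit1 nm_is_norm) => d /H[w [w1 _] wv]; exists w.
  split=> //; have [y yv] := pspace_mk (n1 _ v1).
  exists y; last by rewrite yv memv_line.
  apply: Mc; apply/(pclosureP _ yv) => d /H[w [w1 [z Mz wz]] wv].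
  by exists w, z; split=> //; apply: memy => //; exact: n1.
have K0 : K !=set0.
  exists ((nm v0)^-1%:C *: v0); split; first exact: nm_normalise.
  exists x; last by rewrite xv0 memvZ ?memv_line.
  by exists \1%VF; [exact: group1|exact: pact1].
have KA : K `<=` \bigcup_n A n.
  move=> v [v1 [_ [g Gg <-]]]; rewrite (pact_gen (groupGL G_group Gg) xv0) => vg.
  have [n nB] := bounded_part_exhaust Gg.
  by exists n => //; split=> //; exists g.
have [n [v1 Kv1 [a a0 aP]]] := baire_compact cK K0 (fun n => @bounded_orbit_closed v0 n%:R v00) KA.
have [v11 _] := Kv1.
have [_ [g0 g0B v1g0]] : A n v1 by apply: aP => //; rewrite subrr nm0.
have [Gg0 _ _] := g0B; have Lg0 := groupGL G_group Gg0.
have [k v1k] := vlineP _ _ v1g0.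
have k0 : k != 0 by apply/eqP => k0; move: (n1 _ v11); rewrite v1k k0 scale0r eqxx.
have near_v1 w y : \val y = <[w]>%VS -> orb G x y -> nm (w - v1) < a / 2 ->
    exists2 h : E, bounded_part n%:R h & w \in <[h v0]>%VS.
  move=> yw My wv1; have w0 := pspace_gen_neq0 yw; have w00 := nm_gt0 w0.
  have Kw : K ((nm w)^-1%:C *: w).
    by split; [exact: nm_normalise|exists y => //; rewrite yw memvZ ?memv_line].
  have [|_ [h hB hw]] := aP _ Kw.
    have := nmD ((nm w)^-1%:C *: w - w) (w - v1); rewrite addrA subrK.
    have -> : (nm w)^-1%:C *: w - w = ((nm w)^-1 - 1)%:C *: w.
      by rewrite rmorphB rmorph1 scalerBl scale1r.
    rewrite nmZr.
    have -> : `|(nm w)^-1 - 1| * nm w = `|1 - nm w|.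
      by rewrite -{2}(gtr0_norm w00) -normrM mulrBl mul1r mulVf ?gt_eqF.
    have h1 := nmD (w - v1) v1; have h2 := nmD (v1 - w) w; rewrite subrK nmB in h2.
    rewrite subrK in h1.
    have : `|1 - nm w| <= nm (w - v1) by rewrite ler_norml; apply/andP; split; lra.
    by lra.
  exists h => //; have -> : w = (nm w)%:C *: ((nm w)^-1%:C *: w).
    by rewrite scalerA -rmorphM mulfV ?scale1r // gt_eqF.
  by rewrite memvZ.
(* If [w] is close to [v0], then [g0 w] is on the line of [h v0] for some [h] in
   the bounded part. Close to any such [h] there is a product of [g0] and an
   element of the stabiliser of [x], and removing both factors leaves an element
   near the identity. *)
pose P (w : vtop V) (h : vtop E) : Prop := G h -> g0 w \in <[(h : E) v0]>%VS ->
  exists g, [/\ G g, nmE (g - \1%VF) < e & (w : V) \in <[g v0]>%VS].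
have loc (h : vtop E) : bounded_part n%:R h -> \forall h' \near h & w \near (v0 : vtop V), P w h'.
  move=> [Gh _ _]; have Lh := groupGL G_group Gh.
  have [/vlineP[c gc]|ngh] := boolP (g0 v0 \in <[(h : E) v0]>%VS); last first.
    have [d d0 dP] := not_parallel_near (GL_neq0 Lh v00) ngh.
    have [d1 d10 dP1] := app_near g0 v0 d0; have [d2 d20 dP2] := app_near h v0 d0.
    exists ([set h' : vtop E | nmE ((h' : E) - h) < d2], [set w : vtop V | nm ((w : V) - v0) < d1]).
      by split; [exact: (norm_ball_nbhs nmE_is_norm)|exact: nm_ball_nbhs].
    move=> [h' w] [/= h1 h2] _ hw; exfalso; move: hw; apply/negP; apply: dP.
      by apply: dP1 => //; rewrite subrr nmE0.
    by apply: dP2 => //; rewrite subrr nm0.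
  have c0 : c != 0.
    by apply/eqP => c0; move: (GL_neq0 Lg0 v00); rewrite gc c0 scale0r eqxx.
  (* [s] stabilises the line of [v0]. *)
  pose s : E := (g0^-1 \o (h : E))%VF.
  have Gs : G s by apply: groupM => //; exact: groupV.
  have Ls := groupGL G_group Gs.
  pose q := nmE (g0^-1)%VF * nmE (s^-1)%VF + 1.
  have q0 : 0 < q by rewrite ltr_wpDl // mulr_ge0 ?nmE_ge0.
  exists ([set h' : vtop E | nmE ((h' : E) - h) < e / q], setT).
    split; last exact: filterT.
    by apply: (norm_ball_nbhs nmE_is_norm); rewrite divr_gt0.
  move=> [h' w] [/= h1 _] Gh' /vlineP[m gw].
  exists (g0^-1 \o (h' : E) \o s^-1)%VF; split.
  - by apply: (groupM G_group); [apply: (groupM G_group) => //|]; exact: groupV.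
  - have -> : (g0^-1 \o (h' : E) \o s^-1)%VF - \1%VF = (g0^-1 \o ((h' : E) - h) \o s^-1)%VF.
      rewrite comp_lfunDr comp_lfunDl comp_lfunNr comp_lfunNl -/s.
      by rewrite (lker0_compfV Ls).
    apply: le_lt_trans (nmE_comp _ _) _.
    apply: (@le_lt_trans _ _ (nmE (g0^-1)%VF * nmE ((h' : E) - h) * nmE (s^-1)%VF)).
      by rewrite ler_wpM2r ?nmE_ge0 // nmE_comp.
    apply: (@le_lt_trans _ _ (q * nmE ((h' : E) - h))); last by rewrite mulrC -ltr_pdivlMr.
    by rewrite mulrAC ler_wpM2r ?nmE_ge0 // lerDl.
  - have sv : (s^-1)%VF v0 = c *: v0.
      have ss : s (c *: v0) = v0.
        by rewrite /s comp_lfunE linearZ /= -gc (lker0_lfunK Lg0).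
      by rewrite -{1}ss (lker0_lfunK Ls).
    rewrite !comp_lfunE sv !linearZ /=.
    have -> : (w : V) = m *: (g0^-1)%VF ((h' : E) v0).
      by rewrite -linearZ /= -gw (lker0_lfunK Lg0).
    by apply/vlineP; exists (m / c); rewrite scalerA divfK.
have far := (compact_near_coveringP _).1 (@bounded_part_compact n%:R) (vtop V) (nbhs (v0 : vtop V)) P
  (nbhs_filter (v0 : vtop V)) loc.
have [d d0 dP] := (vtop_nbhsP _ _).1 far.
pose q := normc k * nmE g0 + 1.
have q0 : 0 < q by rewrite ltr_wpDl // mulr_ge0 ?nmE_ge0 ?normc_ge0.
exists (Order.min d (a / 2 / q)) => [|w y yw]; first by rewrite lt_min d0 !divr_gt0.
rewrite lt_min => /andP[wd wa] My.
have My' : orb G x (pact g0 y).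
  case: My => g Gg <-; exists (g0 \o g)%VF; first exact: groupM.
  by rewrite (pactM _ Lg0 (groupGL G_group Gg)).
have [||h hB hw] := near_v1 (k *: g0 w) _ _ My'.
- rewrite (pact_gen Lg0 yw); apply/esym/vline_eqP; rewrite ?memvZ ?memv_line //.
  by rewrite scaler_eq0 negb_or k0 (GL_neq0 Lg0) // (pspace_gen_neq0 yw).
- rewrite v1k -scalerBr -linearB nmZ /=.
  apply: (@le_lt_trans _ _ (normc k * (nmE g0 * nm (w - v0)))).
    by rewrite ler_wpM2l ?normc_ge0 // nmE_app.
  apply: (@le_lt_trans _ _ (q * nm (w - v0))); last by rewrite mulrC -ltr_pdivlMr.
  by rewrite mulrA ler_wpM2r ?nm_ge0 // lerDl.
- have [Gh _ _] := hB.
  have [|g [Gg ge wg]] := dP w wd h hB Gh.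
    by rewrite -[g0 w](scalerK k0) memvZ.
  exists g; split=> //; apply: val_inj; rewrite (pact_gen (groupGL G_group Gg) xv0) yw.
  by apply: vline_eqP => //; exact: pspace_gen_neq0 yw.
Qed.

End OrbitMap.

(** * Levels of vectors and endomorphisms *)

Section Patterns.
Context {R : realType} {V : vectType R[i]}.
Context (e : (\dim {:V}).-tuple V) (eb : basis_of {:V} e) (c : 'I_(\dim {:V}) -> R).
Local Notation E := 'End(V).
Implicit Types (A B g : E) (v w : V) (r : rel R).

Lemma basis_coord v : v = \sum_i coord e i v *: e`_i.
Proof. by apply: coord_basis eb _; rewrite memvf. Qed.

Lemma coord_self (i j : 'I_(\dim {:V})) : coord e i e`_j = (i == j)%:R.
Proof. by rewrite coord_free ?(basis_free eb) // eq_sym. Qed.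

Lemma coord_eq v w : (forall i, coord e i v = coord e i w) -> v = w.
Proof.
move=> vw; rewrite (basis_coord v) (basis_coord w).
by apply: eq_bigr => i _; rewrite vw.
Qed.

Lemma coord_neq0 v : v != 0 -> exists i, coord e i v != 0.
Proof.
move=> v0; apply: contrapT => H; move/eqP: v0; apply; apply: coord_eq => i.
by rewrite linear0; apply/eqP; apply: contrapT => /negP vi; apply: H; exists i.
Qed.

Definition ent A (i j : 'I_(\dim {:V})) : R[i] := coord e i (A e`_j).

Lemma coord_app A v i : coord e i (A v) = \sum_j coord e j v * ent A i j.
Proof.
rewrite {1}(basis_coord v) !linear_sum; apply: eq_bigr => j _.
by rewrite !linearZ.
Qed.

Lemma coord_diag A (d : 'I_(\dim {:V}) -> R[i]) v i :
  (forall j : 'I_(\dim {:V}), A e`_j = d j *: e`_j) -> coord e i (A v) = d i * coord e i v.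
Proof.
move=> Ae; rewrite coord_app (bigD1 i) //= /ent Ae linearZ /= coord_self eqxx mulr1 mulrC.
rewrite big1 ?addr0 // => j ji; rewrite Ae linearZ /= coord_self.
by rewrite eq_sym (negbTE ji) !mulr0.
Qed.

Lemma ent_comp A B i j : ent (A \o B)%VF i j = \sum_k ent B k j * ent A i k.
Proof. by rewrite /ent comp_lfunE coord_app. Qed.

Lemma ent_eq A B : (forall i j, ent A i j = ent B i j) -> A = B.
Proof.
move=> AB; apply/lfunP => v; apply: coord_eq => i; rewrite !coord_app.
by apply: eq_bigr => j _; rewrite AB.
Qed.

(** The relations of interest for [r] are the strict order, its converse and equality,
    for the endomorphisms that lower, raise and preserve the level. *)
Definition pat r A : Prop := forall i j, ent A i j != 0 -> r (c i) (c j).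

Definition lev r v (s : R) : Prop := forall i, coord e i v != 0 -> r (c i) s.

Lemma pat0 r : pat r 0.
Proof. by move=> i j; rewrite /ent zero_lfunE linear0 eqxx. Qed.

Lemma pat_lin r (k : R[i]) A B : pat r A -> pat r B -> pat r (k *: A + B).
Proof.
move=> pA pB i j; rewrite /ent add_lfunE scale_lfunE linearD linearZ /= => h.
have [A0|] := eqVneq (ent A i j) 0; last exact: pA.
by apply: pB; move: h; rewrite /ent in A0; rewrite A0 mulr0 add0r.
Qed.

Lemma patD r A B : pat r A -> pat r B -> pat r (A + B).
Proof. by move=> pA pB; rewrite -[A]scale1r; exact: pat_lin. Qed.

Lemma patZ r (k : R[i]) A : pat r A -> pat r (k *: A).
Proof. by move=> pA; rewrite -[_ *: _]addr0; apply: pat_lin => //; exact: pat0. Qed.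

Lemma patN r A : pat r A -> pat r (- A).
Proof. by rewrite -scaleN1r; exact: patZ. Qed.

Lemma patB r A B : pat r A -> pat r B -> pat r (A - B).
Proof. by move=> pA pB; apply: patD => //; exact: patN. Qed.

Lemma lev0 r s : lev r 0 s.
Proof. by move=> i; rewrite linear0 eqxx. Qed.

Lemma lev_lin r (k : R[i]) v w s : lev r v s -> lev r w s -> lev r (k *: v + w) s.
Proof.
move=> pv pw i; rewrite linearD linearZ /= => h.
have [v0|] := eqVneq (coord e i v) 0; last exact: pv.
by apply: pw; move: h; rewrite v0 mulr0 add0r.
Qed.

Lemma levD r v w s : lev r v s -> lev r w s -> lev r (v + w) s.
Proof. by move=> pA pB; rewrite -[v]scale1r; exact: lev_lin. Qed.

Lemma levZ r (k : R[i]) v s : lev r v s -> lev r (k *: v) s.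
Proof. by move=> pA; rewrite -[_ *: _]addr0; apply: lev_lin => //; exact: lev0. Qed.

Lemma levB r v w s : lev r v s -> lev r w s -> lev r (v - w) s.
Proof. by move=> pA pB; apply: levD => //; rewrite -scaleN1r; exact: levZ. Qed.

Lemma sub_pat r r' A : subrel r r' -> pat r A -> pat r' A.
Proof. by move=> rr' pA i j /pA /rr'. Qed.

Lemma sub_lev r r' v s : subrel r r' -> lev r v s -> lev r' v s.
Proof. by move=> rr' pA i /pA /rr'. Qed.

Lemma pat_disjoint r r' A : (forall s t, r s t -> r' s t -> False) -> pat r A -> pat r' A -> A = 0.
Proof.
move=> rr' pA pA'; apply: ent_eq => i j; rewrite [RHS]/ent zero_lfunE linear0.
by apply/eqP; apply/negP => /negP h; apply: rr' (pA _ _ h) (pA' _ _ h).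
Qed.

Lemma lev_disjoint r r' v s : (forall t, r t s -> r' t s -> False) -> lev r v s -> lev r' v s -> v = 0.
Proof.
move=> rr' pA pA'; apply: coord_eq => i; rewrite linear0.
by apply/eqP; apply/negP => /negP h; apply: rr' (pA _ h) (pA' _ h).
Qed.

Lemma pat_comp r1 r2 r3 A B : (forall x y z, r1 x y -> r2 y z -> r3 x z) ->
  pat r1 A -> pat r2 B -> pat r3 (A \o B)%VF.
Proof.
move=> tr pA pB i j; rewrite ent_comp => h.
have [k] : exists k, ent B k j * ent A i k != 0.
  apply: contrapT => H; move/negP: h; apply; apply/eqP; apply: big1 => k _.
  by apply/eqP; apply: contrapT => /negP hk; apply: H; exists k.
rewrite mulf_eq0 negb_or => /andP[hB hA].
by apply: tr (pA _ _ hA) (pB _ _ hB).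
Qed.

Lemma lev_app r1 r2 r3 A v s : (forall x y z, r1 x y -> r2 y z -> r3 x z) ->
  pat r1 A -> lev r2 v s -> lev r3 (A v) s.
Proof.
move=> tr pA pB i; rewrite coord_app => h.
have [k] : exists k, coord e k v * ent A i k != 0.
  apply: contrapT => H; move/negP: h; apply; apply/eqP; apply: big1 => k _.
  by apply/eqP; apply: contrapT => /negP hk; apply: H; exists k.
rewrite mulf_eq0 negb_or => /andP[hB hA].
by apply: tr (pA _ _ hA) (pB _ hB).
Qed.

Lemma pat1 r : reflexive r -> pat r \1%VF.
Proof.
move=> rr i j; rewrite /ent id_lfunE coord_self.
by have [->|] := eqVneq i j; rewrite ?eqxx.
Qed.

Lemma pat_vspace r : exists U : {vspace E}, forall A, pat r A <-> A \in U.
Proof. by apply: linear_set_vspace => [|k A B]; [exact: pat0|exact: pat_lin]. Qed.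

(** All powers but the zeroth follow the pattern, which is a closed condition. *)
Lemma pat_expB1 r A : transitive r -> pat r A -> pat r (expE A - \1%VF).
Proof.
move=> tr pA; have [U UP] := pat_vspace r; apply/UP.
have pw k : pat r (powE A k.+1).
  elim: k => [|k IH]; first by rewrite /powE /= comp_lfun1r.
  by rewrite powES; apply: pat_comp pA IH => y x z; exact: tr.
have sw k : pat r (expS A k.+1 - \1%VF).
  elim: k => [|k IH].
    rewrite /expS big_ord1 invr1 scale1r subrr; exact: pat0.
  by rewrite expS_S addrAC; apply: patD => //; apply: patZ.
apply: (vspace_closed nmE_is_norm) => d d0.
have /(norm_cvgP nmE_is_norm)/(_ _ d0)[n _ nP] := @expS_cvg R V A.
exists (expS A n.+1 - \1%VF); first exact/UP.
by rewrite opprB addrA subrK; apply: nP => /=.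
Qed.

Lemma pat_exp r A : reflexive r -> transitive r -> pat r A -> pat r (expE A).
Proof.
by move=> rr tr /(pat_expB1 tr) pA; rewrite -[expE A](subrK \1%VF); apply: patD => //; exact: pat1.
Qed.

Lemma entry_norm : is_norm (fun A => \sum_i \sum_j normc (ent A i j)).
Proof.
have nn A : 0 <= \sum_i \sum_j normc (ent A i j).
  by apply: sumr_ge0 => i _; apply: sumr_ge0 => j _; exact: normc_ge0.
split=> [A B|k A|A A0].
- rewrite -big_split; apply: ler_sum => i _; rewrite -big_split; apply: ler_sum => j _.
  by rewrite /ent add_lfunE linearD le_normcD.
- rewrite mulr_sumr; apply: eq_bigr => i _; rewrite mulr_sumr; apply: eq_bigr => j _.
  by rewrite /ent scale_lfunE linearZ normcM.
- apply: ent_eq => i j; rewrite [RHS]/ent zero_lfunE linear0; apply: eq0_normc.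
  apply/eqP; rewrite eq_le normc_ge0 andbT -A0 (bigD1 i) //= (bigD1 j) //= -addrA lerDl.
  rewrite addr_ge0 // ?sumr_ge0 // => k _; rewrite ?normc_ge0 //.
  by apply: sumr_ge0 => l _; rewrite normc_ge0.
Qed.

Section DiagonalFlow.
Context (X : E) (Xe : forall i : 'I_(\dim {:V}), X e`_i = (c i)%:C *: e`_i).

Lemma exp_basis (t : R) (i : 'I_(\dim {:V})) : expE (t%:C *: X) e`_i = (expR (t * c i))%:C *: e`_i.
Proof. by apply: expE_eigen; rewrite scale_lfunE Xe scalerA -rmorphM. Qed.

Lemma coord_exp (t : R) v i : coord e i (expE (t%:C *: X) v) = (expR (t * c i))%:C * coord e i v.
Proof. exact: (coord_diag (d := fun j => (expR (t * c j))%:C) v i (exp_basis t)). Qed.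

Definition expconj (t : R) A : E := (expE (t%:C *: X) \o A \o expE ((- t)%:C *: X))%VF.

Lemma ent_expconj t A i j : ent (expconj t A) i j = (expR (t * (c i - c j)))%:C * ent A i j.
Proof.
rewrite /ent /expconj !comp_lfunE exp_basis !linearZ /= coord_exp mulrA -rmorphM -expRD.
by congr ((expR _)%:C * _); ring.
Qed.

Lemma pat_expconj r t A : pat r A -> pat r (expconj t A).
Proof.
by move=> pA i j; rewrite ent_expconj mulf_eq0 negb_or => /andP[_]; exact: pA.
Qed.

Lemma expconjK t A : expconj (- t) (expconj t A) = A.
Proof.
apply: ent_eq => i j; rewrite !ent_expconj mulrA -rmorphM -expRD.
by rewrite mulNr addNr expR0 mul1r.
Qed.

Lemma expconj1 t : expconj t \1%VF = \1%VF.
Proof. by rewrite /expconj comp_lfun1r rmorphN scaleNr expEN. Qed.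

Lemma expconjB t A B : expconj t (A - B) = expconj t A - expconj t B.
Proof. by apply: ent_eq => i j; rewrite ent_expconj /ent !add_lfunE !opp_lfunE !linearB /= -!/(ent _ _ _) !ent_expconj mulrBr. Qed.

(** Finitely many positive gaps between levels have a positive minimum. *)
Lemma level_gap : exists2 d : R, 0 < d & forall i j, c i < c j -> c i + d <= c j.
Proof.
exists (\big[Order.min/1]_(p : 'I_(\dim {:V}) * 'I_(\dim {:V}) | c p.1 < c p.2) (c p.2 - c p.1)).
  by elim/big_ind : _ => // [x y x0 y0|p]; rewrite ?lt_min ?x0 // subr_gt0.
move=> i j ij; rewrite -lerBrDl.
exact: (@bigmin_le_cond _ _ _ _ (i, j)).
Qed.

Lemma expR_decay (d B eta : R) : 0 < d -> 0 <= B -> 0 < eta ->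
  exists2 T : R, 0 <= T & forall t s, T <= t -> s <= - d -> expR (t * s) * B < eta.
Proof.
move=> d0 B0 eta0; exists (B / (eta * d)) => [|t s Tt sd].
  by rewrite divr_ge0 // mulr_ge0 // ltW.
have t0 : 0 <= t by apply: le_trans Tt; rewrite divr_ge0 // mulr_ge0 // ltW.
apply: (@le_lt_trans _ _ (expR (- (t * d)) * B)).
  by rewrite ler_wpM2r // ler_expR -mulrN ler_wpM2l.
rewrite expRN mulrC ltr_pdivrMr ?expR_gt0 //.
have h1 := expR_ge1Dx (t * d).
apply: (@lt_le_trans _ _ (eta * (1 + t * d))); last by rewrite ler_pM2l.
move: Tt; rewrite ler_pdivrMr ?mulr_gt0 // mulrDr mulr1 mulrCA => Tt.
by apply: le_lt_trans Tt _; rewrite ltrDr.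
Qed.

Lemma expconj_small A (eta : R) : 0 < eta -> pat <%R A -> exists t, nmE (expconj t A) < eta.
Proof.
move=> eta0 pA; have [K K0 KP] := norm_upper (@nmE_is_norm R V).
have [L L0 LP] := norm_lower entry_norm.
have [d d0 dP] := level_gap.
pose B := \sum_i \sum_j normc (ent A i j).
have B0 : 0 <= B by apply: sumr_ge0 => i _; apply: sumr_ge0 => j _; exact: normc_ge0.
have [T T0 TP] := expR_decay d0 B0 (divr_gt0 (divr_gt0 eta0 K0) L0).
exists T; apply: le_lt_trans (KP _) _; rewrite mulrC -ltr_pdivlMr //.
apply: le_lt_trans (LP _) _; rewrite mulrC -ltr_pdivlMr //.
apply: le_lt_trans (TP T (- d) (lexx _) (lexx _)).
rewrite /B mulr_sumr; apply: ler_sum => i _; rewrite mulr_sumr; apply: ler_sum => j _.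
rewrite ent_expconj normcM normcR ger0_norm ?expR_ge0 //.
have [->|/pA ij] := eqVneq (ent A i j) 0; first by rewrite normc0 !mulr0.
rewrite ler_wpM2r ?normc_ge0 // ler_expR ler_wpM2l //; last by have := dP _ _ ij; lra.
Qed.

End DiagonalFlow.
End Patterns.

(** * The flow on lines and the level lowering group *)

Section Cells.
Context {R : realType} {V : vectType R[i]}.
Context (e : (\dim {:V}).-tuple V) (eb : basis_of {:V} e).
Local Notation E := 'End(V).
Local Notation I := 'I_(\dim {:V}).
Implicit Types (c : I -> R) (A B g h X Y : E) (v w u : V) (x y z : pspace V).

Local Notation gtr := (fun s t : R => t < s).
Local Notation ger := (fun s t : R => t <= s).
Local Notation eqr := (fun s t : R => s == t).

Definition flowE X (t : R) y : pspace V := pact (expE (t%:C *: X)) y.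

(** [v] collects the coordinates of maximal level. *)
Lemma top_part c u : u != 0 ->
  exists s v, [/\ v != 0, lev e c eqr v s, lev e c <%R (u - v) s & exists i, s = c i].
Proof.
move=> u0; have [i0 ui0] := coord_neq0 eb u0.
case: (@arg_maxP _ _ _ i0 (fun i => coord e i u != 0) c ui0) => i ui imax.
pose v := \sum_(k | c k == c i) coord e k u *: e`_k.
have vk k : coord e k v = (c k == c i)%:R * coord e k u.
  rewrite /v linear_sum /=; have [ck|ck] := eqVneq (c k) (c i).
    rewrite (bigD1 k) /= ?ck // linearZ /= coord_self // eqxx mulr1 mul1r big1 ?addr0 // => j /andP[_ jk].
    by rewrite linearZ /= coord_self // eq_sym (negbTE jk) mulr0.
  rewrite mul0r big1 // => j cj; rewrite linearZ /= coord_self //.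
  have [kj|] := eqVneq k j; last by rewrite mulr0.
  by move: ck; rewrite kj cj.
exists (c i), v; split.
- apply/eqP => v0; have := vk i; rewrite v0 linear0 eqxx mul1r => /esym/eqP.
  by rewrite (negbTE ui).
- by move=> k; rewrite vk; have [_|] := eqVneq (c k) (c i); rewrite ?mul0r ?eqxx.
- move=> k; rewrite linearB /= vk; have [_|ck] := eqVneq (c k) (c i).
    by rewrite mul1r subrr eqxx.
  rewrite mul0r subr0 => uk; have cki : c k <= c i := imax k uk.
  by rewrite lt_neqAle ck.
- by exists i.
Qed.

Lemma coord_norm : is_norm (fun v => \sum_i normc (coord e i v)).
Proof.
split=> [v w|a v|v v0].
- by rewrite -big_split; apply: ler_sum => i _; rewrite linearD le_normcD.
- by rewrite mulr_sumr; apply: eq_bigr => i _; rewrite linearZ normcM.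
- apply: (coord_eq eb) => i; rewrite linear0; apply: eq0_normc.
  apply/eqP; rewrite eq_le normc_ge0 andbT -v0 (bigD1 i) //= lerDl sumr_ge0 // => j _.
  exact: normc_ge0.
Qed.

Section OneDirection.
Context (c : I -> R) (X : E) (Xe : forall i : I, X e`_i = (c i)%:C *: e`_i).

Lemma exp_lev t v s : lev e c eqr v s -> expE (t%:C *: X) v = (expR (t * s))%:C *: v.
Proof.
move=> vs; apply: (coord_eq eb) => i; rewrite (coord_exp eb Xe) linearZ /=.
have [->|/vs/eqP ->//] := eqVneq (coord e i v) 0; by rewrite !mulr0.
Qed.

Lemma flow_fixed x v s t : \val x = <[v]>%VS -> lev e c eqr v s -> flowE X t x = x.
Proof.
move=> xv vs; apply: val_inj; rewrite (pact_gen (expE_GL _) xv) xv (exp_lev _ vs).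
apply: vline_eqP; last by rewrite memvZ ?memv_line.
by rewrite scaler_eq0 negb_or (pspace_gen_neq0 xv) expRC_neq0.
Qed.

Lemma fixed_lev x v : \val x = <[v]>%VS -> (forall t, flowE X t x = x) ->
  exists s, lev e c eqr v s.
Proof.
move=> xv fx; have v0 := pspace_gen_neq0 xv.
have [s [w [w0 ws vw [i si]]]] := top_part c v0.
have [j wj] := coord_neq0 eb w0; have /eqP cj := ws _ wj.
have vj : coord e j v != 0.
  apply/eqP => vj; have := vw j; rewrite linearB /= vj sub0r oppr_eq0 => /(_ wj).
  by rewrite cj ltxx.
have : expE (1%:C *: X) v \in <[v]>%VS.
  by rewrite -xv -(fx 1) (pact_gen (expE_GL _) xv) memv_line.
move=> /vlineP[k kv].
have kc l : coord e l v != 0 -> k = (expR (c l))%:C.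
  move=> vl; apply: (mulIf vl); have := congr1 (coord e l) kv.
  by rewrite (coord_exp eb Xe) mul1r linearZ.
exists s => l vl; rewrite /= -cj; apply/eqP; apply: (can_inj (@expRK R)).
have := kc _ vl; rewrite (kc _ vj) => /(congr1 (@complex.Re R)) /= ->; by [].
Qed.

Lemma pspace_cvgP (f : R -> pspace V) x v : \val x = <[v]>%VS ->
  (forall d : R, 0 < d -> exists T, forall t, T <= t ->
     exists2 w, \val (f t) = <[w]>%VS & nm (w - v) < d) ->
  f t @[t --> +oo%R] --> x.
Proof.
move=> xv H U /(pnbhsP _ xv)[d d0 dU]; have [T TP] := H _ d0.
exists T; split; first exact: num_real.
move=> t /ltW /TP[w fw wv]; exact: dU fw wv.
Qed.

(** After division by the growth rate of the component [v] of highest level, what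
    remains decays at a rate given by the gap between levels. *)
Lemma flow_limit x y u v s : \val y = <[u]>%VS -> \val x = <[v]>%VS ->
  lev e c eqr v s -> lev e c <%R (u - v) s -> flowE X t y @[t --> +oo%R] --> x.
Proof.
move=> yu xv vs uv; apply: (pspace_cvgP xv) => d d0.
have v0 := pspace_gen_neq0 xv.
have [j vj] := coord_neq0 eb v0.
have /eqP cj := vs _ vj.
have [K K0 KP] := norm_lower coord_norm; have [q q0 qP] := level_gap c.
pose B := \sum_i normc (coord e i (u - v)).
have B0 : 0 <= B by apply: sumr_ge0 => i _; exact: normc_ge0.
have [T T0 TP] := expR_decay q0 B0 (divr_gt0 d0 K0).
exists T => t Tt; exists ((expR (- (t * s)))%:C *: expE (t%:C *: X) u).
  rewrite (pact_gen (expE_GL _) yu); apply/esym/vline_eqP; last by rewrite memvZ ?memv_line.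
  by rewrite scaler_eq0 negb_or (GL_neq0 (expE_GL _) (pspace_gen_neq0 yu)) expRC_neq0.
have -> : (expR (- (t * s)))%:C *: expE (t%:C *: X) u - v =
    (expR (- (t * s)))%:C *: expE (t%:C *: X) (u - v).
  rewrite linearB /= (exp_lev _ vs) scalerBr scalerA -rmorphM -expRD addNr expR0.
  by rewrite rmorph1 scale1r.
apply: le_lt_trans (KP _) _; rewrite mulrC -ltr_pdivlMr //.
apply: le_lt_trans (TP t (- q) Tt (lexx _)).
rewrite /B mulr_sumr; apply: ler_sum => i _.
rewrite linearZ /= (coord_exp eb Xe) !normcM !normcR !(ger0_norm (expR_ge0 _)) mulrA -expRD.
have [->|/uv ci] := eqVneq (coord e i (u - v)) 0; first by rewrite normc0 !mulr0.
rewrite ler_wpM2r ?normc_ge0 // ler_expR.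
rewrite (_ : - (t * s) + t * c i = t * (c i - s)); last by ring.
rewrite ler_wpM2l ?(le_trans T0) //.
by have := qP i j; rewrite cj => /(_ ci); lra.
Qed.

(** By uniqueness of limits [x] is spanned by the component of highest level of any
    generator of [y]. *)
Lemma flow_limit_gen x y v s : \val x = <[v]>%VS -> lev e c eqr v s ->
  flowE X t y @[t --> +oo%R] --> x ->
  exists2 u, \val y = <[u]>%VS & lev e c <%R (u - v) s.
Proof.
move=> xv vs fyx; have [u u0 yu] := pspace_gen y.
have [s' [w [w0 ws uw _]]] := top_part c u0.
have [x' x'w] := pspace_mk w0.
have xx' : x = x'.
  have fyx' := flow_limit yu x'w ws uw.
  exact: (cvg_unique (@pspace_hausdorff R V) fyx fyx').
have /vlineP[k vk] : v \in <[w]>%VS by rewrite -x'w -xx' xv memv_line.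
have k0 : k != 0 by apply/eqP => k0; move: (pspace_gen_neq0 xv); rewrite vk k0 scale0r eqxx.
have ss' : s = s'.
  have [j vj] := coord_neq0 eb (pspace_gen_neq0 xv).
  have /eqP <- := vs _ vj; apply/eqP; apply: ws; move: vj; rewrite vk linearZ /= mulf_eq0 negb_or.
  by case/andP.
exists (k *: u); last by rewrite vk -scalerBr ss'; exact: levZ.
rewrite yu; apply/esym/vline_eqP; last by rewrite memvZ ?memv_line.
by rewrite scaler_eq0 negb_or k0.
Qed.

End OneDirection.

Section UnipotentGroups.
Context (G : set E) (G_group : is_subgroup G) (G_closed : closed_in_GL G).
Context (g_complex : is_csubspace (lie G)).

(** For the level defined by [X] this turns out to be [N], and for the opposite
    level its image under the Cartan involution. *)
Definition unip c : set E := expE @` [set Y | lie G Y /\ pat e c <%R Y].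

Lemma unip_G c g : unip c g -> G g.
Proof. by move=> [Y [gY _] <-]; exact: (lie_exp gY). Qed.

Lemma unip_pat c g : unip c g -> pat e c <%R (g - \1%VF).
Proof. by move=> [Y [_ pY] <-]; apply: (pat_expB1 eb) => // y x z; exact: lt_trans. Qed.

Lemma unipV c g : unip c g -> unip c (g^-1)%VF.
Proof.
move=> [Y [gY pY] <-]; exists (- Y); last by rewrite expEV.
by split; [exact: lieN|exact: patN].
Qed.

Lemma lie_vspace c (r : rel R) :
  exists U : {vspace E}, forall Y, (lie G Y /\ pat e c r Y) <-> Y \in U.
Proof.
have [l0 lP] := g_complex.
apply: (linear_set_vspace (S := [set Y | lie G Y /\ pat e c r Y])).
  by split=> //; exact: pat0.
by move=> k Y Z [gY pY] [gZ pZ]; split; [exact: lP|exact: pat_lin].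
Qed.

Section Decomposition.
Context (c : I -> R) (X : E) (Xe : forall i : I, X e`_i = (c i)%:C *: e`_i).
Context (gX : lie G X).
Context (g_split : forall Y, lie G Y -> exists Y1 Y2 Y3,
  [/\ lie G Y1 /\ pat e c <%R Y1, lie G Y2 /\ pat e c gtr Y2, lie G Y3 /\ pat e c eqr Y3
    & Y = Y1 + (Y2 + Y3)]).

Let flow_G t : G (expE (t%:C *: X)).
Proof. exact: (lie_exp (lieZ t gX)). Qed.

Lemma local_triangular : exists2 d : R, 0 < d & forall y : E, nmE (y - \1%VF) <= d -> G y ->
  exists Y1 Y2 Y3,
  [/\ lie G Y1 /\ pat e c <%R Y1, lie G Y2 /\ pat e c gtr Y2, lie G Y3 /\ pat e c eqr Y3
    & y = (expE Y1 \o (expE Y2 \o expE Y3))%VF].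
Proof.
have [U1 U1P] := lie_vspace c <%R; have [U2 U2P] := lie_vspace c gtr.
have [U3 U3P] := lie_vspace c eqr; have [l0 lP] := g_complex.
have lD Y Z : lie G Y -> lie G Z -> lie G (Y + Z).
  by move=> gY gZ; rewrite -[Y]scale1r; exact: lP.
have gP Y : lie G Y <-> Y \in (U1 + (U2 + U3))%VS.
  split=> [/g_split[Y1 [Y2 [Y3 [/U1P h1 /U2P h2 /U3P h3 ->]]]]|].
    by rewrite !memv_add.
  move=> /memv_addP[Y1 /U1P[h1 _] [_ /memv_addP[Y2 /U2P[h2 _] [Y3 /U3P[h3 _] ->]] ->]].
  by apply: (lD) => //; exact: lD.
have [d d0 dP] := local_decomposition G_group G_closed gP.
exists d => // y yd Gy; have [Y1 [Y2 [Y3 [/U1P h1 /U2P h2 /U3P h3 ->]]]] := dP _ yd Gy.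
by exists Y1, Y2, Y3.
Qed.

Lemma expconj_G t g : G g -> G (expconj X t g).
Proof.
move=> Gg; apply: (groupM G_group); last exact: flow_G.
by apply: (groupM G_group) => //; exact: flow_G.
Qed.

Lemma expconj_unip t g : unip c g -> unip c (expconj X t g).
Proof.
move=> [Y [gY pY] <-]; exists (expconj X t Y).
  split; last exact: (pat_expconj eb Xe).
  have := lie_conj G_group (flow_G t) gY.
  by rewrite /expconj expEV rmorphN scaleNr.
rewrite /expconj rmorphN scaleNr -expEV expE_conj //; exact: expE_GL.
Qed.

(** Conjugation by the flow contracts the right-hand side to the identity, near
    which the group is parametrised by the three kinds of exponentials. *)
Lemma unipP g : unip c g <-> G g /\ pat e c <%R (g - \1%VF).
Proof.
split=> [gu|[Gg pg]]; first by split; [exact: (unip_G gu)|exact: unip_pat].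
have [d d0 dP] := local_triangular.
have [t tP] := expconj_small eb Xe d0 pg.
rewrite (expconjB eb Xe) (expconj1 X) in tP.
have [Y1 [Y2 [Y3 [[gY1 p1] [_ p2] [_ p3] ge]]]] := dP _ (ltW tP) (expconj_G t Gg).
suff e1 : expconj X t g = expE Y1.
  rewrite -(expconjK eb Xe t g) e1; apply: expconj_unip.
  by exists Y1.
pose h := (expE Y2 \o expE Y3)%VF.
have hge : pat e c ger h.
  have ger_trans : transitive ger by move=> y x z /= h1 h2; exact: le_trans h2 h1.
  apply: (@pat_comp _ _ _ eb c ger ger ger) => [x y z /= h1 h2||]; first exact: le_trans h2 h1.
    by apply: (pat_exp eb); [move=> x; exact: lexx|exact: ger_trans|apply: sub_pat p2 => x y /= /ltW].
  by apply: (pat_exp eb); [move=> x; exact: lexx|exact: ger_trans|apply: sub_pat p3 => x y /= /eqP ->].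
have hlt : pat e c <%R (h - \1%VF).
  have pc : pat e c <%R (expconj X t g - \1%VF).
    by rewrite -(expconj1 X t) -(expconjB eb Xe); exact: (pat_expconj eb Xe).
  have pN : pat e c <%R (expE (- Y1) - \1%VF).
    by apply: (pat_expB1 eb); [move=> y x z; exact: lt_trans|exact: patN].
  have -> : h - \1%VF = ((expE (- Y1) - \1%VF) \o (expconj X t g - \1%VF))%VF +
      ((expE (- Y1) - \1%VF) + (expconj X t g - \1%VF)).
    have -> : h = (expE (- Y1) \o expconj X t g)%VF.
      by rewrite ge comp_lfunA expNE comp_lfun1l.
    rewrite !comp_lfunDl !comp_lfunDr !comp_lfunNl !comp_lfunNr !comp_lfun1l !comp_lfun1r.
    by vring.
  apply: patD; last exact: patD.
  by apply: (pat_comp eb _ pN pc) => x y z; exact: lt_trans.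
have h1 : h - \1%VF = 0.
  apply: (pat_disjoint eb _ hlt (r' := ger)) => [s t' /= h1 h2|].
    by move: (le_lt_trans h2 h1); rewrite ltxx.
  by apply: patB => //; apply: (pat1 eb) => x; exact: lexx.
by rewrite ge -/h (subr0_eq h1) comp_lfun1r.
Qed.

Lemma unipM g h : unip c g -> unip c h -> unip c (g \o h)%VF.
Proof.
move=> gu hu; apply/unipP; split; first by apply: (groupM G_group); [exact: (unip_G gu)|exact: (unip_G hu)].
have -> : (g \o h)%VF - \1%VF = ((g - \1%VF) \o (h - \1%VF))%VF + ((g - \1%VF) + (h - \1%VF)).
  rewrite !comp_lfunDl !comp_lfunDr !comp_lfunNl !comp_lfunNr !comp_lfun1l !comp_lfun1r.
  by vring.
apply: patD; last by apply: patD; exact: unip_pat.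
by apply: (pat_comp eb _ (unip_pat gu) (unip_pat hu)) => x y z; exact: lt_trans.
Qed.

End Decomposition.
End UnipotentGroups.
End Cells.

(** * The open cell and the stable set of a fixed point *)

Section OrbitCells.
Context {R : realType} {V : vectType R[i]}.
Context (e : (\dim {:V}).-tuple V) (eb : basis_of {:V} e).
Local Notation E := 'End(V).
Local Notation I := 'I_(\dim {:V}).
Implicit Types (A B g h Y : E) (v w u : V) (x y z : pspace V).
Context (G : set E) (G_group : is_subgroup G) (G_closed : closed_in_GL G).
Context (g_complex : is_csubspace (lie G)).

Local Notation gtr := (fun s t : R => t < s).
Local Notation eqr := (fun s t : R => s == t).

(** In the application the three parts are the nilradical, its opposite and
    [a + i a]. Reversing the flow exchanges the first two. *)
Definition triangular (c : I -> R) : Prop := forall Y, lie G Y -> exists Y1 Y2 Y3,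
  [/\ lie G Y1 /\ pat e c <%R Y1, lie G Y2 /\ pat e c gtr Y2, lie G Y3 /\ pat e c eqr Y3
    & Y = Y1 + (Y2 + Y3)].

Definition eigenbasis (c : I -> R) (X : E) : Prop :=
  forall i : I, X e`_i = (c i)%:C *: e`_i.

Definition opp_level (c : I -> R) : I -> R := fun i => - c i.

Lemma pat_opp_lt c A : pat e (opp_level c) <%R A <-> pat e c gtr A.
Proof. by split=> pA i j /pA; rewrite /opp_level /= ltrN2. Qed.

Lemma pat_opp_gt c A : pat e (opp_level c) gtr A <-> pat e c <%R A.
Proof. by split=> pA i j /pA; rewrite /opp_level /= ltrN2. Qed.

Lemma pat_opp_eq c A : pat e (opp_level c) eqr A <-> pat e c eqr A.
Proof. by split=> pA i j /pA; rewrite /opp_level /= (inj_eq oppr_inj). Qed.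

Lemma lev_opp_eq c v s : lev e c eqr v s -> lev e (opp_level c) eqr v (- s).
Proof. by move=> pA i /pA; rewrite /opp_level /= (inj_eq oppr_inj). Qed.

Lemma lev_opp_gt c v s : lev e (opp_level c) <%R v (- s) -> lev e c gtr v s.
Proof. by move=> pA i /pA; rewrite /opp_level /= ltrN2. Qed.

Lemma triangular_opp c : triangular c -> triangular (opp_level c).
Proof.
move=> tc Y /tc[Y1 [Y2 [Y3 [[h1 p1] [h2 p2] [h3 p3] ->]]]].
exists Y2, Y1, Y3; split; last by rewrite addrCA.
- by split=> //; apply/pat_opp_lt.
- by split=> //; apply/pat_opp_gt.
- by split=> //; apply/pat_opp_eq.
Qed.

Lemma eigenbasis_opp c X : eigenbasis c X -> eigenbasis (opp_level c) (- X).
Proof. by move=> Xe i; rewrite opp_lfunE Xe /opp_level rmorphN scaleNr. Qed.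

(** A fixed point of the flow with a generator [v] of level [s]; the last condition
    removes the third factor of the local parametrisation of the group. *)
Definition fixed_gen (c : I -> R) x v s : Prop :=
  [/\ \val x = <[v]>%VS, lev e c eqr v s
    & forall Y, lie G Y -> pat e c eqr Y -> pact (expE Y) x = x].

Lemma fixed_gen_opp c x v s : fixed_gen c x v s -> fixed_gen (opp_level c) x v (- s).
Proof.
by move=> [h1 h2 h3]; split=> //; [exact: lev_opp_eq|move=> Y gY /pat_opp_eq; exact: h3].
Qed.

(** Points near [x] are images of [x] under group elements near the identity, which
    factor into exponentials of the three parts of the Lie algebra. *)
Lemma big_cell c x v s : triangular c -> closed (orb G x) -> fixed_gen c x v s ->
  exists2 d : R, 0 < d & forall w y, \val y = <[w]>%VS -> nm (w - v) < d -> orb G x y ->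
    exists g1 g2, [/\ unip e G c g1, unip e G (opp_level c) g2 & y = pact g1 (pact g2 x)].
Proof.
move=> tc Mc [xv vs fx].
have [d d0 dP] := local_triangular G_group G_closed g_complex tc.
have [b b0 bP] := orbit_map_open G_group G_closed Mc xv d0.
exists b => // w y yw wv My; have [g [Gg gd ->]] := bP _ _ yw wv My.
have [Y1 [Y2 [Y3 [[gY1 p1] [gY2 p2] [gY3 p3] ->]]]] := dP _ (ltW gd) Gg.
exists (expE Y1), (expE Y2); split; first by exists Y1.
  by exists Y2 => //; split=> //; apply/pat_opp_lt.
rewrite (pactM _ (expE_GL Y1) (GL_comp (expE_GL Y2) (expE_GL Y3))).
by rewrite (pactM _ (expE_GL Y2) (expE_GL Y3)) fx.
Qed.

(** The terms of [g u - u] are below the highest level of [u]. *)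
Lemma unip_lev c g u v s : unip e G c g -> lev e c eqr v s -> lev e c <%R (u - v) s ->
  lev e c <%R (g u - v) s.
Proof.
move=> gu vs uv.
have -> : g u - v = (g - \1%VF) u + (u - v).
  by rewrite add_lfunE opp_lfunE id_lfunE addrA subrK.
apply: levD => //.
apply: (@lev_app _ _ _ eb c <%R (fun s t => s <= t) <%R _ u s) (unip_pat eb gu) _ => [a b d|].
  exact: lt_le_trans.
rewrite -[u](subrK v); apply: levD; first by apply: sub_lev uv => a b /ltW.
by apply: sub_lev vs => a b /= /eqP ->.
Qed.

Lemma unip_gen c g x v s : unip e G c g -> \val x = <[v]>%VS -> lev e c eqr v s ->
  exists2 u, \val (pact g x) = <[u]>%VS & lev e c <%R (u - v) s.
Proof.
move=> gu xv vs; exists (g v); last by apply: unip_lev => //; rewrite subrr; exact: lev0.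
exact: (pact_gen (groupGL G_group (unip_G gu)) xv).
Qed.

(** The hypotheses say that [y] tends to [x] in both directions of time. As [u] and
    [u'] are proportional, the terms of [u - v] are of level at least [s], and by
    assumption they are of level less than [s]. *)
Lemma both_limits c x y v u u' s : \val x = <[v]>%VS -> lev e c eqr v s ->
  \val y = <[u]>%VS -> lev e c <%R (u - v) s ->
  \val y = <[u']>%VS -> lev e c gtr (u' - v) s -> y = x.
Proof.
move=> xv vs yu uv yu' u'v; apply: val_inj; rewrite xv.
have /vlineP[k uk] : u \in <[u']>%VS by rewrite -yu' yu memv_line.
suff uv0 : u - v = 0 by rewrite yu (subr0_eq uv0).
have E1 : u - v = (k - 1) *: v + k *: (u' - v) by rewrite uk scalerBr scalerBl scale1r [RHS]addrC addrA subrK.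
apply: (lev_disjoint eb _ uv (r' := fun a b => b <= a)) => [t /= h1 h2|].
  by move: (le_lt_trans h2 h1); rewrite ltxx.
rewrite E1; apply: levD; apply: levZ; first by apply: sub_lev vs => a b /= /eqP ->.
by apply: sub_lev u'v => a b /= /ltW.
Qed.

Lemma orb_pact g x y : G g -> orb G x y -> orb G x (pact g y).
Proof.
move=> Gg [h Gh <-]; exists (g \o h)%VF; first exact: groupM.
by rewrite (pactM _ (groupGL G_group Gg) (groupGL G_group Gh)).
Qed.

Lemma pactKV g x : GL g -> pact (g^-1)%VF (pact g x) = x.
Proof.
move=> g0; have [v v0 xv] := pspace_gen x; apply: val_inj.
have gV0 : GL (g^-1)%VF.
  by apply/lker0P => a b ab; rewrite -(lker0_lfunVK g0 a) ab (lker0_lfunVK g0).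
by rewrite (pact_gen gV0 (pact_gen g0 xv)) (lker0_lfunK g0).
Qed.

Lemma flowK X t y : flowE X (- t) (flowE X t y) = y.
Proof.
rewrite -[RHS](pactKV y (expE_GL (t%:C *: X))) expEV /flowE.
by rewrite rmorphN scaleNr.
Qed.

Lemma flow_expconj X t g y : GL g ->
  pact (expconj X t g) y = flowE X t (pact g (flowE X (- t) y)).
Proof.
move=> g0; rewrite /expconj /flowE.
by rewrite (pactM _ (GL_comp (expE_GL _) g0) (expE_GL _)) (pactM _ (expE_GL _) g0).
Qed.

Section Flow.
Context (c : I -> R) (X : E) (Xe : eigenbasis c X) (gX : lie G X) (tc : triangular c).

(** Flow a point of the stable set into the open cell of [x], transport the
    resulting factorisation back, and note that the factor from the opposite
    unipotent group must fix [x]. *)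
Lemma stable_cell x v s y : closed (orb G x) -> fixed_gen c x v s -> orb G x y ->
  (flowE X t y @[t --> +oo%R] --> x) <-> exists2 g, unip e G c g & y = pact g x.
Proof.
move=> Mc fx My; have [xv vs _] := fx; split; last first.
  move=> [g gu ->]; have [u yu uv] := unip_gen gu xv vs.
  exact: (flow_limit eb Xe yu xv vs uv).
move=> yx; have [d d0 dP] := big_cell tc Mc fx.
pose U : set (pspace V) := [set z | orb G x z -> exists g1 g2,
  [/\ unip e G c g1, unip e G (opp_level c) g2 & z = pact g1 (pact g2 x)]].
have NU : nbhs x U by apply/(pnbhsP _ xv); exists d => // w z zw wv; exact: dP zw wv.
have [T [_ TP]] := yx _ NU.
have Tt : T < T + 1 by rewrite ltrDl.
have fG t : G (expE (t%:C *: X)) by exact: (lie_exp (lieZ t gX)).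
have [|g1 [g2 [u1 u2 fy]]] := TP _ Tt; first exact: orb_pact.
set t := T + 1 in fy.
(* The factors of the position at time [t], transported back to time zero. *)
have L1 := groupGL G_group (unip_G u1); have L2 := groupGL G_group (unip_G u2).
pose k1 := expconj X (- t) g1; pose k2 := expconj X (- t) g2.
have ku1 : unip e G c k1 by exact: (expconj_unip eb G_group Xe gX).
have ku2 : unip e G (opp_level c) k2.
  rewrite /k2 (_ : expconj X (- t) g2 = expconj (- X) t g2).
    exact: (expconj_unip eb G_group (eigenbasis_opp Xe) (lieN gX)).
  by rewrite /expconj opprK rmorphN !scalerN scaleNr opprK.
have yk : y = pact k1 (pact k2 x).
  rewrite -(flowK X t y) fy /k1 /k2 (flow_expconj _ _ _ L1) (flow_expconj _ _ _ L2) opprK.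
  rewrite (flow_fixed eb Xe t xv vs); congr (flowE _ _ (pact _ _)).
  by rewrite -{1}(flowK X (- t) (pact g2 x)) opprK.
exists k1 => //.
have [u yu uv] := flow_limit_gen eb Xe xv vs yx.
have Lk1 := groupGL G_group (unip_G ku1).
have k1V := unipV ku1.
have zk : pact (k1^-1)%VF y = pact k2 x by rewrite yk pactKV.
have [u' zu' u'v] := unip_gen ku2 xv (lev_opp_eq vs).
have zu : \val (pact k2 x) = <[(k1^-1)%VF u]>%VS.
  by rewrite -zk (pact_gen (groupGL G_group (unip_G k1V)) yu).
have u1v := unip_lev k1V vs uv.
by rewrite yk (both_limits xv vs zu u1v zu' (lev_opp_gt u'v)).
Qed.

End Flow.
End OrbitCells.

(** * Closures of the stable sets *)

Section BruhatOrder.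
Context {R : realType} {V : vectType R[i]}.
Context (e : (\dim {:V}).-tuple V) (eb : basis_of {:V} e).
Local Notation E := 'End(V).
Local Notation I := 'I_(\dim {:V}).
Implicit Types (A B g h Y : E) (v w u : V) (x y z : pspace V).
Context (G : set E) (G_group : is_subgroup G) (G_closed : closed_in_GL G).
Context (g_complex : is_csubspace (lie G)).
Context (M : set (pspace V)) (M_closed : closed M) (M_orb : forall x, M x -> M = orb G x).

Local Notation gtr := (fun s t : R => t < s).
Local Notation eqr := (fun s t : R => s == t).

Lemma M_pact g x : G g -> M x -> M (pact g x).
Proof. by move=> Gg Mx; rewrite (M_orb Mx); exists g. Qed.

Lemma opp_levelK (c : I -> R) : opp_level (opp_level c) = c.
Proof. by apply/funext => i; rewrite /opp_level opprK. Qed.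

Lemma flowE_opp X t y : flowE (- X) t y = flowE X (- t) y.
Proof. by rewrite /flowE rmorphN scaleNr scalerN. Qed.

(** What the closure relations need to know of the special flow, in a form that is
    stable under reversing it. *)
Definition regular_flow (c : I -> R) (X : E) : Prop :=
  [/\ eigenbasis e c X, lie G X, triangular e G c
    & forall x, M x -> (forall t, flowE X t x = x) -> exists v s, fixed_gen e G c x v s].

Lemma regular_flow_opp c X : regular_flow c X -> regular_flow (opp_level c) (- X).
Proof.
move=> [h1 h2 h3 h4]; split; [exact: eigenbasis_opp|exact: lieN|exact: triangular_opp|].
move=> x Mx fx; have [|v [s vs]] := h4 x Mx; last by exists v, (- s); exact: fixed_gen_opp.
by move=> t; rewrite -[t]opprK -flowE_opp.
Qed.

Definition fixed X x : Prop := M x /\ forall t, flowE X t x = x.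

Lemma fixed_opp X x : fixed X x -> fixed (- X) x.
Proof. by move=> [Mx fx]; split=> // t; rewrite flowE_opp. Qed.

Section OneFlow.
Context (c : I -> R) (X : E) (rf : regular_flow c X).

Let Xe : eigenbasis e c X. Proof. by case: rf. Qed.
Let gX : lie G X. Proof. by case: rf. Qed.
Let tc : triangular e G c. Proof. by case: rf. Qed.
Let fgen x : fixed X x -> exists v s, fixed_gen e G c x v s.
Proof. by case: rf => _ _ _ H [Mx fx]; exact: H. Qed.

Lemma flow_G t : G (expE (t%:C *: X)).
Proof. exact: (lie_exp (lieZ t gX)). Qed.

Lemma stable_orb x y : fixed X x -> M y ->
  (flowE X t y @[t --> +oo%R] --> x) <-> orb (unip e G c) x y.
Proof.
move=> Fx My; have [v [s fx]] := fgen Fx; have [Mx _] := Fx.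
have Mc : closed (orb G x) by rewrite -(M_orb Mx).
have Oy : orb G x y by rewrite -(M_orb Mx).
have H := stable_cell eb G_group G_closed g_complex Xe gX tc Mc fx Oy.
split=> [/H[g gu ->]|[g gu gy]]; first by exists g.
by apply/H; exists g.
Qed.

(** Every trajectory converges: the line of a vector tends to the line of its
    component of highest level. *)
Lemma orb_cover y : M y -> exists2 x, fixed X x & orb (unip e G c) x y.
Proof.
move=> My; have [u u0 yu] := pspace_gen y.
have [s [v [v0 vs uv _]]] := top_part eb c u0.
have [x xv] := pspace_mk v0.
have yx := flow_limit eb Xe yu xv vs uv.
have Mx : M x.
  apply: M_closed => U Ux; have [T [_ TP]] := yx _ Ux.
  exists (flowE X (T + 1) y); split; first by apply: M_pact => //; exact: flow_G.
  by apply: TP; rewrite ltrDl.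
have Fx : fixed X x by split=> // t; exact: (flow_fixed eb Xe t xv vs).
by exists x => //; apply/stable_orb.
Qed.

Lemma orb_unipM g x y : unip e G c g -> orb (unip e G c) x y -> orb (unip e G c) x (pact g y).
Proof.
move=> gu [h hu <-]; exists (g \o h)%VF.
  exact: (unipM eb G_group G_closed g_complex Xe gX tc gu hu).
by rewrite (pactM _ (groupGL G_group (unip_G gu)) (groupGL G_group (unip_G hu))).
Qed.

Lemma unip1 : unip e G c \1%VF.
Proof.
exists 0; last exact: expE0.
by split; [case: g_complex|exact: pat0].
Qed.

Lemma orb_refl x : orb (unip e G c) x x.
Proof. by exists \1%VF; [exact: unip1|exact: pact1]. Qed.

Lemma orb_M x : M x -> orb (unip e G c) x `<=` M.
Proof. by move=> Mx _ [g gu <-]; apply: M_pact => //; exact: (unip_G gu). Qed.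

Lemma pact_closure (S : set (pspace V)) g z : GL g -> closure S z ->
  (forall y, S y -> S (pact g y)) -> closure S (pact g z).
Proof.
move=> g0 cz Sg; have [w w0 zw] := pspace_gen z.
apply/(pclosureP _ (pact_gen g0 zw)) => d d0.
have q0 : 0 < nmE g + 1 by rewrite ltr_wpDl ?nmE_ge0.
have [w' [y [yw' ww' Sy]]] := (pclosureP S zw).1 cz (d / (nmE g + 1)) (divr_gt0 d0 q0).
exists (g w'), (pact g y); split; [exact: pact_gen| |exact: Sg].
rewrite -linearB; apply: le_lt_trans (nmE_app _ _) _.
apply: (@le_lt_trans _ _ ((nmE g + 1) * nm (w' - w))); last by rewrite mulrC -ltr_pdivlMr.
by rewrite ler_wpM2r ?nm_ge0 // lerDl.
Qed.

Definition br x y : Prop := orb (unip e G c) x `<=` closure_in M (orb (unip e G c) y).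

(** The trajectory of [z] runs from [x], its limit in the past, to [y]. *)
Definition link x y : Prop :=
  exists2 z, orb (unip e G (opp_level c)) x z & orb (unip e G c) y z.

Lemma br_closure x y : M x -> br x y <-> closure (orb (unip e G c) y) x.
Proof.
move=> Mx; split=> [xy|xy _ [g gu <-]]; first by have [] := xy _ (orb_refl x).
split; last by apply: M_pact => //; exact: (unip_G gu).
apply: pact_closure => //; first exact: (groupGL G_group (unip_G gu)).
by move=> z; exact: orb_unipM.
Qed.

(** A point of [N y] near [x] has the form [n n' x] with [n] in [N] and [n'] in
    the opposite group, so [n' x] is in both orbits. *)
Lemma closure_link x y : fixed X x -> M y -> closure (orb (unip e G c) y) x -> link x y.
Proof.
move=> Fx My xy; have [Mx _] := Fx; have [v [s fx]] := fgen Fx; have [xv _ _] := fx.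
have Mc : closed (orb G x) by rewrite -(M_orb Mx).
have [d d0 dP] := big_cell G_group G_closed g_complex tc Mc fx.
have [w [z [zw wv yz]]] := (pclosureP _ xv).1 xy d d0.
have Oz : orb G x z by rewrite -(M_orb Mx); exact: (orb_M My yz).
have [g1 [g2 [u1 u2 zE]]] := dP _ _ zw wv Oz.
exists (pact g2 x); first by exists g2.
have -> : pact g2 x = pact (g1^-1)%VF z.
  by rewrite zE (pactKV _ (groupGL G_group (unip_G u1))).
by apply: orb_unipM => //; exact: unipV.
Qed.

Lemma flow_orb t y z : fixed X y -> orb (unip e G c) y z -> orb (unip e G c) y (flowE X t z).
Proof.
move=> [My fy] [g gu <-]; exists (expconj X t g).
  exact: (expconj_unip eb G_group Xe gX).
by rewrite (flow_expconj _ _ _ (groupGL G_group (unip_G gu))) fy.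
Qed.

End OneFlow.

Section TwoDirections.
Context (c : I -> R) (X : E) (rf : regular_flow c X).

Let rf' : regular_flow (opp_level c) (- X) := regular_flow_opp rf.

(** Backwards in time the trajectory of [z] stays in [N y] and tends to [x]. *)
Lemma link_closure x y : fixed X x -> fixed X y -> link c x y ->
  closure (orb (unip e G c) y) x.
Proof.
move=> Fx Fy [z xz yz]; have [Mx _] := Fx; have Mz := orb_M Mx xz.
have zx := (stable_orb rf' (fixed_opp Fx) Mz).2 xz.
move=> U Ux; have [T [_ TP]] := zx _ Ux.
exists (flowE (- X) (T + 1) z); split; last by apply: TP; rewrite ltrDl.
by rewrite flowE_opp; exact: flow_orb.
Qed.

Lemma br_linkP x y : fixed X x -> fixed X y -> br c x y <-> link c x y.
Proof.
move=> Fx Fy; have [Mx _] := Fx; have [My _] := Fy.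
rewrite (br_closure rf) //; split; [exact: (closure_link rf)|exact: link_closure].
Qed.

Lemma link_opp x y : link (opp_level c) x y <-> link c y x.
Proof. by rewrite /link opp_levelK; split=> -[z h1 h2]; exists z. Qed.

(** A point of the closure is in [N y] for some fixed point [y], and moving it by
    [N] shows that [y] is in the closure. *)
Lemma closure_unip x : fixed X x ->
  closure_in M (orb (unip e G c) x) = [set z | exists y, [/\ fixed X y, br c y x & orb (unip e G c) y z]].
Proof.
move=> Fx; apply/seteqP; split=> [z [cz Mz]|z [y [Fy yx]]]; last exact: yx.
have [y Fy yz] := orb_cover rf Mz; exists y; split=> //.
have [My _] := Fy; apply/(br_closure rf) => //.
have [g gu gz] := yz.
have -> : y = pact (g^-1)%VF z by rewrite -gz (pactKV _ (groupGL G_group (unip_G gu))).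
apply: (pact_closure (groupGL G_group (unip_G (unipV gu))) cz) => w.
by apply: (orb_unipM rf); exact: unipV.
Qed.

(** The point joining [x] and [y] has a generator that is a generator of [x] plus
    terms of higher level, and one that is a generator of [y] plus terms of lower
    level. As the two are proportional, the level of [x] is at most that of [y],
    and if the levels agree only the terms at this level can be proportional. *)
Lemma link_level x y v s v' s' : fixed_gen e G c x v s -> fixed_gen e G c y v' s' ->
  link c x y -> s <= s' /\ (s = s' -> x = y).
Proof.
move=> [xv vs _] [yv' vs' _] [z [g2 u2 g2x] [g1 u1 g1y]].
have [u zu uv] := unip_gen eb G_group u2 xv (lev_opp_eq vs).
have [u' zu' uv'] := unip_gen eb G_group u1 yv' vs'.
rewrite g2x in zu; rewrite g1y in zu'.
have {}uv := lev_opp_gt uv.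
have /vlineP[k uk] : u \in <[u']>%VS by rewrite -zu' zu memv_line.
have u0 := pspace_gen_neq0 zu.
have k0 : k != 0 by apply/eqP => k0; move: u0; rewrite uk k0 scale0r eqxx.
split.
  have [j vj] := coord_neq0 eb (pspace_gen_neq0 xv).
  have /eqP cj := vs _ vj.
  have uj : coord e j u != 0.
    apply/eqP => uj; have := uv j; rewrite linearB /= uj sub0r oppr_eq0 => /(_ vj).
    by rewrite cj ltxx.
  have u'j : coord e j u' != 0.
    by move: uj; rewrite uk linearZ /= mulf_eq0 negb_or => /andP[].
  have [v'j|/vs'/eqP <-] := eqVneq (coord e j v') 0; last by rewrite cj.
  by rewrite -cj ltW //; apply: uv'; rewrite linearB /= v'j subr0.
move=> ss'; apply: val_inj; rewrite xv yv'.
suff vk : v - k *: v' = 0.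
  apply: vline_eqP; first exact: pspace_gen_neq0 xv.
  by rewrite (subr0_eq vk) memvZ ?memv_line.
apply: (lev_disjoint eb (r := eqr) (r' := fun a b => a != b) (s := s)) => [t /eqP -> /eqP //||].
  by apply: levB; [exact: vs|apply: levZ; rewrite ss'; exact: vs'].
have -> : v - k *: v' = k *: (u' - v') - (u - v) by rewrite uk scalerBr opprB [RHS]addrC addrA subrK.
apply: levB; first by apply: levZ; rewrite ss'; apply: sub_lev uv' => a b /= /lt_eqF ->.
by apply: sub_lev uv => a b /= /gt_eqF ->.
Qed.

Lemma br_antisym x y : fixed X x -> fixed X y -> br c x y -> br c y x -> x = y.
Proof.
move=> Fx Fy /(br_linkP Fx Fy) xy /(br_linkP Fy Fx) yx.
have [_ _ _ fgen] := rf.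
have [v [s fx]] := fgen _ Fx.1 Fx.2; have [v' [s' fy]] := fgen _ Fy.1 Fy.2.
have [h1 h2] := link_level fx fy xy; have [h3 _] := link_level fy fx yx.
by apply: h2; apply/eqP; rewrite eq_le h1.
Qed.

Lemma br_trans x y z : M x -> br c x y -> br c y z -> br c x z.
Proof.
move=> Mx xy yz w /xy[cw Mw]; split=> //.
have : closure (closure (orb (unip e G c) z)) w.
  by apply: closure_subset cw => u /yz[].
exact: closed_closure.
Qed.

Lemma br_refl x : M x -> br c x x.
Proof. by move=> Mx z xz; split; [exact: subset_closure|exact: orb_M xz]. Qed.

End TwoDirections.

(** The previous decomposition for the reversed flow, for which links go the other
    way. *)
Lemma closure_opposite c X x : regular_flow c X -> fixed X x ->
  closure_in M (orb (unip e G (opp_level c)) x) =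
  [set z | exists y, [/\ fixed X y, br c x y & orb (unip e G (opp_level c)) y z]].
Proof.
move=> rf Fx; have rf' := regular_flow_opp rf.
rewrite (closure_unip rf' (fixed_opp Fx)); apply/seteqP; split=> z [y [Fy yx yz]].
  have Fy' : fixed X y by rewrite -[X]opprK; exact: fixed_opp.
  exists y; split=> //; apply/(br_linkP rf) => //.
  by apply/link_opp/(br_linkP rf') => //; exact: fixed_opp.
exists y; split=> //; first exact: fixed_opp.
apply/(br_linkP rf'); [exact: fixed_opp|exact: fixed_opp|].
by apply/link_opp/(br_linkP rf).
Qed.

End BruhatOrder.

(** * Adjoints *)

Section Adjoint.
Context {R : realType} {V : vectType R[i]} (dot : {dot V for Num.conj}).
Implicit Types (A B Y Z H : 'End(V)) (u v w : V).

Lemma dotDl u v w : dot (u + v) w = dot u w + dot v w.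
Proof. exact: linearDl. Qed.

Lemma dotZl (k : R[i]) u v : dot (k *: u) v = k * dot u v.
Proof. exact: linearZl_LR. Qed.

Lemma dotDr u v w : dot u (v + w) = dot u v + dot u w.
Proof. exact: linearDr. Qed.

Lemma dotZr (k : R[i]) u v : dot u (k *: v) = k^* * dot u v.
Proof. exact: linearZr_LR. Qed.

Lemma dotBl u v w : dot (u - v) w = dot u w - dot v w.
Proof. exact: linearBl. Qed.

Lemma dotBr u v w : dot u (v - w) = dot u v - dot u w.
Proof. exact: linearBr. Qed.

Lemma dotC u v : dot u v = (dot v u)^*.
Proof. by rewrite (hermC dot) expr0 mul1r. Qed.

Lemma dot_suml (J : Type) (r : seq J) (P : pred J) (F : J -> V) v :
  dot (\sum_(i <- r | P i) F i) v = \sum_(i <- r | P i) dot (F i) v.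
Proof. exact: linear_sumlz. Qed.

Lemma dot_sumr (J : Type) (r : seq J) (P : pred J) (F : J -> V) v :
  dot v (\sum_(i <- r | P i) F i) = \sum_(i <- r | P i) dot v (F i).
Proof. exact: linear_sumr. Qed.

Lemma dot_gt0 u : u != 0 -> 0 < dot u u.
Proof. by move=> u0; rewrite dnorm_gt0. Qed.

Lemma dot_eqr v w : (forall u, dot u v = dot u w) -> v = w.
Proof.
move=> vw; apply/eqP; rewrite -subr_eq0; apply/negP => /negP/dot_gt0.
by rewrite dotBr vw subrr ltxx.
Qed.

(** The vectors dual to a basis are obtained by inverting the map sending [u] to
    the vector whose coordinates are its inner products with the basis. *)
Lemma adj_exists Y : exists Z, forall u v, dot (Y u) v = dot u (Z v).
Proof.
pose b := vbasis {:V}.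
pose f u : V := \sum_(i < \dim {:V}) dot u b`_i *: b`_i.
have fl : linear f.
  move=> k u v; rewrite /f scaler_sumr -big_split; apply: eq_bigr => i _ /=.
  by rewrite dotDl dotZl scalerDl scalerA.
pose fL : {linear V -> V} := HB.pack f (GRing.isLinear.Build _ _ _ _ f fl).
pose L := linfun fL.
have L0 : lker L == 0%VS.
  apply/lker0P => u v; rewrite !lfunE /= => uv.
  have duv (i : 'I_(\dim {:V})) : dot u b`_i = dot v b`_i.
    have := congr1 (coord b i) uv; rewrite !linear_sum /= (bigD1 i) // [in RHS](bigD1 i) //= !linearZ /=.
    rewrite !coord_free ?(basis_free (vbasisP _)) // eqxx !mulr1 !big1 ?addr0 // => j ji;
      by rewrite linearZ /= coord_free ?(basis_free (vbasisP _)) // (negbTE ji) mulr0.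
  apply/eqP; rewrite -subr_eq0; apply/negP => /negP/dot_gt0.
  rewrite {2}(coord_vbasis (memvf (u - v))) dot_sumr big1 ?ltxx // => i _.
  by rewrite dotZr dotBl duv subrr mulr0.
pose w (i : 'I_(\dim {:V})) := (L^-1)%VF b`_i.
have dual i (j : 'I_(\dim {:V})) : dot (w i) b`_j = (i == j)%:R.
  have : L (w i) = b`_i by rewrite (lker0_lfunVK L0).
  rewrite lfunE /= => /(congr1 (coord b j)); rewrite linear_sum /= (bigD1 j) //= linearZ /=.
  rewrite !coord_free ?(basis_free (vbasisP _)) // eqxx mulr1 big1 ?addr0 => [->//|k kj].
  by rewrite linearZ /= coord_free ?(basis_free (vbasisP _)) // (negbTE kj) mulr0.
have wspan u : exists s : 'I_(\dim {:V}) -> R[i], u = \sum_i s i *: w i.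
  exists (fun i => coord b i (L u)).
  rewrite -{1}(lker0_lfunK L0 u) {1}(coord_vbasis (memvf (L u))) linear_sum.
  by apply: eq_bigr => i _; rewrite linearZ.
pose g v : V := \sum_(j < \dim {:V}) (dot (Y (w j)) v)^* *: b`_j.
have gl : linear g.
  move=> k u v; rewrite /g scaler_sumr -big_split; apply: eq_bigr => i _ /=.
  by rewrite dotDr dotZr rmorphD rmorphM /= conjCK scalerDl scalerA.
pose gL : {linear V -> V} := HB.pack g (GRing.isLinear.Build _ _ _ _ g gl).
exists (linfun gL) => u v; rewrite lfunE /=.
have [s ->] := wspan u; rewrite linear_sum !dot_suml; apply: eq_bigr => i _.
rewrite linearZ /= !dotZl; congr (_ * _); rewrite /g dot_sumr (bigD1 i) //= dotZr dual eqxx mulr1 conjCK.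
by rewrite big1 ?addr0 // => j ji; rewrite dotZr dual eq_sym (negbTE ji) mulr0.
Qed.

Lemma adjP Y u v : dot (Y u) v = dot u (adj dot Y v).
Proof.
move: u v; rewrite /adj; have := @xgetPex _ 0 _ (adj_exists Y); exact.
Qed.

Lemma adj_unique Y Z : (forall u v, dot (Y u) v = dot u (Z v)) -> adj dot Y = Z.
Proof. by move=> YZ; apply/lfunP => v; apply: dot_eqr => u; rewrite -adjP YZ. Qed.

Lemma adjPr Y u v : dot u (Y v) = dot (adj dot Y u) v.
Proof. by rewrite dotC adjP -dotC. Qed.

Lemma adjK Y : adj dot (adj dot Y) = Y.
Proof. by apply: adj_unique => u v; rewrite adjPr. Qed.

Lemma adjD Y Z : adj dot (Y + Z) = adj dot Y + adj dot Z.
Proof. by apply: adj_unique => u v; rewrite !add_lfunE dotDl dotDr !adjP. Qed.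

Lemma adjZ (k : R[i]) Y : adj dot (k *: Y) = k^* *: adj dot Y.
Proof. by apply: adj_unique => u v; rewrite !scale_lfunE dotZl dotZr conjCK adjP. Qed.

Lemma adjN Y : adj dot (- Y) = - adj dot Y.
Proof. by rewrite -scaleN1r adjZ rmorphN rmorph1 scaleN1r. Qed.

Lemma adj0 : adj dot 0 = 0.
Proof. by rewrite -(scale0r 0) adjZ rmorph0 !scale0r. Qed.

Lemma adj_comp Y Z : adj dot (Y \o Z)%VF = (adj dot Z \o adj dot Y)%VF.
Proof. by apply: adj_unique => u v; rewrite !comp_lfunE !adjP. Qed.

Lemma adj1 : adj dot \1%VF = \1%VF.
Proof. by apply: adj_unique => u v; rewrite !id_lfunE. Qed.

Lemma conjCR (r : R) : Num.conj (r%:C : R[i]) = r%:C.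
Proof. exact: conjc_real. Qed.

Lemma normc_conj (k : R[i]) : normc k^* = normc k.
Proof.
by case: k => a b /=; rewrite sqrrN.
Qed.

(** Continuity of the adjoint comes for free: it carries the operator norm to a
    norm, and all norms define the same topology. *)
Lemma adj_norm : is_norm (fun Y => nmE (adj dot Y)).
Proof.
split=> [Y Z|k Y|Y].
- by rewrite adjD nmED.
- by rewrite adjZ nmEZ normc_conj.
- by move=> Y0; case: (@nmE_is_norm R V) => _ _ /(_ _ Y0) /(congr1 (adj dot)); rewrite adjK adj0.
Qed.

Lemma adj_powE Y k : adj dot (powE Y k) = powE (adj dot Y) k.
Proof.
elim: k => [|k IH]; first exact: adj1.
rewrite !powES adj_comp IH; symmetry.
by apply: (@powE_intertwine R V (adj dot Y) (adj dot Y) (adj dot Y) k).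
Qed.

Lemma adj_sum (J : Type) (r : seq J) (P : pred J) (F : J -> 'End(V)) :
  adj dot (\sum_(i <- r | P i) F i) = \sum_(i <- r | P i) adj dot (F i).
Proof. exact: (big_morph (adj dot) adjD adj0). Qed.

Lemma adj_exp Y : adj dot (expE Y) = expE (adj dot Y).
Proof.
apply/esym/expE_unique; apply/(norm_cvgP nmE_is_norm) => d d0.
have /(norm_cvgP adj_norm)/(_ _ d0) := @expS_cvg R V Y.
apply: filterS => n /=; rewrite adjD adjN /expS adj_sum.
congr (nmE (_ - _) < d); apply: eq_bigr => k _; rewrite adjZ adj_powE; congr (_ *: _).
by rewrite fmorphV rmorph_nat.
Qed.

End Adjoint.

(** * Simultaneous diagonalisation *)

Section SimultaneousDiagonalization.
Context {R : realType} {V : vectType R[i]} (dot : {dot V for Num.conj}).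
Implicit Types (Y Z H : 'End(V)) (u v w : V) (U : {vspace V}).

Lemma stable_eigenvector H U : U != 0%VS -> (forall u, u \in U -> H u \in U) ->
  exists u k, [/\ u \in U, u != 0 & H u = k *: u].
Proof.
move=> U0 HU; pose b := vbasis U.
pose A : 'M[R[i]]_(\dim U) := \matrix_(i, j) coord b j (H b`_i).
have dU : (0 < \dim U)%N by rewrite lt0n dimv_eq0.
have [k /eigenvalueP[x xA x0]] := eigenvalue_closed A dU.
exists (\sum_i x 0 i *: b`_i), k; split.
- by apply: memv_suml => i _; rewrite memvZ // vbasis_mem // mem_nth // size_tuple.
- apply/eqP => s0; move/eqP: x0; apply; apply/rowP => i; rewrite mxE.
  have := congr1 (coord b i) s0; rewrite linear_sum linear0 /= (bigD1 i) //= linearZ /=.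
  rewrite coord_free ?(basis_free (vbasisP _)) // eqxx mulr1 big1 ?addr0 // => j ji.
  by rewrite linearZ /= coord_free ?(basis_free (vbasisP _)) // (negbTE ji) mulr0.
rewrite linear_sum scaler_sumr.
transitivity (\sum_j (\sum_i x 0 i * A i j) *: b`_j).
  under [RHS]eq_bigr do rewrite scaler_suml.
  rewrite exchange_big; apply: eq_bigr => i _ /=; rewrite linearZ /=.
  have HbU : H b`_i \in U by rewrite HU // vbasis_mem // mem_nth // size_tuple.
  rewrite {1}(coord_vbasis HbU) scaler_sumr; apply: eq_bigr => j _.
  by rewrite scalerA mxE.
apply: eq_bigr => j _; have := congr1 (fun y : 'rV_ _ => y 0 j) xA.
by rewrite !mxE => ->; rewrite scalerA.
Qed.

Context (a : set 'End(V)) (a_comm : forall H1 H2, a H1 -> a H2 -> (H1 \o H2 = H2 \o H1)%VF).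
Context (a_herm : forall H, a H -> forall u v, dot (H u) v = dot u (H v)).

Definition stable U : Prop := forall H u, a H -> u \in U -> H u \in U.

Definition joint_eigen u : Prop := forall H, a H -> exists r : R, H u = r%:C *: u.

(** On a nonzero stable subspace of minimal dimension every operator of a
    commuting family acts as a scalar. *)
Lemma common_eigenvector U : U != 0%VS -> stable U ->
  exists u, [/\ u \in U, u != 0 & joint_eigen u].
Proof.
move=> U0 sU.
pose P n := `[< exists U', [/\ (U' <= U)%VS, U' != 0%VS, stable U' & \dim U' = n] >].
have exP : exists n, P n by exists (\dim U); apply/asboolP; exists U.
case: (ex_minnP exP) => n /asboolP[U' [U'U U'0 sU' Un]] nmin.
have scal H : a H -> exists k, forall u, u \in U' -> H u = k *: u.
  move=> aH; have [u [k [uU u0 Hu]]] := stable_eigenvector U'0 (fun u => sU' H u aH).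
  pose K := (U' :&: lker (H - k *: \1)%VF)%VS.
  have memK w : (w \in K) = (w \in U') && (H w == k *: w).
    by rewrite memv_cap memv_ker add_lfunE opp_lfunE scale_lfunE id_lfunE subr_eq0.
  have KU : K = U'.
    apply/eqP; rewrite eqEdim capvSl /= Un; apply: nmin; apply/asboolP.
    exists K; split=> //; first by rewrite (subv_trans (capvSl _ _)).
      apply/eqP => K0; have : u \in K by rewrite memK uU Hu eqxx.
      by rewrite K0 memv0 (negbTE u0).
    move=> H' w aH'; rewrite !memK => /andP[wU /eqP Hw]; rewrite sU' //=.
    by rewrite -comp_lfunE (a_comm aH aH') comp_lfunE Hw linearZ.
  by exists k => w; rewrite -{1}KU memK => /andP[_ /eqP].
have u0 : vpick U' != 0 by rewrite vpick0.
exists (vpick U'); split=> //; first by apply: (subvP U'U); exact: memv_pick.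
move=> H aH; have [k kP] := scal H aH; exists (complex.Re k).
rewrite kP ?memv_pick //; congr (_ *: _).
have : k = k^*.
  apply: (mulIf (lt0r_neq0 (dot_gt0 dot u0))); rewrite -dotZl -kP ?memv_pick //.
  by rewrite a_herm // kP ?memv_pick // dotZr.
by case: k {kP} => x y /= [] /eqP; rewrite -addr_eq0 -mulr2n mulrn_eq0 /= => /eqP ->.
Qed.

(** The orthogonal complement of a joint eigenvector is stable, the operators being
    Hermitian. *)
Lemma joint_eigen_span U : stable U -> exists bs : seq V,
  [/\ free bs, <<bs>>%VS = U & forall u, u \in bs -> joint_eigen u].
Proof.
elim: {U}(\dim U) {-2}U (erefl (\dim U)) => [|n IH] U dU sU.
  by exists [::]; split=> //; [rewrite nil_free|rewrite span_nil; apply/esym/eqP; rewrite -dimv_eq0 dU].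
have [|u [uU u0 ju]] := common_eigenvector _ sU; first by rewrite -dimv_eq0 dU.
pose U' := (U :&: orthov dot <[u]>)%VS.
have dU' : \dim U' = n.
  rewrite -eq_dim_orthov1 ?dU //; apply/mem_orthovPn; exists u => //.
  by rewrite (lt0r_neq0 (dot_gt0 dot u0)).
have sU' : stable U'.
  move=> H w aH; rewrite !memv_cap => /andP[wU]; rewrite !mem_orthov1 => /eqP wu.
  rewrite sU //=; have [r Hu] := ju _ aH.
  by rewrite a_herm // Hu dotZr wu mulr0.
have [bs [fs sspan sj]] := IH _ dU' sU'.
exists (u :: bs); split.
- rewrite free_cons fs andbT sspan memv_cap uU mem_orthov1.
  by rewrite (lt0r_neq0 (dot_gt0 dot u0)).
- have us : free (u :: bs).
    by rewrite free_cons fs andbT sspan memv_cap uU mem_orthov1 (lt0r_neq0 (dot_gt0 dot u0)).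
  apply/eqP; rewrite eqEdim; apply/andP; split.
    by rewrite span_cons sspan subv_add capvSl andbT -memvE.
  have /eqnP -> := us; have /eqnP := fs; rewrite sspan dU' /= => <-.
  by rewrite dU.
- by move=> v; rewrite inE => /predU1P[->|/sj].
Qed.

Lemma joint_eigenbasis : exists2 e : (\dim {:V}).-tuple V, basis_of {:V} e &
  forall i : 'I_(\dim {:V}), joint_eigen e`_i.
Proof.
have [bs [fs ss sj]] := @joint_eigen_span fullv (fun H u _ _ => memvf _).
have sz : size bs == \dim {:V} by rewrite -ss; apply/eqP/esym/eqnP.
exists (Tuple sz) => [|i]; first by rewrite basisEfree fs /= ss subvv /= (eqP sz).
by apply: sj; rewrite mem_nth //= (eqP sz).
Qed.

End SimultaneousDiagonalization.

(** By induction on the number of nonzero coordinates of [w]. If an operator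
    separates two of them, then subtracting from its value on [w] either of the
    two multiples of [w] makes the support smaller, and the difference of the two
    results is a nonzero multiple of [w]. *)
Lemma diagonal_family (K : fieldType) (W : lmodType K) (J : finType) (phi : J -> W -> K)
    (S : Type) (T : S -> W -> W) (chi : J -> S -> K) (U : set W) :
  (forall j k v w, phi j (k *: v + w) = k * phi j v + phi j w) ->
  (forall v w, (forall j, phi j v = phi j w) -> v = w) ->
  (forall j s w, phi j (T s w) = chi j s * phi j w) ->
  U 0 -> (forall k v w, U v -> U w -> U (k *: v + w)) -> (forall s w, U w -> U (T s w)) ->
  forall w, U w -> exists2 l : seq W,
    forall z, z \in l -> exists j, [/\ U z, phi j z != 0 & forall s, T s z = chi j s *: z]
  & w = \sum_(z <- l) z.
Proof.
move=> phil phii phiT U0 Ul UT w Uw.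
have phi0 j : phi j 0 = 0.
  by have := phil j 1 0 0; rewrite scale1r addr0 mul1r -[X in X = _]addr0 => /addrI.
have phiZ j k v : phi j (k *: v) = k * phi j v by rewrite -[k *: v]addr0 phil phi0 addr0.
have UZ k v : U v -> U (k *: v) by move=> Uv; rewrite -[k *: v]addr0; exact: Ul.
elim: {w}#|[pred j | phi j w != 0]| {-2}w (leqnn #|[pred j | phi j w != 0]|) Uw => [|n IH] w wn Uw.
  exists [::] => //; rewrite big_nil; apply: phii => j; rewrite phi0.
  move: wn; rewrite leqn0 => /eqP/card0_eq/(_ j); rewrite !inE.
  by move=> /negbFE/eqP.
have [/existsP[j jw]|/existsPn w0] := boolP [exists j, phi j w != 0]; last first.
  exists [::] => //; rewrite big_nil; apply: phii => j; rewrite phi0.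
  by apply/eqP; rewrite -[_ == _]negbK w0.
have [/existsP[k /andP[kw sep]]|/existsPn nsep] :=
  boolP [exists k, (phi k w != 0) && `[< exists s, chi k s <> chi j s >]]; last first.
  exists [:: w]; last by rewrite big_seq1.
  move=> z; rewrite inE => /eqP ->; exists j; split=> // s; apply: phii => l.
  rewrite phiT phiZ; have [->|lw] := eqVneq (phi l w) 0; first by rewrite !mulr0.
  congr (_ * _); apply: contrapT => ls; have := nsep l; rewrite lw /= => /asboolPn; apply.
  by exists s.
have /asboolP[s ks] := sep.
(* [part i] has no coordinate at [i]. *)
pose part i := T s w + (- chi i s) *: w.
have phipart i l : phi l (part i) = (chi l s - chi i s) * phi l w.
  by rewrite /part addrC phil phiT mulrBl mulNr addrC.
have Upart i : U (part i) by rewrite /part addrC; apply: Ul => //; exact: UT.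
have decomp i : phi i w != 0 -> exists2 l : seq W,
    forall z, z \in l -> exists j, [/\ U z, phi j z != 0 & forall s, T s z = chi j s *: z]
  & part i = \sum_(z <- l) z.
  move=> iw; apply: IH; last exact: Upart.
  rewrite -ltnS; apply: leq_trans wn; apply: proper_card; apply/properP; split.
    by apply/fintype.subsetP => l; rewrite !inE phipart mulf_eq0 negb_or => /andP[].
  by exists i; rewrite !inE // phipart subrr mul0r eqxx.
have [l1 l1P e1] := decomp _ jw; have [l2 l2P e2] := decomp _ kw.
pose q := (chi k s - chi j s)^-1.
have q0 : q != 0 by rewrite invr_eq0 subr_eq0; apply/eqP.
exists ([seq q *: z | z <- l1] ++ [seq (- q) *: z | z <- l2]).
  have scaled c (l : seq W) : c != 0 ->
      (forall z, z \in l -> exists j, [/\ U z, phi j z != 0 & forall s, T s z = chi j s *: z]) ->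
      forall z, z \in [seq c *: z | z <- l] ->
      exists j, [/\ U z, phi j z != 0 & forall s, T s z = chi j s *: z].
    move=> c0 lP _ /mapP[z /lP[i [Uz iz Tz]] ->]; exists i; split; first exact: UZ.
      by rewrite phiZ mulf_neq0.
    move=> s'; apply: phii => l'; rewrite phiT !phiZ mulrCA -phiT Tz phiZ.
    by rewrite mulrCA.
  move=> z; rewrite mem_cat => /orP[|]; first exact: scaled.
  by apply: scaled => //; rewrite oppr_eq0.
rewrite big_cat !big_map -!scaler_sumr -e1 -e2 /= scaleNr -scalerBr.
have -> : part j - part k = (chi k s - chi j s) *: w.
  rewrite /part opprD addrACA subrr add0r !scaleNr opprK scalerBl addrC //.
by rewrite scalerA mulVf ?scale1r // subr_eq0; apply/eqP.
Qed.

(** * The root decomposition *)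

Section RootDecomposition.
Context {R : realType} {V : vectType R[i]} (dot : {dot V for Num.conj}).
Context (G : set 'End(V)) (G_group : is_subgroup G).
Context (G_theta : thetaG dot @` G `<=` G) (g_complex : is_csubspace (lie G)).
Context (a : set 'End(V)) (a_max : is_maximal_abelian_in_p dot G a).
Context (Xo : a) (Xo_regular : forall alpha, root_set G alpha -> alpha Xo <> 0).
Local Notation E := 'End(V).
Local Notation I := 'I_(\dim {:V}).
Local Notation gtr := (fun s t : R => t < s).
Local Notation eqr := (fun s t : R => s == t).
Implicit Types (Y Z H : E) (u v w : V).

Lemma lieD Y Z : lie G Y -> lie G Z -> lie G (Y + Z).
Proof. by move=> gY gZ; rewrite -[Y]scale1r; case: g_complex => _; apply. Qed.

Lemma lieZc (k : R[i]) Y : lie G Y -> lie G (k *: Y).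
Proof. by move=> gY; rewrite -[_ *: _]addr0; case: g_complex => l0; apply. Qed.

Lemma lie_adj Y : lie G Y -> lie G (adj dot Y).
Proof.
move=> gY t; have gtY : G (expE (- (t%:C *: Y))).
  by rewrite -scaleNr -rmorphN; exact: gY.
have : (thetaG dot @` G) (adj dot (expE (t%:C *: Y))).
  by exists (expE (- (t%:C *: Y))) => //; rewrite /thetaG expEV opprK.
by move=> /G_theta; rewrite adj_exp adjZ conjCR.
Qed.

Lemma a_lie H : a H -> lie G H.
Proof. by case: a_max => _ ap _ _ /ap[]. Qed.

Lemma a_adj H : a H -> adj dot H = H.
Proof. by case: a_max => _ ap _ _ /ap[_]; rewrite /thetaL => /oppr_inj. Qed.

Lemma a_herm H : a H -> forall u v, dot (H u) v = dot u (H v).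
Proof. by move=> aH u v; rewrite adjP a_adj. Qed.

Lemma a_comm H1 H2 : a H1 -> a H2 -> (H1 \o H2 = H2 \o H1)%VF.
Proof. by case: a_max => _ _ ab _ h1 h2; exact/subr0_eq/ab. Qed.

Lemma bracketDr H Y Z : bracket H (Y + Z) = bracket H Y + bracket H Z.
Proof. by rewrite /bracket comp_lfunDl comp_lfunDr opprD addrACA. Qed.

Lemma bracketZr H (k : R[i]) Y : bracket H (k *: Y) = k *: bracket H Y.
Proof. by rewrite /bracket -comp_lfunZr -comp_lfunZl scalerBr. Qed.

Lemma bracketNr H Y : bracket H (- Y) = - bracket H Y.
Proof. by rewrite -scaleN1r bracketZr scaleN1r. Qed.

Lemma bracket_adj H Y : a H -> bracket H (adj dot Y) = - adj dot (bracket H Y).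
Proof.
by move=> aH; rewrite /bracket adjD adjN !adj_comp (a_adj aH) opprB.
Qed.

(** An hermitian element of the Lie algebra that commutes with [a] can be added
    to [a], so by maximality it lies in [a]. *)
Lemma maximal_hermitian P : lie G P -> adj dot P = P ->
  (forall H : a, bracket (\val H) P = 0) -> a P.
Proof.
move=> gP hP aP; have [[a0 aD] ap ab amax] := a_max.
have aP' H : a H -> (H \o P = P \o H)%VF.
  by move=> aH; apply/subr0_eq; exact: (aP (SigSub (mem_set aH))).
pose a' : set E := [set Z | exists2 H, a H & exists r : R, Z = H + r%:C *: P].
have aa' : a `<=` a' by move=> H aH; exists H => //; exists 0; rewrite scale0r addr0.
suff <- : a' = a by exists 0 => //; exists 1; rewrite scale1r add0r.
apply: amax => //.
- split; first exact: aa'.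
  move=> r _ _ [H1 aH1 [s1 ->]] [H2 aH2 [s2 ->]]; exists (r%:C *: H1 + H2); first exact: aD.
  by exists (r * s1 + s2); rewrite rmorphD rmorphM scalerDr scalerDl scalerA addrACA.
- move=> _ [H aH [r ->]]; split.
    by apply: lieD; [exact: a_lie|exact: lieZc].
  by rewrite /thetaL adjD adjZ conjCR a_adj // hP.
- move=> _ _ [H1 aH1 [s1 ->]] [H2 aH2 [s2 ->]]; apply/eqP; rewrite /bracket subr_eq0; apply/eqP.
  rewrite !comp_lfunDl !comp_lfunDr -!comp_lfunZl -!comp_lfunZr (a_comm aH1 aH2).
  by rewrite (aP' _ aH1) (aP' _ aH2) !scalerA (mulrC s1%:C) -!addrA; congr (_ + _); rewrite addrCA.
Qed.

(** The Hermitian and skew-Hermitian parts of [Y] are in the Lie algebra and commute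
    with [a], so maximality applies to the first, and to the second divided by [i]. *)
Lemma centralizer_a Y : lie G Y -> (forall H : a, bracket (\val H) Y = 0) ->
  exists P Q, [/\ a P, a Q & Y = P + 'i%C *: Q].
Proof.
move=> gY aY; have aY' (H : a) : bracket (\val H) (adj dot Y) = 0.
  by rewrite bracket_adj ?aY ?adj0 ?oppr0 //; exact: set_valP.
(* One half, a real number. *)
have [h hh hc] : exists2 h : R[i], h *+ 2 = 1 & Num.conj h = h.
  exists (2^-1)%:C; last exact: conjCR.
  by rewrite -rmorphMn -mulr_natl mulfV ?pnatr_eq0 // rmorph1.
exists (h *: (Y + adj dot Y)), ((- 'i%C * h) *: (Y - adj dot Y)).
have ic : Num.conj ('i%C : R[i]) = - 'i%C by apply/eqP; rewrite eq_complex /= oppr0 !eqxx.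
split.
- apply: maximal_hermitian; first by apply/lieZc/lieD => //; exact: lie_adj.
    by rewrite adjZ adjD adjK hc addrC.
  by move=> H; rewrite bracketZr bracketDr aY aY' addr0 scaler0.
- apply: maximal_hermitian.
  + by apply/lieZc/lieD => //; apply: lieN; exact: lie_adj.
  + have nc : Num.conj (- 'i%C * h) = 'i%C * h by rewrite rmorphM rmorphN /= hc ic opprK.
    by rewrite adjZ nc adjD adjN adjK mulNr scaleNr -scalerN opprB.
  + by move=> H; rewrite bracketZr bracketDr bracketNr aY aY' subr0 scaler0.
- rewrite scalerA mulrA mulrN -expr2 sqr_i opprK mul1r -scalerDr addrACA subrr addr0.
  by rewrite -mulr2n -scalerMnr scalerMnl hh scale1r.
Qed.

Context (e : (\dim {:V}).-tuple V) (eb : basis_of {:V} e) (m : I -> a -> R).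
Context (mP : forall (i : I) (H : a), (\val H : E) e`_i = (m i H)%:C *: e`_i).

Lemma basis_neq0 (i : I) : e`_i != 0.
Proof.
by apply/eqP => ei0; have := coord_self eb i i; rewrite ei0 linear0 eqxx => /esym/eqP; rewrite oner_eq0.
Qed.

Lemma scale_injl (W : lmodType R[i]) (r s : R) (w : W) : w != 0 -> r%:C *: w = s%:C *: w -> r = s.
Proof.
move=> w0 /eqP; rewrite -subr_eq0 -scalerBl scaler_eq0 (negbTE w0) orbF subr_eq0.
by move=> /eqP/complexI.
Qed.

Lemma weight_rdual i : rdual (m i).
Proof.
move=> r H1 H2 H3 E3; apply: (scale_injl (basis_neq0 i)).
rewrite -mP E3 add_lfunE scale_lfunE !mP scalerA -scalerDl.
by rewrite rmorphD rmorphM.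
Qed.

Lemma weight_basis i : weight_set (m i).
Proof.
split; first exact: weight_rdual.
by exists e`_i; [move=> H; exact: mP|exact: basis_neq0].
Qed.

Lemma ent_bracket (H : a) Y i j :
  ent e (bracket (\val H) Y) i j = (m i H - m j H)%:C * ent e Y i j.
Proof.
have cH v : coord e i ((\val H : E) v) = (m i H)%:C * coord e i v.
  exact: (coord_diag eb (d := fun j => (m j H)%:C) v i (mP^~ H)).
rewrite /ent /bracket add_lfunE opp_lfunE !comp_lfunE linearB /= cH mP linearZ /= linearZ /=.
by rewrite rmorphB mulrBl.
Qed.

Lemma nilrad0 : nilrad G Xo 0.
Proof. by exists [::]; split=> //; rewrite big_nil. Qed.

Lemma nilradD Y Z : nilrad G Xo Y -> nilrad G Xo Z -> nilrad G Xo (Y + Z).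
Proof.
move=> [s1 [p1 ->]] [s2 [p2 ->]]; exists (s1 ++ s2); split; last by rewrite big_cat.
by move=> W; rewrite mem_cat => /orP[/p1|/p2].
Qed.

Lemma nilrad_lie Y : nilrad G Xo Y -> lie G Y.
Proof.
move=> [s [sP ->]]; elim: s sP => [|Z s IH] sP.
  by rewrite big_nil; case: g_complex.
rewrite big_cons; apply: lieD.
  by have [|alpha _ []] := sP Z; rewrite ?mem_head.
by apply: IH => W Ws; apply: sP; rewrite inE Ws orbT.
Qed.

Lemma nilrad_root (alpha : a -> R) Y : pos_roots G Xo alpha -> root_space G alpha Y -> nilrad G Xo Y.
Proof.
move=> pa ra; exists [:: Y]; split; last by rewrite big_seq1.
by move=> Z; rewrite inE => /eqP ->; exists alpha.
Qed.

Lemma root_adj (alpha : a -> R) Y : root_space G alpha Y -> root_space G (fun H : a => - alpha H) (adj dot Y).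
Proof.
move=> [gY aY]; split; first exact: lie_adj.
move=> H; rewrite bracket_adj; last exact: set_valP.
by rewrite aY adjZ conjCR rmorphN scaleNr.
Qed.

Lemma root_spaceN (alpha : a -> R) Y : root_space G alpha Y -> root_space G alpha (- Y).
Proof. by move=> [gY aY]; split; [exact: lieN|move=> H; rewrite bracketNr aY scalerN]. Qed.

Lemma rdual_diff i j : rdual (fun H : a => m i H - m j H).
Proof.
move=> r H1 H2 H3 E3; rewrite (weight_rdual i E3) (weight_rdual j E3).
by rewrite mulrBr opprD addrACA.
Qed.

(** Conjugation by exponentials of elements of [a] preserves the Lie algebra and is
    diagonal in the matrix entries. So an element of the Lie algebra is a sum of
    joint eigenvectors inside it, each of which is a root vector or commutes
    with [a]. *)
Lemma root_decomposition Y : lie G Y -> exists Y1 Y2 Y3,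
  [/\ nilrad G Xo Y1, nilrad G Xo (- adj dot Y2), lie G Y3 /\ (forall H : a, bracket (\val H) Y3 = 0)
    & Y = Y1 + (Y2 + Y3)].
Proof.
move=> gY; have [l0 lP] := g_complex.
have conj_lie (H : a) Z : lie G Z -> lie G (expconj (\val H) 1 Z).
  move=> gZ; have gH := lie_exp (lieZ 1 (a_lie (set_valP H))).
  by have := lie_conj G_group gH gZ; rewrite /expconj expEV rmorphN scaleNr.
have [|||s sP ->] := @diagonal_family R[i] E (I * I)%type (fun p Y => ent e Y p.1 p.2) a
  (fun (H : a) Y => expconj (\val H) 1 Y) (fun p (H : a) => (expR (m p.1 H - m p.2 H))%:C) (lie G)
  _ _ _ l0 lP conj_lie Y gY.
- by move=> [i j] k Z W; rewrite /ent add_lfunE scale_lfunE linearD linearZ.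
- by move=> Z W ZW; apply: (ent_eq eb) => i j; exact: (ZW (i, j)).
- by move=> [i j] H Z; rewrite (ent_expconj eb (mP^~ H)) mul1r.
elim: s sP => [|Z s IH] sP.
  exists 0, 0, 0; rewrite big_nil !addr0 adj0 oppr0; split; [exact: nilrad0|exact: nilrad0| |by []].
  split=> // H; rewrite /bracket comp_lfun0l comp_lfun0r subr0 //.
have [|Y1 [Y2 [Y3 [n1 n2 [g3 c3] es]]]] := IH.
  by move=> W Ws; apply: sP; rewrite inE Ws orbT.
have [|[i j] /= [gZ Zij Ze]] := sP Z; first exact: mem_head.
rewrite big_cons es.
have Z0 : Z != 0 by apply: contra Zij => /eqP ->; rewrite /ent zero_lfunE linear0.
pose alpha (H : a) := m i H - m j H.
have rZ : root_space G alpha Z.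
  split=> // H; apply: (ent_eq eb) => k l; rewrite ent_bracket.
  have -> : ent e ((alpha H)%:C *: Z) k l = (alpha H)%:C * ent e Z k l.
    by rewrite /ent scale_lfunE linearZ.
  have [->|kl] := eqVneq (ent e Z k l) 0; first by rewrite !mulr0.
  congr (_%:C * _); apply: (can_inj (@expRK R)); apply/complexI/(mulIf kl).
  have := congr1 (fun W => ent e W k l) (Ze H); rewrite (ent_expconj eb (mP^~ H)) mul1r => ->.
  by rewrite /ent scale_lfunE linearZ.
have [az|anz] := pselect (alpha = fun=> 0).
  exists Y1, Y2, (Z + Y3); split=> //; last by rewrite addrCA (addrCA Z).
  split; first exact: lieD.
  by move=> H; rewrite bracketDr c3 addr0 (rZ.2 H) az scale0r.
have ra : root_set G alpha by split=> //; [exact: rdual_diff|exists Z].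
have [apos|aneg] := ltP 0 (alpha Xo).
  exists (Z + Y1), Y2, Y3; split=> //; last by rewrite addrA.
  apply: nilradD => //; apply: (nilrad_root _ rZ); by split.
exists Y1, (Z + Y2), Y3; split=> //; last by rewrite addrCA -addrA.
rewrite adjD opprD; apply: nilradD => //.
apply: (nilrad_root _ (root_spaceN (root_adj rZ))); split; last first.
  by rewrite oppr_gt0 lt_neqAle aneg andbT; apply/eqP/Xo_regular.
split.
- move=> r H1 H2 H3 E3; have E4 : alpha H3 = r * alpha H1 + alpha H2 := rdual_diff i j E3.
  by rewrite E4 opprD mulrN.
- by move=> az; apply: anz; apply/funext => H; have := congr1 (@^~ H) az => /eqP; rewrite oppr_eq0 => /eqP.
- exists (adj dot Z); first exact: root_adj.
  by apply: contra Z0 => /eqP z; rewrite -[Z](adjK dot) z adj0.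
Qed.

End RootDecomposition.

(** * The special flow and the main theorem *)

Section SpecialFlow.
Context {R : realType} {V : vectType R[i]} (dot : {dot V for Num.conj}).
Context (G : set 'End(V)) (G_group : is_subgroup G) (G_closed : closed_in_GL G).
Context (G_theta : thetaG dot @` G `<=` G) (g_complex : is_csubspace (lie G)).
Context (a : set 'End(V)) (a_max : is_maximal_abelian_in_p dot G a).
Context (Xo : a) (Xo_regular : forall alpha, root_set G alpha -> alpha Xo <> 0).
Local Notation E := 'End(V).
Local Notation I := 'I_(\dim {:V}).
Local Notation gtr := (fun s t : R => t < s).
Local Notation eqr := (fun s t : R => s == t).
Implicit Types (Y Z : E) (u v w : V).
Context (e : (\dim {:V}).-tuple V) (eb : basis_of {:V} e) (m : I -> a -> R).
Context (mP : forall (i : I) (H : a), (\val H : E) e`_i = (m i H)%:C *: e`_i).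
Context (X : a) (X_neg : forall alpha, pos_roots G Xo alpha -> alpha X < 0).
Context (X_sep : forall mu nu, weight_set mu -> weight_set nu -> mu <> nu -> mu X <> nu X).

Definition level (i : I) : R := m i X.
Local Notation c := level.

Lemma level_eigenbasis : eigenbasis e c (\val X).
Proof. by move=> i; exact: mP. Qed.

Lemma root_ent (alpha : a -> R) Z i j : root_space G alpha Z -> ent e Z i j != 0 ->
  c i - c j = alpha X.
Proof.
move=> [_ aZ] Zij; apply/complexI/(mulIf Zij).
have := congr1 (fun W => ent e W i j) (aZ X); rewrite (ent_bracket eb mP) => ->.
by rewrite /ent scale_lfunE linearZ.
Qed.

Lemma nilrad_pat Y : nilrad G Xo Y -> pat e c <%R Y.
Proof.
move=> [s [sP ->]]; elim: s sP => [|Z s IH] sP; first by rewrite big_nil; exact: pat0.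
rewrite big_cons; apply: patD; last by apply: IH => W Ws; apply: sP; rewrite inE Ws orbT.
have [|alpha pa ra] := sP Z; first exact: mem_head.
by move=> i j /(root_ent ra) ij; rewrite -subr_lt0 ij; exact: X_neg.
Qed.

Lemma nilrad_adj_pat Y : nilrad G Xo (- adj dot Y) -> pat e c gtr Y.
Proof.
move=> nY; rewrite -[Y](adjK dot) -[adj dot Y]opprK adjN.
move: (- adj dot Y) nY => {}Y [s [sP ->]].
elim: s sP => [|Z s IH] sP; first by rewrite big_nil adj0 oppr0; exact: pat0.
rewrite big_cons adjD opprD; apply: patD; last by apply: IH => W Ws; apply: sP; rewrite inE Ws orbT.
have [|alpha pa ra] := sP Z; first exact: mem_head.
apply: patN => i j.
move/(root_ent (root_adj G_theta a_max ra)) => ij.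
by rewrite -subr_gt0 ij oppr_gt0; exact: X_neg.
Qed.

Lemma centralizer_pat Y : (forall H : a, bracket (\val H) Y = 0) -> pat e c eqr Y.
Proof.
move=> aY i j Yij; have := congr1 (fun W => ent e W i j) (aY X).
rewrite (ent_bracket eb mP) /ent zero_lfunE linear0 => /eqP.
rewrite mulf_eq0 -/(ent e Y i j) (negbTE Yij) orbF => /eqP/complexI/eqP.
by rewrite subr_eq0.
Qed.

(** The components of [Y] that do not lower the level cancel. *)
Lemma nilradE Y : nilrad G Xo Y <-> lie G Y /\ pat e c <%R Y.
Proof.
split=> [nY|[gY pY]]; first by split; [exact: nilrad_lie nY|exact: nilrad_pat].
have [Y1 [Y2 [Y3 [n1 n2 [g3 c3] YE]]]] :=
  root_decomposition G_group G_theta g_complex a_max Xo_regular eb mP gY.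
suff Y23 : Y2 + Y3 = 0 by rewrite YE Y23 addr0.
apply: (pat_disjoint eb (c := c) (r := <%R) (r' := fun s t : R => t <= s)) => [s t /= h1 h2||].
- by move: (le_lt_trans h2 h1); rewrite ltxx.
- have -> : Y2 + Y3 = Y - Y1 by rewrite YE [RHS]addrC addKr.
  by apply: patB => //; exact: nilrad_pat.
- apply: patD; first by apply: sub_pat (nilrad_adj_pat n2) => s t /= /ltW.
  by apply: sub_pat (centralizer_pat c3) => s t /= /eqP ->.
Qed.

Lemma nilrad_adjE Y : nilrad G Xo (- adj dot Y) <-> lie G Y /\ pat e c gtr Y.
Proof.
split=> [nY|[gY pY]].
  split; last exact: nilrad_adj_pat.
  rewrite -[Y](adjK dot) -[adj dot Y]opprK; apply: (lie_adj G_theta).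
  by apply: lieN; exact: nilrad_lie nY.
have [Y1 [Y2 [Y3 [n1 n2 [g3 c3] YE]]]] :=
  root_decomposition G_group G_theta g_complex a_max Xo_regular eb mP gY.
suff Y13 : Y1 + Y3 = 0 by rewrite YE addrCA Y13 addr0.
apply: (pat_disjoint eb (c := c) (r := gtr) (r' := fun s t : R => s <= t)) => [s t /= h1 h2||].
- by move: (le_lt_trans h2 h1); rewrite ltxx.
- have -> : Y1 + Y3 = Y - Y2 by rewrite YE addrCA [RHS]addrC addKr.
  by apply: patB => //; exact: nilrad_adj_pat.
- apply: patD; first by apply: sub_pat (nilrad_pat n1) => s t /= /ltW.
  by apply: sub_pat (centralizer_pat c3) => s t /= /eqP ->.
Qed.

Lemma Ngrp_unip : Ngrp G Xo = unip e G c.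
Proof. by apply/seteqP; split=> _ [Y /nilradE nY <-]; exists Y. Qed.

Lemma thetaN_unip : thetaN dot G Xo = unip e G (opp_level c).
Proof.
have tE Y : thetaG dot (expE Y) = expE (- adj dot Y) by rewrite /thetaG expEV adj_exp adjN.
apply/seteqP; split=> [_ [_ [Y nY <-] <-]|_ [Y [gY /pat_opp_lt pY] <-]]; rewrite ?tE.
  exists (- adj dot Y) => //.
  have : nilrad G Xo (- adj dot (- adj dot Y)) by rewrite adjN opprK adjK.
  by move=> /nilrad_adjE[h1 h2]; split=> //; apply/pat_opp_lt.
exists (expE (- adj dot Y)); first by exists (- adj dot Y) => //; exact/nilrad_adjE.
by rewrite tE adjN adjK opprK.
Qed.

Lemma level_triangular : triangular e G c.
Proof.
move=> Y gY; have [Y1 [Y2 [Y3 [n1 n2 [g3 c3] ->]]]] :=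
  root_decomposition G_group G_theta g_complex a_max Xo_regular eb mP gY.
exists Y1, Y2, Y3; split=> //; [exact/nilradE|exact/nilrad_adjE|].
by split=> //; exact: centralizer_pat.
Qed.

(** Since [X] separates the weights, a line fixed by its flow consists of weight
    vectors, and the level preserving part of the Lie algebra is [a + i a]. *)
Lemma level_regular (M : set (pspace V)) : regular_flow e G M c (\val X).
Proof.
split; [exact: level_eigenbasis|exact: (a_lie a_max (set_valP X))|exact: level_triangular|].
move=> x Mx fx; have [v v0 xv] := pspace_gen x.
have [s vs] := fixed_lev eb level_eigenbasis xv fx.
exists v, s; split=> // Y gY pY.
have [j vj] := coord_neq0 eb v0.
have weight i : coord e i v != 0 -> m i = m j.
  move=> vi; apply: contrapT => ij.
  apply: (X_sep (weight_basis eb mP i) (weight_basis eb mP j) ij).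
  by rewrite -/(c i) -/(c j) (eqP (vs _ vi)) (eqP (vs _ vj)).
have av (H : a) : (\val H : E) v = (m j H)%:C *: v.
  rewrite {1}(basis_coord eb v) [in RHS](basis_coord eb v) linear_sum scaler_sumr.
  apply: eq_bigr => i _; rewrite linearZ /= mP !scalerA mulrC.
  by have [->|/weight ->] := eqVneq (coord e i v) 0; rewrite ?mulr0.
have [Y1 [Y2 [Y3 [n1 n2 [g3 c3] YE]]]] :=
  root_decomposition G_group G_theta g_complex a_max Xo_regular eb mP gY.
have Y12 : Y1 + Y2 = 0.
  apply: (pat_disjoint eb (c := c) (r := eqr) (r' := fun s t : R => s != t)) => [u t /eqP -> /eqP //||].
    have -> : Y1 + Y2 = Y - Y3 by rewrite YE addrA addrK.
    by apply: patB => //; exact: centralizer_pat.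
  apply: patD; first by apply: sub_pat (nilrad_pat n1) => u t /= /lt_eqF ->.
  by apply: sub_pat (nilrad_adj_pat n2) => u t /= /gt_eqF ->.
have {}YE : Y = Y3 by rewrite YE addrA Y12 add0r.
have [P [Q [aP aQ PQ]]] := centralizer_a G_theta g_complex a_max g3 c3.
have Yv : Y v \in <[v]>%VS.
  rewrite YE PQ add_lfunE scale_lfunE (av (SigSub (mem_set aP))) (av (SigSub (mem_set aQ))).
  by rewrite memvD // ?memvZ // memv_line.
apply: val_inj; rewrite (pact_gen (expE_GL Y) xv) xv; apply: vline_eqP.
  exact: GL_neq0 (expE_GL Y) v0.
apply: expE_stable; last exact: memv_line.
by move=> u /vlineP[k ->]; rewrite linearZ memvZ.
Qed.

End SpecialFlow.

Local Close Scope complex_scope.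
Theorem theorem6p1 (R : realType) (V : vectType R[i])
  (dot : {dot V for Num.conj})
  (G : set 'End(V))
  (G_group : is_subgroup G)
  (G_closed : closed_in_GL G)
  (G_connected : connected (G : set (vtop 'End(V))))
  (G_theta : thetaG dot @` G `<=` G)
  (g_complex : is_csubspace (lie G))
  (a : set 'End(V))
  (a_max : is_maximal_abelian_in_p dot G a)
  (Xo : a)
  (Xo_regular : forall alpha, root_set G alpha -> alpha Xo <> 0)
  (M : set (pspace V))
  (M_orbit : exists x, M = orb G x)
  (M_closed : closed M)
  (xc : pspace V)
  (xc_M : M xc)
  (xc_fixed : forall g, Bgrp dot G Xo g -> pact g xc = xc)
  (X : a)
  (X_neg : forall alpha, pos_roots G Xo alpha -> alpha X < 0)
  (X_sep : forall mu nu, weight_set mu -> weight_set nu -> mu <> nu -> mu X <> nu X) :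
  [/\ (* (i) *)
      forall x y : fixed_points M X,
        (bruhat G Xo x y <-> smale y x) /\
        (bruhat G Xo x y <-> smale_order y x),
      (* (ii) *)
      forall x : fixed_points M X,
        closure_in M (orb (Ngrp G Xo) (\val x)) =
        \bigcup_(y in [set y | bruhat G Xo y x]) orb (Ngrp G Xo) (\val y),
      (* (iii) *)
      forall x : fixed_points M X,
        closure_in M (orb (thetaN dot G Xo) (\val x)) =
        \bigcup_(y in [set y | bruhat G Xo x y])
          orb (thetaN dot G Xo) (\val y)
    & (* (iv) *)
      Relation_Definitions.order (fixed_points M X) (@bruhat R V G a Xo M X)].
Proof.
have [e eb ej] := joint_eigenbasis (a_comm a_max) (a_herm a_max).
have [m mP] : exists m : 'I_(\dim {:V}) -> a -> R,
    forall (i : 'I_(\dim {:V})) (H : a), (\val H : 'End(V)) e`_i = ((m i H)%:C)%C *: e`_i.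
  have [m mP] := choice (fun p : 'I_(\dim {:V}) * a => ej p.1 (\val p.2) (set_valP p.2)).
  by exists (fun i H => m (i, H)) => i H; exact: (mP (i, H)).
have rf := level_regular G_group G_theta g_complex a_max Xo_regular eb mP X_neg X_sep M.
have NE := Ngrp_unip G_group G_theta g_complex a_max Xo_regular eb mP X_neg.
have NE' := thetaN_unip G_group G_theta g_complex a_max Xo_regular eb mP X_neg.
have M_orb x : M x -> M = orb G x.
  have [x0 Mx0] := M_orbit; rewrite Mx0 => -[g Gg <-].
  have Lg := groupGL G_group Gg; apply/seteqP; split=> _ [h Gh <-].
    exists (h \o g^-1)%VF; first by apply: (groupM G_group) => //; exact: groupV.
    have GgV := groupV G_group Gg.
    by rewrite (pactM _ (groupGL G_group Gh) (groupGL G_group GgV)) (pactKV _ Lg).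
  exists (h \o g)%VF; first exact: groupM.
  by rewrite (pactM _ (groupGL G_group Gh) Lg).
pose c := level m X.
have fixP (x : fixed_points M X) : fixed M (\val X) (\val x).
  by have [Mx fx] := set_valP x; split.
have bruE (x y : fixed_points M X) : bruhat G Xo x y = br e G M c (\val x) (\val y).
  by rewrite /bruhat NE.
have opp_flow := regular_flow_opp rf.
have plusE (x : fixed_points M X) z : Wplus M X (\val x) z <-> orb (unip e G c) (\val x) z.
  have [Mx _] := fixP x.
  split=> [[Mz zx]|xz]; first exact/(stable_orb eb G_group G_closed g_complex M_closed M_orb rf (fixP x) Mz).
  have Mz : M z := orb_M M_orb Mx xz.
  by split=> //; exact/(stable_orb eb G_group G_closed g_complex M_closed M_orb rf (fixP x) Mz).
have minusE (x : fixed_points M X) z : Wminus M X (\val x) z <-> orb (unip e G (opp_level c)) (\val x) z.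
  have [Mx _] := fixP x; have Fx := fixed_opp (fixP x).
  have flowN : flowE (- \val X) ^~ z = (fun t => flow X (- t) z).
    by apply/funext => t; exact: flowE_opp.
  split=> [[Mz zx]|xz].
    apply/(stable_orb eb G_group G_closed g_complex M_closed M_orb opp_flow Fx Mz).
    rewrite flowN.
    exact: ((cvgNy_compNP (fun t => flow X t z) (nbhs (\val x))).1 zx).
  have Mz : M z := orb_M M_orb Mx xz.
  have := (stable_orb eb G_group G_closed g_complex M_closed M_orb opp_flow Fx Mz).2 xz.
  rewrite flowN => zx; split=> //.
  exact: ((cvgNy_compNP (fun t => flow X t z) (nbhs (\val x))).2 zx).
have smaleE (x y : fixed_points M X) : smale y x <-> bruhat G Xo x y.
  rewrite bruE (br_linkP eb G_group G_closed g_complex M_closed M_orb rf (fixP x) (fixP y)).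
  split=> [[z [/minusE h1 /plusE h2]]|[z h1 h2]]; first by exists z.
  by exists z; split; [exact/minusE|exact/plusE].
have bru_trans (x y z : fixed_points M X) : bruhat G Xo x y -> bruhat G Xo y z -> bruhat G Xo x z.
  by rewrite !bruE; apply: br_trans; case: (fixP x).
split.
- move=> x y; split; first by split=> /smaleE.
  split=> [/smaleE xy|]; first exact: Relation_Operators.t_step.
  elim=> [u w /smaleE //|u w z _ uw _ wz]; exact: bru_trans wz uw.
- move=> x; rewrite NE (closure_unip eb G_group G_closed g_complex M_closed M_orb rf (fixP x)).
  apply/seteqP; split=> z.
    move=> [y [Fy yx yz]]; have Fy' : fixed_points M X y by case: Fy.
    by exists (SigSub (mem_set Fy')); rewrite /= ?bruE.
  by move=> [y /=]; rewrite bruE => yx yz; exists (\val y); split=> //; exact: fixP.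
- move=> x; rewrite NE' (closure_opposite eb G_group G_closed g_complex M_closed M_orb rf (fixP x)).
  apply/seteqP; split=> z.
    move=> [y [Fy yx yz]]; have Fy' : fixed_points M X y by case: Fy.
    by exists (SigSub (mem_set Fy')); rewrite /= ?bruE.
  by move=> [y /=]; rewrite bruE => yx yz; exists (\val y); split=> //; exact: fixP.
- split.
  + by move=> x; rewrite bruE; apply: br_refl => //; case: (fixP x).
  + by move=> x y z; exact: bru_trans.
  + move=> x y; rewrite !bruE => xy yx; apply: val_inj.
    exact: (br_antisym eb G_group G_closed g_complex M_closed M_orb rf (fixP x) (fixP y)).
Qed.
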